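(* Let $\Phi$ be a Young function with $\Phi\in\Delta_2\cap\nabla_2$, let $b\in BMO(X)$, and let $\varphi_1,\varphi_2:(0,\infty)\to(0,\infty)$ be measurable functions. Suppose there is a constant $C>0$, independent of $r$, such that for all $r>0$ $$\sup_{r<t<\infty}\Big(1+\ln\frac tr\Big)\Phi^{-1}(t^{-Q})\,\operatorname*{ess\,inf}_{t<s<\infty}\frac{\varphi_1(s)}{\Phi^{-1}(s^{-Q})}\le C\,\varphi_2(r).$$ Then the operator $M_b$ is bounded from $M_{\Phi,\varphi_1}(X)$ to $M_{\Phi,\varphi_2}(X)$.
   Context: $(X,d,\mu)$ is a space of homogeneous type: $X$ is a topological space with a quasi-distance $d$ (i.e. $d(x,y)\ge 0$, $d(x,y)=0$ iff $x=y$, $d(x,y)=d(y,x)$, $d(x,y)\le K_1(d(x,z)+d(z,y))$) and a positive measure $\mu$; the balls $B(x,r)=\{y\in X:d(x,y)<r\}$, $r>0$, form a basis of neighborhoods of $x$; $\mu$ is defined on a $\sigma$-algebra containing the balls, and $0<\mu(B(x,2r))\le K_2\mu(B(x,r))<\infty$; $K_1,K_2\ge1$ are constants independent of $x,y,z,r$. Standing assumptions: $\mu(X)=\infty$; the compactly supported continuous functions are dense in $L_1(X,\mu)$; $X$ is $Q$-homogeneous for some $Q>0$, i.e. $K_3^{-1}r^Q\le\mu(B(x,r))\le K_3r^Q$ for all $x\in X$, $r>0$, with a constant $K_3\ge1$. A Young function is a convex, left-continuous $\Phi:[0,\infty)\to[0,\infty]$ with $\lim_{r\to+0}\Phi(r)=\Phi(0)=0$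 and $\lim_{r\to\infty}\Phi(r)=\infty$. $\Phi^{-1}(s)=\inf\{r\ge0:\Phi(r)>s\}$ ($\inf\emptyset=\infty$). $\Phi\in\Delta_2$ means $\Phi(2r)\le k\Phi(r)$ for all $r>0$, for some $k>1$; $\Phi\in\nabla_2$ means $\Phi(r)\le\frac1{2k}\Phi(kr)$ for all $r\ge0$, for some $k>1$. $L_\Phi(X)$ is the set of $f\in L_1^{\rm loc}(X)$ with $\int_X\Phi(\epsilon|f|)d\mu<\infty$ for some $\epsilon>0$, with $\|f\|_{L_\Phi}=\inf\{\lambda>0:\int_X\Phi(|f(x)|/\lambda)d\mu(x)\le1\}$; $\|f\|_{L_\Phi(B)}=\|f\chi_B\|_{L_\Phi}$; $L_\Phi^{\rm loc}(X)$ is the set of $f$ with $f\chi_B\in L_\Phi(X)$ for all balls $B$. For a positive measurable $\varphi$ on $(0,\infty)$, $M_{\Phi,\varphi}(X)$ is the set of $f\in L_\Phi^{\rm loc}(X)$ with $\|f\|_{M_{\Phi,\varphi}}=\sup_{x\in X,r>0}\varphi(r)^{-1}\Phi^{-1}(\mu(B(x,r))^{-1})\|f\|_{L_\Phi(B(x,r))}<\infty$. $BMO(X)$ is the set of $b\in L_1^{\rm loc}(X)$ with $\|b\|_*=\sup_{x\in X,r>0}\frac1{\mu(B(x,r))}\int_{B(x,r)}|b(y)-b_{B(x,r)}|d\mu(y)<\infty$, where $b_B=\frac1{\mu(B)}\int_Bb\,d\mu$. $M_b(f)(x)=\sup_{t>0}\mu(B(x,t))^{-1}\int_{B(x,t)}|b(x)-b(y)||f(y)|d\mu(y)$.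 An operator $T$ is bounded from $A$ to $A'$ if there is $C>0$ with $\|Tf\|_{A'}\le C\|f\|_A$ for all $f\in A$. *)

(* Defs.v *)
From HB Require Import structures.
From mathcomp Require Import all_boot all_order all_algebra.
From mathcomp Require Import all_classical all_reals all_analysis.
From mathcomp Require Import measurable_realfun ess_sup_inf.

Set Implicit Arguments.
Unset Strict Implicit.
Unset Printing Implicit Defensive.

Import Order.TTheory GRing.Theory Num.Theory.
Import numFieldNormedType.Exports.

Local Open Scope classical_set_scope.
Local Open Scope ring_scope.
Local Open Scope ereal_scope.

(* The sigma-algebra is not required to be the Borel one. *)
#[short(type="topMeasurableType")]
HB.structure Definition TopMeasurable disp :=
  {T of Topological T & Measurable disp T}.

Section space.
Context {R : realType} {disp : measure_display} {X : topMeasurableType disp}.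
Implicit Types (d : X -> X -> R) (mu : {measure set X -> \bar R}).

Definition qball d (x : X) (r : R) : set X := [set y | (d x y < r)%R].

Record homogeneous_type d mu (K1 K2 : R) : Prop := HomogeneousType {
  ht_K1 : (1 <= K1)%R ;
  ht_K2 : (1 <= K2)%R ;
  ht_ge0 : forall x y, (0 <= d x y)%R ;
  ht_eq0 : forall x y, d x y = 0%R <-> x = y ;
  ht_sym : forall x y, d x y = d y x ;
  ht_triangle : forall x y z, (d x y <= K1 * (d x z + d z y))%R ;
  ht_nbhs : forall (x : X) (A : set X),
    nbhs x A <-> exists2 r : R, (0 < r)%R & qball d x r `<=` A ;
  ht_measurable : forall (x : X) (r : R), (0 < r)%R -> measurable (qball d x r) ;
  ht_gt0 : forall (x : X) (r : R), (0 < r)%R -> 0 < mu (qball d x (2 * r)) ;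
  ht_doubling : forall (x : X) (r : R), (0 < r)%R ->
    mu (qball d x (2 * r)) <= K2%:E * mu (qball d x r) ;
  ht_fin : forall (x : X) (r : R), (0 < r)%R -> K2%:E * mu (qball d x r) < +oo }.

Definition Cc_dense_L1 mu : Prop :=
  forall f : X -> R, mu.-integrable [set: X] (EFin \o f) ->
  forall e : R, (0 < e)%R ->
  exists g : X -> R, [/\ continuous g, compact (closure [set x | g x != 0%R]),
    mu.-integrable [set: X] (EFin \o g) &
    \int[mu]_x `|f x - g x|%:E < e%:E].

Definition homogeneous_dim d mu (Q K3 : R) : Prop :=
  forall (x : X) (r : R), (0 < r)%R ->
    (K3^-1 * r `^ Q)%:E <= mu (qball d x r) <= (K3 * r `^ Q)%:E.

(* Balls, rather than compact sets, are the bounded sets used for local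
   integrability: X need not be complete, and averages over all balls have to
   make sense. *)
Definition L1loc d mu (f : X -> R) : Prop :=
  measurable_fun [set: X] f /\
  forall (x : X) (r : R), (0 < r)%R -> mu.-integrable (qball d x r) (EFin \o f).

Definition avg d mu (b : X -> R) (x : X) (r : R) : R :=
  ((fine (mu (qball d x r)))^-1 * \int[mu]_(y in qball d x r) b y)%R.

Definition BMO_norm d mu (b : X -> R) : \bar R :=
  ereal_sup [set z | exists (x : X) (r : R), (0 < r)%R /\
    z = (mu (qball d x r))^-1 *
        \int[mu]_(y in qball d x r) `|b y - avg d mu b x r|%:E].

Definition BMO d mu : set (X -> R) :=
  [set b | L1loc d mu b /\ BMO_norm d mu b < +oo].

Definition maximal_commutator d mu (b f : X -> R) (x : X) : \bar R :=
  ereal_sup [set z | exists2 t : R, (0 < t)%R &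
    z = (mu (qball d x t))^-1 *
        \int[mu]_(y in qball d x t) (`|b x - b y| * `|f y|)%:E].

End space.

Section young.
Context {R : realType}.
Implicit Types (Phi : R -> \bar R).

(* Only the values of Phi on [0, +oo[ are meaningful. *)
Record young_function Phi : Prop := YoungFunction {
  young_ge0 : forall r : R, (0 <= r)%R -> 0 <= Phi r ;
  young_convex : forall x y t : R, (0 <= x)%R -> (0 <= y)%R ->
    (0 <= t <= 1)%R ->
    Phi (t * x + (1 - t) * y)%R <= t%:E * Phi x + (1 - t)%:E * Phi y ;
  young_left_continuous : forall r : R, (0 < r)%R -> Phi s @[s --> r^'-] --> Phi r ;
  young0 : Phi 0%R = 0 ;
  young_cvg0 : Phi s @[s --> 0%R^'+] --> 0 ;
  young_cvgy : Phi s @[s --> +oo%R] --> +oo }.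

Definition young_inv Phi (s : \bar R) : \bar R :=
  ereal_inf [set r%:E | r in [set r : R | (0 <= r)%R /\ s < Phi r]].

Definition Delta2 Phi : Prop := exists2 k : R, (1 < k)%R &
  forall r : R, (0 < r)%R -> Phi (2 * r)%R <= k%:E * Phi r.

Definition nabla2 Phi : Prop := exists2 k : R, (1 < k)%R &
  forall r : R, (0 <= r)%R -> Phi r <= ((2 * k)^-1)%:E * Phi (k * r)%R.

(* Phi(+oo) = +oo, so that Phi can be applied to the [0, +oo]-valued
   function |f| when f = M_b(f). *)
Definition young_ext Phi (x : \bar R) : \bar R :=
  if x is r%:E then Phi r else +oo.

End young.

Section spaces_of_functions.
Context {R : realType} {disp : measure_display} {X : topMeasurableType disp}.
Variables (d : X -> X -> R) (mu : {measure set X -> \bar R}).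
Implicit Types (Phi : R -> \bar R) (phi : R -> R).

Definition modular Phi (c : R) (f : X -> \bar R) : \bar R :=
  \int[mu]_x young_ext Phi (c%:E * `|f x|).

Definition luxemburg_norm Phi (f : X -> \bar R) : \bar R :=
  ereal_inf [set l%:E | l in
    [set l : R | (0 < l)%R /\ modular Phi l^-1 f <= 1]].

Definition orlicz Phi : set (X -> R) :=
  [set f | L1loc d mu f /\
    exists2 e : R, (0 < e)%R & modular Phi e (EFin \o f) < +oo].

(* f \_ B extends f by point, which is 0 in both R and \bar R, so it is
   f * chi_B. *)
Definition orlicz_loc Phi : set (X -> R) :=
  [set f | forall (x : X) (r : R), (0 < r)%R -> orlicz Phi (f \_ (qball d x r))].

Definition orlicz_morrey_norm Phi phi (f : X -> \bar R) : \bar R :=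
  ereal_sup [set z | exists (x : X) (r : R), (0 < r)%R /\
    z = ((phi r)^-1)%:E * young_inv Phi (mu (qball d x r))^-1 *
        luxemburg_norm Phi (f \_ (qball d x r))].

Definition orlicz_morrey Phi phi : set (X -> R) :=
  [set f | orlicz_loc Phi f /\
    orlicz_morrey_norm Phi phi (EFin \o f) < +oo].

End spaces_of_functions.

(* Lebesgue (not only Borel) measurability, with a Borel target. *)
Definition lebesgue_measurable_fun {R : realType} (D : set R) (f : R -> R) :=
  forall Y : set R, measurable Y ->
    completed_algebra_gen (@lebesgue_measure R) (D `&` f @^-1` Y).

Definition ess_inf_above {R : realType} (t : R) (f : R -> \bar R) : \bar R :=
  ess_inf (mrestr (@lebesgue_measure R) (measurable_itv `]t, +oo[)) f.

(* The target is given by its norm only, T f being possibly +oo-valued. *)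
Definition bounded_operator {R : realType} {U V : Type}
    (A : set U) (normA : U -> \bar R) (normA' : V -> \bar R) (T : U -> V) :=
  exists2 C : R, (0 < C)%R & forall f, A f -> normA' (T f) <= C%:E * normA f.

(* Main.v *)
(** The averages of |b(x) - b(y)| |f(y)| over the balls B(y,t) centred in
    B = B(x,r) are split at t = r.

    For t >= r, a ball B(y,t) lies in B(x,2Kt), and Young's inequality
    a s <= a^m + s^p together with the logarithmic growth of the averages of b
    bounds the average by (1 + |b(y) - b_B|) times a supremum over t > r of
    (1 + ln(t/r)) times the p-mean of f over B(x,t); the latter is controlled by
    the hypothesis on phi1 and phi2, because p is smaller than the lower index of
    Phi.

    For t <= r, the balls are sorted by the size 2^i of the p-mean of f. For each
    i a Vitali selection covers the centres of the balls of level i by dilates of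
    disjoint balls, on each of which the oscillation of b has bounded moments by
    the John-Nirenberg inequality, so that a ball selected at level i contributes
    Phi(2^i) times its measure. Summing over i recovers the modular of f since p
    is smaller than the lower index of Phi.

    Nothing is known about the measurability of maximal functions, so
    they are always estimated through measurable majorants. *)

Require Import Defs.
From mathcomp Require Import all_boot all_order all_algebra.
From mathcomp Require Import all_classical all_reals all_analysis.
From mathcomp Require Import measurable_realfun ess_sup_inf.
From mathcomp Require Import ring lra.
Set Implicit Arguments.
Unset Strict Implicit.
Unset Printing Implicit Defensive.
Import Order.TTheory GRing.Theory Num.Theory.
Import numFieldNormedType.Exports.
Local Open Scope classical_set_scope.
Local Open Scope ring_scope.
Local Open Scope ereal_scope.

(** * Ahlfors regular quasi-metric spaces *)

(** The obstacle is that |b(y) - b(z)| couples the centre with the variable of integration, so [b]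
    and [f] cannot be estimated separately on small balls. Young's inequality is therefore used at
    height 2^i: |b(y) - b(z)| h(z) <= 2^i (|b(y) - b(z)|^(m+2) + 2^(-ip) h(z)^p) with p =
    (m+2)/(m+1). A ball on which h has p-mean about 2^i then yields 2^i (1 + w), where w is a moment
    of [b] alone. By Delta_2, Phi(2^i (1 + w)) is at most a constant times (1 + w)^N Phi(2^i), and
    (1 + w)^N has a bounded mean over the dilated ball covering the centre. This is why the
    oscillation is measured on each selected ball, and why high moments of [b] enter.

    The form of p makes its conjugate exponent the integer m + 2; nabla_2 gives a lower growth
    exponent above 1, and p falls below it for m large.

    Constants must not depend on the ball, so Phi is replaced by Phi(us)/Phi(u) with u =
    Phi^(-1)(r^(-Q)); all these functions share their growth constants. *)

Record ahlfors_space (R : realType) (disp : measure_display)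
    (X : topMeasurableType disp) (d : X -> X -> R)
    (mu : {measure set X -> \bar R}) (K Q D : R) : Prop := AhlforsSpace {
  rs_K : (1 <= K)%R ;
  rs_Q : (0 < Q)%R ;
  rs_D : (1 <= D)%R ;
  rs_ge0 : forall x y, (0 <= d x y)%R ;
  rs_refl : forall x, d x x = 0%R ;
  rs_sym : forall x y, d x y = d y x ;
  rs_triangle : forall x y z, (d x y <= K * (d x z + d z y))%R ;
  rs_nbhs : forall (x : X) (A : set X), nbhs x A ->
    exists2 r : R, (0 < r)%R & qball d x r `<=` A ;
  rs_measurable : forall (x : X) (r : R), (0 < r)%R -> measurable (qball d x r) ;
  rs_dim : homogeneous_dim d mu Q D }.

(** * Monotonicity and linearity of integrals *)

Section integral.
Context {d : measure_display} {T : measurableType d} {R : realType}.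
Variable mu : {measure set T -> \bar R}.

(* Without measurability, the integral of a nonnegative function is its lower
   integral, hence still monotone. *)
Lemma ge0_le_lower_integral (A B : set T) (f g : T -> \bar R) : A `<=` B ->
  (forall x, A x -> 0 <= f x <= g x) -> (forall x, B x -> 0 <= g x) ->
  \int[mu]_(x in A) f x <= \int[mu]_(x in B) g x.
Proof.
move=> AB fg g0; rewrite integral_mkcond [leRHS]integral_mkcond.
have f0' x : 0 <= (f \_ A) x.
  by apply: erestrict_ge0 => y /fg /andP[].
have g0' x : 0 <= (g \_ B) x by exact: erestrict_ge0.
rewrite !ge0_integralTE//; apply: le_ereal_sup => _ [h hf <-].
exists h => // x; apply: le_trans (hf x) _.
rewrite !patchE; case: ifPn => [/set_mem Ax|_].
  by rewrite mem_set; [have /andP[] := fg _ Ax|exact: AB].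
by case: ifPn => // /set_mem/g0.
Qed.

Lemma ge0_integralDT (D : set T) (f g : T -> \bar R) : measurable D ->
  measurable_fun setT f -> measurable_fun setT g ->
  (forall x, 0 <= f x) -> (forall x, 0 <= g x) ->
  \int[mu]_(x in D) (f x + g x) =
  \int[mu]_(x in D) f x + \int[mu]_(x in D) g x.
Proof.
by move=> mD mf mg f0 g0; apply: ge0_integralD => //; exact: measurable_funTS.
Qed.

Lemma ge0_integralZlT (D : set T) (k : R) (f : T -> \bar R) : measurable D ->
  measurable_fun setT f -> (forall x, 0 <= f x) -> (0 <= k)%R ->
  \int[mu]_(x in D) (k%:E * f x) = k%:E * \int[mu]_(x in D) f x.
Proof.
by move=> mD mf f0 k0; apply: ge0_integralZl => //; exact: measurable_funTS.
Qed.

End integral.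

(** * Balls and the Vitali covering argument *)

Section geometry.
Context {R : realType} {disp : measure_display} {X : topMeasurableType disp}.
Context {d : X -> X -> R} {mu : {measure set X -> \bar R}} {K Q D : R}.
Hypothesis hs : ahlfors_space d mu K Q D.
Local Notation B := (qball d).

Lemma qball_le0 x r : (r <= 0)%R -> B x r = set0.
Proof.
move=> r0; apply/seteqP; split => y //=; rewrite /qball/= => h.
by have := lt_le_trans h r0; rewrite ltNge (rs_ge0 hs).
Qed.

Lemma measurable_qball x r : measurable (B x r).
Proof.
by have [r0|r0] := ltP 0%R r; [exact: (rs_measurable hs)|rewrite qball_le0].
Qed.

Lemma qball_center x r : (0 < r)%R -> B x r x.
Proof. by move=> r0; rewrite /qball/= (rs_refl hs). Qed.

Lemma mu_qball_le x r : (0 <= r)%R -> mu (B x r) <= (D * r `^ Q)%:E.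
Proof.
rewrite le_eqVlt => /predU1P[<-|r0].
  by rewrite qball_le0// measure0 powR0 ?mulr0// gt_eqF// (rs_Q hs).
by have /andP[] := rs_dim hs x r0.
Qed.

Lemma mu_qball_ge x r : (0 < r)%R -> (D^-1 * r `^ Q)%:E <= mu (B x r).
Proof. by move=> r0; have /andP[] := rs_dim hs x r0. Qed.

Lemma mu_qball_lty x r : mu (B x r) < +oo.
Proof.
have [r0|r0] := leP 0%R r; last by rewrite qball_le0 ?measure0 1?ltW.
exact: le_lt_trans (mu_qball_le x r0) (ltry _).
Qed.

Lemma qball_subset x y r s t : (d x y < s)%R -> (K * (s + t) <= r)%R ->
  B y t `<=` B x r.
Proof.
move=> xy str z /=; rewrite /qball/= => yz.
apply: lt_le_trans str; apply: le_lt_trans (rs_triangle hs x z y) _.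
have K0 : (0 < K)%R by exact: lt_le_trans (rs_K hs).
by rewrite ltr_pM2l// ltrD.
Qed.

(** Two uses of the quasi-triangle inequality: d(c,y) < 3Kr, then K(3Kr + 2r) <= 5K^2 r. The
    hypothesis t <= 2r is what a greedy choice within a factor 2 of the largest radius provides. *)
Lemma qball_meet_subset y t c r w : (t <= 2 * r)%R -> B y t w -> B c r w ->
  B y t `<=` B c (5 * K ^+ 2 * r)%R.
Proof.
rewrite /qball/= => tr yw cw.
have K1 := rs_K hs.
have r0 : (0 < r)%R by exact: le_lt_trans (rs_ge0 hs _ _) cw.
have cy : (d c y < 3 * K * r)%R.
  apply: le_lt_trans (rs_triangle hs c y w) _.
  have : (d c w + d w y < 3 * r)%R by rewrite (rs_sym hs w y); lra.
  by rewrite -(ltr_pM2l (lt_le_trans ltr01 K1)) mulrCA mulrA.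
apply: (qball_subset cy).
have h : (2 * r <= 2 * K * r)%R by rewrite ler_pM2r// ler_peMr.
have : (3 * K * r + t <= 5 * K * r)%R by lra.
rewrite -(ler_pM2l (lt_le_trans ltr01 K1)) => /le_trans; apply.
by rewrite le_eqVlt (_ : K * (5 * K * r) = 5 * K ^+ 2 * r)%R ?eqxx//; ring.
Qed.

Lemma mu_bigcup_qball_le (c : nat -> X) (rho : nat -> R) s : (0 <= s)%R ->
  (forall i, 0 <= rho i)%R ->
  mu (\bigcup_i B (c i) (s * rho i)%R) <=
  (D * s `^ Q)%:E * \sum_(i <oo) (rho i `^ Q)%:E.
Proof.
move=> s0 rho0; rewrite -nneseriesZl; last by move=> *; rewrite lee_fin powR_ge0.
apply: (@le_trans _ _ (\sum_(i <oo) mu (B (c i) (s * rho i)%R))).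
  apply: measure_sigma_subadditive => //.
  - by move=> i; exact: measurable_qball.
  - by apply: bigcup_measurable => i _; exact: measurable_qball.
apply: lee_nneseries => // i _.
rewrite -EFinM -mulrA -powRM//; apply: mu_qball_le; exact: mulr_ge0.
Qed.

(* Greedy Vitali selection. An index i with rho i = 0, hence an empty ball,
   selects nothing. *)
Lemma qball_selection (x0 : X) (P : X -> R -> Prop) (U : set X) :
  measurable U -> mu U < +oo ->
  (forall y t, P y t -> (0 < t)%R /\ B y t `<=` U) ->
  exists (c : nat -> X) (rho : nat -> R), [/\
    forall i, rho i = 0%R \/ P (c i) (rho i),
    trivIset [set: nat] (fun i => B (c i) (rho i)) &
    forall y t, P y t -> exists i, (0 < rho i)%R /\
      B y t `<=` B (c i) (5 * K ^+ 2 * rho i)%R].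
Proof.
move=> mU Uoo PU.
have D0 : (0 < D)%R by exact: lt_le_trans (rs_D hs).
have Q0 := rs_Q hs.
have [M M0 UM] : exists2 M : R, (0 <= M)%R & mu U = M%:E.
  exists (fine (mu U)); first exact: fine_ge0.
  by rewrite fineK// ge0_fin_numE.
(* Regularity bounds the admissible radii through the measure of [U], so the suprema taken below are
   finite. *)
have tT y t : P y t -> (t <= (D * M) `^ Q^-1)%R.
  move=> /PU[t0 BU].
  have : (t `^ Q <= D * M)%R.
    have : mu (B y t) <= mu U.
      by apply: le_measure => //; rewrite inE//; exact: measurable_qball.
    rewrite UM => /(le_trans (mu_qball_ge y t0)).
    by rewrite lee_fin ler_pdivrMl.
  have Qi : (0 <= Q^-1)%R by rewrite invr_ge0 ltW.
  move=> /(ge0_ler_powR Qi); rewrite !nnegrE powR_ge0 mulr_ge0 ?(ltW D0)//.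
  by rewrite -powRrM mulfV ?gt_eqF// powRr1 ?(ltW t0)//; exact.
pose free (V : set X) y t := P y t /\ B y t `&` V = set0.
(* Here [V] is the union of the balls selected so far. The next ball avoids it and has more than
   half of the supremal radius still possible; if no candidate is left, the dummy radius 0 is
   returned. *)
have /choice[sel selP] : forall V : set X, exists a : X * R,
    (a.2 = 0%R /\ forall y t, ~ free V y t) \/
    (free V a.1 a.2 /\ forall y t, free V y t -> (t <= 2 * a.2)%R).
  move=> V; have [[y0 [t0 f0]]|nf] := pselect (exists y t, free V y t); last first.
    by exists (x0, 0%R); left; split=> // y t f; apply: nf; exists y, t.
  pose T := [set t | exists y, free V y t].
  have supT : has_sup T.
    split; first by exists t0, y0.
    by exists ((D * M) `^ Q^-1)%R => t [y [/tT]].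
  have t0S : (t0 <= sup T)%R by apply: ub_le_sup; [exact: supT.2|exists y0].
  have [t0p _] := PU _ _ f0.1.
  have [t1 [y1 f1] t1S] : exists2 t, T t & (sup T / 2 < t)%R.
    have S0 : (0 < sup T / 2)%R by rewrite divr_gt0// (lt_le_trans t0p).
    by have [t Tt] := sup_adherent S0 supT; exists t => //; lra.
  exists (y1, t1); right; split => //= y t f.
  have : (t <= sup T)%R by apply: ub_le_sup; [exact: supT.2|exists y].
  by lra.
pose V := fix V (n : nat) : set X :=
  if n is n'.+1 then V n' `|` B (sel (V n')).1 (sel (V n')).2 else set0.
pose c n := (sel (V n)).1; pose rho n := (sel (V n)).2.
have VS n : V n.+1 = V n `|` B (c n) (rho n) by [].
have Vle i j : (i <= j)%N -> V i `<=` V j.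
  elim: j => [|j ih]; first by rewrite leqn0 => /eqP->.
  by rewrite leq_eqVlt => /predU1P[->//|/ih VV] x /VV; rewrite VS; left.
have BV n : B (c n) (rho n) `&` V n = set0.
  have [[r0 _]|[[_ //] _]] := selP (V n).
  by rewrite qball_le0 ?set0I// /rho r0.
have tB : trivIset [set: nat] (fun i => B (c i) (rho i)).
  apply/trivIsetP => i j _ _.
  wlog ij : i j / (i < j)%N.
    by move=> h; rewrite neq_lt => /orP[ij|ji]; [|rewrite setIC]; apply: h;
       rewrite ?(ltn_eqF ij) ?(ltn_eqF ji).
  move=> _; rewrite -subset0 -(BV j) setIC; apply: setIS.
  by apply: (@subset_trans _ (V i.+1)); [rewrite VS; right|exact: Vle].
exists c, rho; split => //.
  move=> i; have [[r0 _]|[[p _] _]] := selP (V i); [by left|by right].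
move=> y t Pyt; have [t0 BU] := PU _ _ Pyt.
(* A ball that is never met stays a candidate forever, so all selected radii are at least t/2;
   infinitely many disjoint balls of measure at least [a] would then fit into [U]. *)
have [n yV] : exists n, B y t `&` V n !=set0.
  apply: contrapT => /forallNP nV.
  have fr n : free (V n) y t by split=> //; apply: contrapT => /eqP/set0P/nV.
  have rt n : P (c n) (rho n) /\ (t / 2 <= rho n)%R.
    have [[_ /(_ _ _ (fr n))//]|[[p _] /(_ _ _ (fr n)) h]] := selP (V n).
    by split => //; rewrite /rho; lra.
  have muB n : (D^-1 * (t / 2) `^ Q)%:E <= mu (B (c n) (rho n)).
    have [p tr] := rt n; have [r0 _] := PU _ _ p.
    apply: le_trans (mu_qball_ge _ r0); rewrite lee_fin ler_pM2l ?invr_gt0//.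
    by apply: (ge0_ler_powR (ltW Q0)) => //; rewrite nnegrE ltW// divr_gt0.
  set a := (D^-1 * (t / 2) `^ Q)%R in muB.
  have a0 : (0 < a)%R by rewrite mulr_gt0 ?invr_gt0 ?powR_gt0 ?divr_gt0.
  have sumn n : (n%:R * a <= M)%R.
    rewrite -lee_fin -UM.
    apply: (@le_trans _ _ (mu (\bigcup_i B (c i) (rho i)))); last first.
      apply: le_measure; rewrite ?inE//.
        by apply: bigcup_measurable => i _; exact: measurable_qball.
      by move=> x [i _]; have [/PU[_ +] _] := rt i; apply.
    rewrite measure_bigcup//; last by move=> i _; exact: measurable_qball.
    apply: le_trans (nneseries_lim_ge n _); last by [].
    elim: n => [|n ih]; first by rewrite mul0r big_nil.
    rewrite big_mkcond big_nat_recr//= -big_mkcond/= in_setT.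
    by rewrite -natr1 mulrDl mul1r EFinD leeD.
  have := sumn (Num.truncn (M / a)).+1.
  rewrite -ler_pdivlMr// leNgt => /negP; apply.
  by rewrite truncnS_gt// num_real.
(* Just before it is first met the ball is still a candidate, whence t <= 2 * rho i, and the ball it
   meets is the one selected at that stage. *)
have [i [yi Vi]] : exists i, B y t `&` V i = set0 /\ B y t `&` V i.+1 !=set0.
  elim: n yV => [|n ih]; first by rewrite /= setI0 => -[].
  have [/ih//|/set0P/negP/negPn/eqP n0 n1] := pselect (B y t `&` V n !=set0).
  by exists n.
have fr : free (V i) y t by [].
have [[_ /(_ _ _ fr)//]|[[p _] /(_ _ _ fr) h]] := selP (V i).
have [r0 _] := PU _ _ p.
exists i; split => //.
have [w [yw]] := Vi.
rewrite VS => -[Vw|Bw].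
  by have : (B y t `&` V i) w by []; rewrite yi.
exact: qball_meet_subset h yw Bw.
Qed.

(** The selected balls are disjoint, so their lower bounds for the integral of [g] add up inside
    [U]. Sums of rho^Q stand in for sums of measures, and a dummy radius 0 contributes 0 because Q >
    0. *)
Lemma qball_covering (x0 : X) (P : X -> R -> Prop) (U : set X) (lam : R)
    (g : X -> \bar R) :
  (0 < lam)%R -> measurable U -> mu U < +oo ->
  (forall y t, P y t -> (0 < t)%R /\ B y t `<=` U) ->
  measurable_fun setT g -> (forall y, 0 <= g y) ->
  (forall y t, P y t -> (lam * t `^ Q)%:E <= \int[mu]_(z in B y t) g z) ->
  exists (c : nat -> X) (rho : nat -> R), [/\
    forall i, rho i = 0%R \/ P (c i) (rho i),
    \sum_(i <oo) (rho i `^ Q)%:E <= (lam^-1)%:E * \int[mu]_(z in U) g z &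
    forall y t, P y t -> exists i, (0 < rho i)%R /\
      B y t `<=` B (c i) (5 * K ^+ 2 * rho i)%R].
Proof.
move=> lam0 mU Uoo PU mg g0 Pg.
have [c [rho [Pc tB cov]]] := qball_selection x0 mU Uoo PU.
exists c, rho; split => //.
rewrite lee_pdivlMl// -nneseriesZl; last by move=> *; rewrite lee_fin powR_ge0.
apply: (@le_trans _ _ (\int[mu]_(z in \bigcup_i B (c i) (rho i)) g z)); last first.
  apply: ge0_subset_integral => //.
  - by apply: bigcup_measurable => i _; exact: measurable_qball.
  - exact: measurable_funTS.
  - move=> x [i _]; have [->|/PU[_ +]] := Pc i; last exact.
    by rewrite qball_le0.
rewrite ge0_integral_bigcup//.
- apply: lee_nneseries => i *; first by rewrite mule_ge0 ?lee_fin ?powR_ge0 ?ltW.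
  have [->|/Pg//] := Pc i.
  rewrite powR0 ?gt_eqF ?(rs_Q hs)// mule0; exact: integral_ge0.
- by move=> i; exact: measurable_qball.
- exact: measurable_funTS.
Qed.

End geometry.

(** * Differentiation of integrals *)

Section lebesgue_points.
Context {R : realType} {disp : measure_display} {X : topMeasurableType disp}.
Context {d : X -> X -> R} {mu : {measure set X -> \bar R}} {K Q D : R}.
Hypothesis hs : ahlfors_space d mu K Q D.
Hypothesis dense : Cc_dense_L1 mu.
Local Notation B := (qball d).
Local Notation kap := (5 * K ^+ 2)%R.

(* The form of Lebesgue's differentiation theorem that the John-Nirenberg
   stopping argument needs. The gap between A and 2A avoids taking limits of
   averages: w is compared with a continuous function within A / 3. *)
Lemma lebesgue_gap (w : X -> R) (x0 : X) (r0 A del eps : R) :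
  measurable_fun setT w -> (forall x, 0 <= w x)%R ->
  (forall x r, \int[mu]_(y in B x r) (w y)%:E < +oo) ->
  (0 < A)%R -> (0 < del)%R -> (0 < eps)%R ->
  exists S, [/\ measurable S, mu S <= eps%:E &
    forall y, B x0 r0 y -> (2 * A < w y)%R ->
      (forall r, (0 < r <= del)%R ->
        \int[mu]_(z in B y r) (w z)%:E <= A%:E * mu (B y r)) -> S y].
Proof.
move=> mw w0 iw A0 del0 eps0.
have K0 : (0 < K)%R by exact: lt_le_trans (rs_K hs).
have D0 : (0 < D)%R by exact: lt_le_trans (rs_D hs).
pose U := B x0 (K * (r0 + del))%R.
have mU : measurable U by exact: (measurable_qball hs).
(* Chosen so that 2A - 2e = A + e: near a point where w > 2A and |v - g| < e, the continuous [g]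
   still exceeds [A] by [e]. *)
pose e := (A / 3)%R.
have e0 : (0 < e)%R by rewrite divr_gt0.
(* The term 1 is for the points where |v - g| is large, the other one for the balls on which it has
   a large average; both are multiplied by eta / e, and [eta] makes the total equal to [eps]. *)
pose N := (1 + D ^+ 2 * kap `^ Q)%R.
have N0 : (0 < N)%R.
  by rewrite ltr_pwDl// mulr_ge0 ?powR_ge0// sqr_ge0.
pose eta := (eps * e / N)%R.
have eta0 : (0 < eta)%R by exact: divr_gt0 (mulr_gt0 _ _) N0.
pose v := w \_ U.
have mv : measurable_fun setT v.
  by apply/(measurable_restrictT _ _).1 => //; exact: measurable_funTS.
have iv : mu.-integrable [set: X] (EFin \o v).
  apply/integrableP; split; first exact/measurable_EFinP.
  apply: le_lt_trans (iw x0 (K * (r0 + del))%R).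
  rewrite [X in _ <= X]integral_mkcond; apply: ge0_le_lower_integral => // x _.
    rewrite abse_ge0 /v /= !patchE; case: ifPn => _ //=.
      by rewrite ger0_norm// lexx.
    by rewrite normr0 lexx.
  by apply: erestrict_ge0 => y _; rewrite lee_fin.
have [g [cg _ ig gv]] := dense iv eta0.
pose h z := `|v z - g z|%R.
have mg : measurable_fun setT g.
  by apply/measurable_EFinP; case/integrableP : ig.
have mh : measurable_fun setT h.
  by apply: measurableT_comp => //; exact: measurable_funB.
have mhE : measurable_fun setT (EFin \o h) by exact/measurable_EFinP.
have h0 z : (0 <= h z)%R by exact: normr_ge0.
pose S1 := [set z | (e <= h z)%R].
have mS1 : measurable S1.
  rewrite (_ : S1 = setT `&` h @^-1` `[e, +oo[%classic).
    by apply: mh => //.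
  by rewrite setTI; apply/seteqP; split => z /=; rewrite in_itv/= andbT.
have muS1 : mu S1 <= (eta / e)%:E.
  rewrite mulrC EFinM lee_pdivlMl// -integral_cst//.
  apply: le_trans (ltW gv); apply: ge0_le_lower_integral => // x.
  by rewrite /= lee_fin ltW.
pose P y t := [/\ B x0 r0 y, (0 < t <= del)%R &
  ((e / D) * t `^ Q)%:E <= \int[mu]_(z in B y t) (h z)%:E].
have PU y t : P y t -> (0 < t)%R /\ B y t `<=` U.
  move=> [x0y /andP[t0 td] _]; split=> //.
  by apply: (qball_subset hs x0y); rewrite ler_pM2l// lerD2l.
have [c [rho [Pc sumr cov]]] := qball_covering hs x0 (divr_gt0 e0 D0) mU
  (mu_qball_lty hs _ _) PU mhE (fun z => h0 z)
  (fun y t p => let: And3 _ _ q := p in q).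
have rho0 i : (0 <= rho i)%R.
  by have [->//|[_ /andP[/ltW]]] := Pc i.
have kap0 : (0 <= kap)%R by rewrite mulr_ge0// sqr_ge0.
pose S2 := \bigcup_i B (c i) (kap * rho i)%R.
have mS2 : measurable S2.
  by apply: bigcup_measurable => i _; exact: (measurable_qball hs).
have muS2 : mu S2 <= (D ^+ 2 * kap `^ Q * (eta / e))%:E.
  apply: le_trans (mu_bigcup_qball_le hs c kap0 rho0) _.
  apply: (@le_trans _ _ ((D * kap `^ Q)%:E * ((e / D)^-1%:E * eta%:E))).
    apply: lee_wpmul2l; first by rewrite lee_fin mulr_ge0 ?powR_ge0 ?(ltW D0).
    apply: le_trans sumr _; apply: lee_wpmul2l.
      by rewrite lee_fin invr_ge0 divr_ge0 ?(ltW D0) ?(ltW e0).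
    apply: le_trans (ltW gv); apply: ge0_le_lower_integral => // x _.
    by rewrite lee_fin h0 lexx.
  rewrite -!EFinM lee_fin invf_div le_eqVlt; apply/orP; left; apply/eqP.
  by field; rewrite !gt_eqF.
exists (S1 `|` S2); split; first exact: measurableU.
  apply: le_trans (measureU2 _ _ _) _ => //.
  apply: le_trans (leeD muS1 muS2) _; rewrite -EFinD lee_fin le_eqVlt.
  apply/orP; left; apply/eqP; rewrite /eta /N; field.
  by rewrite !gt_eqF//=.
move=> y x0y wy avgy.
have [S1y|nS1y] := pselect (S1 y); first by left.
right.
have hy : (h y < e)%R by rewrite ltNge; exact/negP.
have Uy : U y.
  apply: (qball_subset hs x0y (t := del)) => //; exact: (qball_center hs).
have vE z : U z -> v z = w z by move=> Uz; rewrite /v patchE mem_set.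
have gy : (2 * A - e < g y)%R.
  by move: hy; rewrite /h vE// ltr_norml => /andP[]; lra.
have [r1 r10 r1g] : exists2 r : R, (0 < r)%R &
    B y r `<=` [set z | `|g y - g z| < e]%R.
  apply: (rs_nbhs hs).
  have := cg y; move/cvgrPdist_lt => /(_ e e0); exact.
pose r := Num.min r1 del.
have r_gt0 : (0 < r)%R by rewrite lt_min r10.
have rdel : (r <= del)%R by rewrite ge_min lexx orbT.
have rr1 : (r <= r1)%R by rewrite ge_min lexx.
have BU : B y r `<=` U.
  by apply: (qball_subset hs x0y); rewrite ler_pM2l// lerD2l.
(* On this ball w + h >= A + e while [w] averages at most [A], so [h] averages at least [e] and the
   ball is one of those covered by [S2]. *)
have key : e%:E * mu (B y r) <= \int[mu]_(z in B y r) (h z)%:E.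
  have muf : A%:E * mu (B y r) \is a fin_num.
    by rewrite fin_numM// ge0_fin_numE// (mu_qball_lty hs).
  rewrite -(@leeD2lE _ (A%:E * mu (B y r)))// -ge0_muleDl ?lee_fin ?(ltW A0) ?(ltW e0)//.
  apply: (@le_trans _ _ (\int[mu]_(z in B y r) ((w z)%:E + (h z)%:E))).
    rewrite -integral_cst; last exact: (measurable_qball hs).
    apply: ge0_le_lower_integral => //= z yz; last first.
      by rewrite adde_ge0// lee_fin.
    rewrite -!EFinD !lee_fin addr_ge0 ?(ltW A0) ?(ltW e0)//=.
    have : (`|g y - g z| < e)%R.
      by apply: r1g; exact: lt_le_trans yz rr1.
    rewrite ltr_norml => /andP[_ gyz].
    have : (g z - w z <= h z)%R.
      by rewrite /h vE; [rewrite distrC ler_norm|exact: BU].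
    by rewrite /e in gy gyz *; lra.
  rewrite ge0_integralDT//; last first.
  - exact/measurable_EFinP.
  - exact: (measurable_qball hs).
  by apply: leeD => //; apply: avgy; rewrite r_gt0.
have Pyr : P y r.
  split=> //; first by rewrite r_gt0.
  apply: le_trans key; rewrite -mulrA EFinM lee_pmul2l ?lte_fin//.
  exact: (mu_qball_ge hs).
have [i [_ Bi]] := cov _ _ Pyr.
by exists i => //; apply: Bi; exact: (qball_center hs).
Qed.

End lebesgue_points.

(** * Series, powers and geometric levels *)

Section series.
Context {R : realType}.

Lemma nneseries_le (u : nat -> \bar R) (M : \bar R) : (forall i, 0 <= u i) ->
  (forall n, \sum_(0 <= i < n) u i <= M) -> \sum_(i <oo) u i <= M.
Proof.
by move=> u0 uM; apply: lime_le; [exact: is_cvg_nneseries|exact: nearW].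
Qed.

Lemma nneseries_ge (u : nat -> \bar R) k : (forall i, 0 <= u i) ->
  u k <= \sum_(i <oo) u i.
Proof.
move=> u0; apply: le_trans (nneseries_lim_ge k.+1 _) => //.
by rewrite big_nat_recr//= leeDr// sume_ge0.
Qed.

Lemma nneseries_geometric_le (a q : R) : (0 <= a)%R -> (0 <= q < 1)%R ->
  \sum_(i <oo) (a * q ^+ i)%:E <= (a / (1 - q))%:E.
Proof.
move=> a0 /andP[q0 q1]; apply: nneseries_le => [i|n].
  by rewrite lee_fin mulr_ge0// exprn_ge0.
rewrite sumEFin lee_fin -mulr_sumr ler_wpM2l// -div1r ler_pdivlMr ?subr_gt0//.
have := subrX1 q n; rewrite big_mkord => h.
have := exprn_ge0 n q0; lra.
Qed.

End series.

Lemma powR_invl {R : realType} (x q : R) : (0 <= x)%R ->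
  (x^-1 `^ q = (x `^ q)^-1)%R.
Proof. by move=> x0; rewrite -powR_inv1// -powRrM mulN1r powRN. Qed.

Lemma powR_exprn {R : realType} (x q : R) n : (0 <= x)%R ->
  ((x `^ q) ^+ n = (x ^+ n) `^ q)%R.
Proof.
move=> x0; rewrite -(powR_mulrn n (powR_ge0 x q)) -(powR_mulrn n x0).
by rewrite -!powRrM mulrC.
Qed.

Lemma powR_div {R : realType} (x y q : R) : (0 <= x)%R -> (0 <= y)%R ->
  ((x / y) `^ q = x `^ q / y `^ q)%R.
Proof. by move=> x0 y0; rewrite powRM ?invr_ge0// powR_invl. Qed.

Lemma level_exists {R : realType} (q a : R) : (1 < q)%R -> (1 < a)%R ->
  exists k : nat, (q ^+ k < a <= q ^+ k.+1)%R.
Proof.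
move=> q1 a1.
have q0 : (0 < q)%R by exact: lt_trans q1.
have a0 : (0 < a)%R by exact: lt_trans a1.
have ex : exists n, (a <= q ^+ n)%R.
  exists (Num.truncn (ln a / ln q)).+1.
  rewrite -ler_ln ?posrE ?exprn_gt0// lnXn// -mulr_natl.
  by rewrite -ler_pdivrMr ?ln_gt0// ltW// truncnS_gt// num_real.
case: (ex_minnP ex) => -[|k] ak mk; first by move: ak; rewrite expr0 leNgt a1.
exists k; rewrite ak andbT ltNge; apply/negP => /mk.
by rewrite ltnn.
Qed.

Lemma exprD_le {R : realType} (x y : R) n : (0 <= x)%R -> (0 <= y)%R ->
  ((x + y) ^+ n <= 2 ^+ n * (x ^+ n + y ^+ n))%R.
Proof.
move=> x0 y0; wlog xy : x y x0 y0 / (x <= y)%R.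
  move=> h; have [/h|/ltW/h] := leP x y; first exact.
  by rewrite addrC [(y ^+ n + _)%R]addrC; apply.
apply: (@le_trans _ _ ((2 * y) ^+ n)%R).
  by apply: lerXn2r; rewrite ?nnegrE ?addr_ge0 ?mulr_ge0//; lra.
by rewrite exprMn ler_wpM2l ?exprn_ge0// lerDr exprn_ge0.
Qed.

(** * A maximal function estimate inside a set of finite measure *)

Section local_maximal.
Context {R : realType} {disp : measure_display} {X : topMeasurableType disp}.
Context {d : X -> X -> R} {mu : {measure set X -> \bar R}} {K Q D : R}.
Hypothesis hs : ahlfors_space d mu K Q D.
Local Notation B := (qball d).
Local Notation kap := (5 * K ^+ 2)%R.

Let D0 : (0 < D)%R := lt_le_trans ltr01 (rs_D hs).
Let mB x r : measurable (B x r) := measurable_qball hs x r.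

(* The strong type estimate L^(n+1) -> L^n, n < n+1, on a set of finite measure,
   from the weak type estimate at n+1. *)
Lemma local_maximal n : exists2 C, (0 <= C)%R &
  forall (U : set X) (H : X -> R) (x0 : X), measurable U -> mu U < +oo ->
  measurable_fun setT H -> (forall x, 0 <= H x)%R ->
  \int[mu]_(x in U) (H x ^+ n.+1)%:E < +oo ->
  exists W : X -> \bar R, [/\ measurable_fun setT W, (forall x, 0 <= W x),
    \int[mu]_(x in U) W x <=
      C%:E * (mu U + \int[mu]_(x in U) (H x ^+ n.+1)%:E) &
    forall y t, (0 < t)%R -> B y t `<=` U -> exists w, [/\ (0 <= w)%R,
      \int[mu]_(z in B y t) (H z)%:E <= (w * t `^ Q)%:E &
      (w ^+ n)%:E <= W y]].
Proof.
have kap0 : (0 <= kap)%R by rewrite mulr_ge0// sqr_ge0.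
pose C1 := (2 ^+ n.+1 * (D * kap `^ Q))%R.
have C10 : (0 <= C1)%R by rewrite !mulr_ge0 ?exprn_ge0 ?powR_ge0 ?(ltW D0).
have Dn0 : (0 <= (D + 1) ^+ n)%R by rewrite exprn_ge0// addr_ge0// ltW.
exists ((D + 1) ^+ n * (1 + C1))%R; first by rewrite mulr_ge0 ?addr_ge0.
move=> U H x0 mU Uoo mH H0 Hoo.
pose g x : \bar R := (H x ^+ n.+1)%:E.
have g0 x : 0 <= g x by rewrite lee_fin exprn_ge0.
have mg : measurable_fun setT g.
  by apply/measurable_EFinP; exact: measurable_funX.
(* Means of H^(n+1) of size q^i correspond to means of [H] of size 2^i. *)
pose q : R := (2 ^+ n.+1)%R.
have q1 : (1 < q)%R by rewrite exprn_egt1// ltr1n.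
have q0 i : (0 < q ^+ i)%R by rewrite exprn_gt0// (lt_trans _ q1).
pose P i y t := [/\ (0 < t)%R, B y t `<=` U &
  (q ^+ i * t `^ Q)%:E <= \int[mu]_(z in B y t) g z].
have /choice[V hV] : forall i, exists V : set X, [/\ measurable V,
    mu V <= ((D * kap `^ Q) * (q ^+ i)^-1)%:E * \int[mu]_(z in U) g z &
    forall y t, P i y t -> V y].
  move=> i.
  have PU y t : P i y t -> (0 < t)%R /\ B y t `<=` U by case.
  have [c [rho [Pc sumr cov]]] := qball_covering hs x0 (q0 i) mU Uoo PU mg g0
    (fun y t p => let: And3 _ _ h := p in h).
  have rho0 j : (0 <= rho j)%R by have [->//|[/ltW]] := Pc j.
  exists (\bigcup_j B (c j) (kap * rho j)%R); split.
  - exact: bigcup_measurable.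
  - apply: le_trans (mu_bigcup_qball_le hs c kap0 rho0) _.
    rewrite [X in _ <= X * _]EFinM -muleA; apply: lee_wpmul2l => //.
    by rewrite lee_fin mulr_ge0 ?powR_ge0 ?(ltW D0).
  - move=> y t Py; have [j [_ Bj]] := cov _ _ Py.
    exists j => //; apply: Bj; apply: (qball_center hs).
    by case: Py.
have mV i : measurable (V i) by case: (hV i).
(* The weight 2^((i+1)n) on a set of measure O(2^(-i(n+1))) leaves the summable factor 2^(-i): this
   is what the loss of one exponent buys. *)
pose u i y : \bar R := (2 ^+ (i.+1 * n))%:E * (\1_(V i) y)%:E.
have u0 i y : 0 <= u i y by rewrite mule_ge0// lee_fin exprn_ge0.
have mu_ i : measurable_fun setT (u i).
  by apply: measurable_funeM; apply/measurable_EFinP; exact: measurable_indic.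
have msum : measurable_fun setT (fun y => \sum_(i <oo) u i y).
  exact: ge0_emeasurable_sum.
have sum0 y : 0 <= \sum_(i <oo) u i y by exact: nneseries_ge0.
have mS : measurable_fun setT (fun y => 1 + \sum_(i <oo) u i y).
  exact: emeasurable_funD.
have S0 y : 0 <= 1 + \sum_(i <oo) u i y by rewrite adde_ge0.
exists (fun y => ((D + 1) ^+ n)%:E * (1 + \sum_(i <oo) u i y)); split.
- exact: measurable_funeM.
- by move=> y; rewrite mule_ge0.
- rewrite ge0_integralZlT//.
  rewrite [in leRHS]EFinM -muleA; apply: lee_wpmul2l => //.
  rewrite ge0_integralDT// integral_cst// mul1e integral_nneseries//; last first.
    by move=> i; exact: measurable_funTS.
  set G := \int[mu]_(x in U) (H x ^+ n.+1)%:E in Hoo *.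
  have G0 : 0 <= G by apply: integral_ge0 => z _; exact: g0.
  rewrite ge0_muleDr//.
  apply: leeD.
    rewrite -[leLHS]mul1e; apply: lee_wpmul2r => //.
    by rewrite lee_fin lerDl.
  have GE : G = (fine G)%:E by rewrite fineK// ge0_fin_numE.
  apply: (@le_trans _ _
    (\sum_(i <oo) (2 ^+ n * (D * kap `^ Q) * fine G * 2^-1 ^+ i)%:E)).
    apply: lee_nneseries => i *; first by apply: integral_ge0 => y _; exact: u0.
    have mind : measurable_fun setT (fun y => (\1_(V i) y : R)%:E).
      by apply/measurable_EFinP; exact: measurable_indic.
    rewrite ge0_integralZlT// integral_indic//.
    have [_ muV _] := hV i.
    apply: (@le_trans _ _ ((2 ^+ (i.+1 * n))%:E *
        (((D * kap `^ Q) * (q ^+ i)^-1)%:E * G))).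
      apply: lee_wpmul2l => //; apply: le_trans muV.
      by apply: le_measure; rewrite ?inE//; exact: measurableI.
    rewrite GE -!EFinM lee_fin /q le_eqVlt; apply/orP; left; apply/eqP.
    rewrite mulSn exprD exprVn -exprM mulSn exprD mulnC.
    by field; rewrite !expf_neq0.
  apply: le_trans (nneseries_geometric_le _ _) _.
  + by rewrite !mulr_ge0 ?exprn_ge0 ?powR_ge0 ?(ltW D0) ?fine_ge0.
  + by lra.
  rewrite GE -EFinM lee_fin /= (_ : 1 - 2^-1 = 2^-1 :> R)%R; last by lra.
  have fG0 : (0 <= fine G)%R by exact: fine_ge0.
  rewrite invrK.
  have -> : (2 ^+ n * (D * kap `^ Q) * fine G * 2 = C1 * fine G)%R.
    by rewrite /C1 (exprS _ n); ring.
  by rewrite ler_wpM2r// lerDr.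
move=> y t t0 BU.
have tQ : (0 < t `^ Q)%R by exact: powR_gt0.
have Joo : \int[mu]_(z in B y t) g z < +oo.
  apply: le_lt_trans Hoo; apply: ge0_le_lower_integral => // z _; last exact: g0.
  by rewrite lexx andbT; exact: g0.
pose J := (fine (\int[mu]_(z in B y t) g z) / t `^ Q)%R.
have JE : \int[mu]_(z in B y t) g z = (J * t `^ Q)%:E.
  rewrite /J divfK ?gt_eqF// fineK// ge0_fin_numE.
    exact: Joo.
  by apply: integral_ge0 => z _; exact: g0.
(* The pointwise bound H <= s + s^(-n) H^(n+1) takes the place of Jensen's inequality and costs the
   factor D + 1. *)
have main s : (0 < s)%R -> (J <= s ^+ n.+1)%R ->
    \int[mu]_(z in B y t) (H z)%:E <= ((D + 1) * s * t `^ Q)%:E.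
  move=> s0 Js.
  apply: (@le_trans _ _
    (\int[mu]_(z in B y t) (s%:E + (s ^- n)%:E * g z))).
    apply: ge0_le_lower_integral => // z _; last first.
      by rewrite adde_ge0 ?mule_ge0// ?lee_fin ?invr_ge0 ?exprn_ge0// ltW.
    rewrite /g -EFinM -EFinD !lee_fin H0/=.
    have h0 : (0 <= s ^- n * H z ^+ n.+1)%R.
      by rewrite mulr_ge0 ?invr_ge0 ?exprn_ge0// ltW.
    have [Hs|/ltW sH] := leP (H z) s; first by rewrite (le_trans Hs)// lerDl.
    apply: (@le_trans _ _ (s ^- n * H z ^+ n.+1)%R); last by rewrite lerDr ltW.
    rewrite mulrC exprS -mulrA ler_peMr//.
    by rewrite -exprVn -exprMn exprn_ege1// ler_pdivlMr// mul1r.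
  have gg0 z : 0 <= (s ^- n)%:E * g z.
    by rewrite mule_ge0// lee_fin invr_ge0 exprn_ge0// ltW.
  rewrite ge0_integralDT//; last 2 first.
  - exact: measurable_funeM.
  - by rewrite lee_fin ltW.
  rewrite integral_cst// ge0_integralZlT//; last first.
    by rewrite invr_ge0 exprn_ge0// ltW.
  rewrite JE -EFinM.
  have -> : ((D + 1) * s * t `^ Q)%:E = s%:E * (D * t `^ Q)%:E + (s * t `^ Q)%:E.
    by rewrite -EFinM -EFinD; congr EFin; ring.
  apply: leeD.
    apply: lee_wpmul2l; first by rewrite lee_fin ltW.
    by apply: (mu_qball_le hs); exact: ltW.
  rewrite lee_fin mulrA ler_pM2r// mulrC ler_pdivrMr ?exprn_gt0//.
  by rewrite -exprS.
(* The levels start at 1; smaller means are paid for by the constant term of the majorant. *)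
have [J1|J1] := leP J 1%R.
  exists ((D + 1) * 1)%R; split.
  - by rewrite mulr1 addr_ge0// ltW.
  - by apply: main => //; rewrite expr1n.
  - by rewrite mulr1 -[leLHS]mule1; apply: lee_wpmul2l => //; rewrite leeDl.
have [i /andP[qJ Jq]] := level_exists q1 J1.
have s0 : (0 < 2 ^+ i.+1 :> R)%R by exact: exprn_gt0.
exists ((D + 1) * 2 ^+ i.+1)%R; split.
- by rewrite mulr_ge0 ?addr_ge0// ltW.
- by apply: main => //; rewrite -exprM mulnC exprM.
rewrite exprMn EFinM; apply: lee_wpmul2l => //.
apply: (@le_trans _ _ (u i y)).
  have [_ _ VP] := hV i.
  rewrite /u indicE mem_set ?mule1 ?lee_fin -?exprM//.
  apply: (VP y t); split => //; rewrite JE lee_fin ler_pM2r//; exact: ltW.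
apply: le_trans (nneseries_ge i (u0^~ y)) _.
by rewrite leeDr.
Qed.

End local_maximal.

(** * Young functions *)

Section growth.
Context {R : realType}.

(** These are the properties of s |-> F(us)/F(u) that are uniform in u, see [growth_rescale]; what
    is deduced from them has constants independent of the ball. *)
Record growth (Psi : R -> R) (N : nat) (L p0 : R) : Prop := Growth {
  growth_homo : {homo Psi : s t / (s <= t)%R} ;
  growth_ge0 : forall s, (0 <= Psi s)%R ;
  growth1 : Psi 1%R = 1%R ;
  growth_upper : forall a s, (1 <= a)%R -> (0 <= s)%R ->
    (Psi (a * s) <= L * a ^+ N * Psi s)%R ;
  growth_lower : forall s t, (0 < s)%R -> (s <= t)%R ->
    (Psi s <= L * (s / t) `^ p0 * Psi t)%R }.

(** According to whether s <= a^(m+1) or not, one of the two terms alone dominates the product, so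
    the constant is 1. The integer exponent is meant for the oscillation of [b]. *)
Lemma young_split (m : nat) (a s : R) : (0 <= a)%R -> (0 <= s)%R ->
  (a * s <= a ^+ m.+2 + s `^ (m.+2%:R / m.+1%:R))%R.
Proof.
move=> a0 s0; have [sa|/ltW as_] := leP s (a ^+ m.+1)%R.
  rewrite -[leLHS]addr0 lerD ?powR_ge0// [leRHS]exprS.
  by rewrite ler_wpM2l.
rewrite -[leLHS]add0r lerD ?exprn_ge0//.
have -> : (m.+2%:R / m.+1%:R = m.+1%:R^-1 + 1 :> R)%R.
  by rewrite -[in LHS]natr1; field; rewrite addrC natr1.
rewrite powRD; last by rewrite gt_eqF// addr_gt0.
rewrite powRr1// ler_wpM2r//.
apply: (@le_trans _ _ ((a ^+ m.+1) `^ m.+1%:R^-1)%R).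
  by rewrite -powR_mulrn// -powRrM mulfV// powRr1.
by apply: ge0_ler_powR; rewrite ?nnegrE ?exprn_ge0.
Qed.

Lemma geometric_below (q x : R) n : (1 < q)%R -> (0 < x)%R ->
  (\sum_(0 <= i < n) (if q ^+ i < x then q ^+ i else 0) <= x * q / (q - 1))%R.
Proof.
move=> q1 x0.
have q0 : (0 < q)%R by exact: lt_trans q1.
have q10 : (0 < q - 1)%R by rewrite subr_gt0.
elim: n => [|n ih].
  by rewrite big_nil divr_ge0 ?mulr_ge0// ltW.
rewrite big_nat_recr//=; case: ifPn => [qx|_]; last by rewrite addr0.
apply: (@le_trans _ _ (\sum_(0 <= i < n.+1) q ^+ i)%R).
  rewrite [leRHS]big_nat_recr//= lerD2r; apply: ler_sum => i _.
  by case: ifPn => // _; rewrite exprn_ge0// ltW.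
rewrite ler_pdivlMr// mulrC big_mkord -subrX1.
apply: (@le_trans _ _ (q ^+ n.+1)%R); first by rewrite lerBlDr lerDl.
by rewrite exprSr ler_pM2r// ltW.
Qed.

(** Only levels with 2^i < 2Ds count, and there Psi(2^i) is at most a multiple of (2^i/s)^p0 Psi(s).
    The terms are thus at most a multiple of (2^i/s)^(p0-p) Psi(s), and since p < p0 this geometric
    sum is governed by its last term. It is the summation step of a Marcinkiewicz interpolation. *)
Lemma level_sum (N : nat) (L p0 p D : R) : (1 <= D)%R -> (1 <= L)%R ->
  (0 < p)%R -> (p < p0)%R ->
  exists2 C, (0 <= C)%R & forall Psi, growth Psi N L p0 ->
  forall s, (0 <= s)%R ->
  \sum_(i <oo) (if (2 ^+ i / (2 * D) < s)%R
    then Psi (2 ^+ i)%R * (2 `^ p) ^- i * s `^ p else 0%R)%:E <= (C * Psi s)%:E.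
Proof.
move=> D1 L1 pgt0 pp0.
have D0 : (0 < D)%R by exact: lt_le_trans D1.
have L0 : (0 < L)%R by exact: lt_le_trans L1.
pose e := (p0 - p)%R.
have e0 : (0 < e)%R by rewrite subr_gt0.
pose q : R := (2 `^ e)%R.
have q1 : (1 < q)%R.
  have := @gt0_ltr_powR R e e0 1%R 2%R.
  by rewrite !nnegrE powR1 ltr1n; apply.
pose A := (L * L * (2 * D) ^+ N)%R.
have L_ge0 := ltW L0.
have D2 : (0 < 2 * D)%R by rewrite mulr_gt0.
have D2_ge0 := ltW D2.
have DN_ge0 : (0 <= (2 * D) ^+ N)%R by exact: exprn_ge0.
have A0 : (0 <= A)%R by rewrite !mulr_ge0.
exists (A * (q / (q - 1)))%R.
  by rewrite !mulr_ge0 ?invr_ge0 ?subr_ge0 ?(ltW q1) ?powR_ge0.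
move=> Psi gPsi s s0.
have Psi0 := growth_ge0 gPsi.
apply: nneseries_le => [i|n].
  by case: ifPn => // _; rewrite lee_fin !mulr_ge0 ?powR_ge0 ?invr_ge0 ?exprn_ge0 ?powR_ge0.
rewrite sumEFin lee_fin.
have [s_eq0|sn0] := eqVneq s 0%R.
  rewrite big1 ?mulr_ge0// ?invr_ge0 ?subr_ge0 ?(ltW q1) ?powR_ge0// => i _.
  by rewrite s_eq0 ltNge divr_ge0// ?mulr_ge0 ?(ltW D0).
have sgt0 : (0 < s)%R by rewrite lt_neqAle eq_sym sn0.
pose x := ((2 * D * s) `^ e)%R.
have x0 : (0 < x)%R by rewrite powR_gt0// !mulr_gt0.
apply: (@le_trans _ _ (\sum_(0 <= i < n)
    (A * Psi s / x * (if q ^+ i < x then q ^+ i else 0)))%R); last first.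
  rewrite -mulr_sumr.
  apply: (@le_trans _ _ (A * Psi s / x * (x * q / (q - 1)))%R).
    rewrite ler_wpM2l ?geometric_below// !mulr_ge0// invr_ge0; exact: ltW.
  rewrite le_eqVlt; apply/orP; left; apply/eqP; field.
  by rewrite subr_eq0 (gt_eqF x0) (gt_eqF q1).
apply: ler_sum => i _; set tau := (2 ^+ i / (2 * D))%R.
have i0 : (0 < 2 ^+ i :> R)%R by rewrite exprn_gt0.
have tau0 : (0 < tau)%R by rewrite divr_gt0// mulr_gt0.
have qi : (q ^+ i = (2 ^+ i) `^ e)%R.
  by rewrite /q powR_exprn.
have tau_s : (tau < s)%R = (q ^+ i < x)%R.
  have h : (tau < s)%R = (2 ^+ i < 2 * D * s)%R.
    by rewrite /tau ltr_pdivrMr ?mulr_gt0// mulrC.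
  rewrite h qi /x; apply/idP/idP => [ts|].
    by apply: gt0_ltr_powR; rewrite ?nnegrE ?mulr_ge0// ?mulr_ge0 ?(ltW i0) ?(ltW D0).
  apply: contraTT; rewrite -!leNgt => ts.
  by apply: ge0_ler_powR; rewrite ?nnegrE ?(ltW e0) ?mulr_ge0// ?mulr_ge0 ?(ltW i0) ?(ltW D0).
rewrite tau_s; case: ifPn => [qx|_]; last by rewrite mulr0.
have ts : (tau < s)%R by rewrite tau_s.
(* Upper growth brings 2^i down to [tau]; as tau < s, lower growth then compares [tau] with [s]. *)
have h1 : (Psi (2 ^+ i) <= A * (tau / s) `^ p0 * Psi s)%R.
  have -> : (2 ^+ i = (2 * D) * tau)%R by rewrite /tau; field; rewrite gt_eqF.
  apply: le_trans (growth_upper gPsi _ (ltW tau0)) _; first lra.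
  have := growth_lower gPsi tau0 (ltW ts).
  move=> /(@ler_wpM2l _ (L * (2 * D) ^+ N)%R) => /(_ _)/le_trans; apply.
    by rewrite mulr_ge0.
  rewrite /A le_eqVlt; apply/orP; left; apply/eqP; ring.
have h2 : ((2 `^ p) ^- i * s `^ p <= (tau / s) `^ (- p))%R.
  have -> : ((2 `^ p) ^+ i = (2 ^+ i) `^ p)%R.
    by rewrite powR_exprn.
  rewrite powRN powR_div ?(ltW tau0)// invf_div mulrC.
  rewrite ler_wpM2l ?powR_ge0// lef_pV2 ?posrE ?powR_gt0//.
  apply: ge0_ler_powR; rewrite ?nnegrE ?(ltW pgt0) ?(ltW i0) ?(ltW tau0)//.
  rewrite /tau ler_pdivrMr ?mulr_gt0// ler_peMr ?(ltW i0)//.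
  by lra.
rewrite -mulrA; apply: le_trans (ler_pM _ _ h1 h2) _ => //.
  by rewrite mulr_ge0 ?invr_ge0 ?exprn_ge0 ?powR_ge0.
have -> : (A * (tau / s) `^ p0 * Psi s * (tau / s) `^ (- p) =
    A * Psi s * ((tau / s) `^ p0 * (tau / s) `^ (- p)))%R by ring.
rewrite -powRD; last by rewrite gt_eqF ?divr_gt0// implybT.
rewrite -/e -[leRHS]mulrA; apply: ler_wpM2l; first by rewrite mulr_ge0.
rewrite qi /x [leRHS]mulrC -powR_div ?(ltW i0) ?(mulr_ge0 D2_ge0 s0)//.
rewrite le_eqVlt; apply/orP; left; apply/eqP; congr powR.
by rewrite /tau; field; rewrite !gt_eqF.
Qed.

End growth.

Section young.
Context {R : realType}.
Implicit Types (Phi : R -> \bar R) (F : R -> R).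

(** Quantitative form of the assumptions on Phi: [N] is an upper growth exponent given by Delta_2,
    and [p] a lower one, above 1, given by nabla_2. *)
Record doubling_young Phi F (N : nat) (L p : R) : Prop := DoublingYoung {
  dy_E : forall r, (0 <= r)%R -> Phi r = (F r)%:E ;
  dy_homo : {homo F : s t / (s <= t)%R} ;
  dy_ge0 : forall r, (0 <= F r)%R ;
  dy_gt0 : forall r, (0 < r)%R -> (0 < F r)%R ;
  dy_L : (1 <= L)%R ;
  dy_p : (1 < p)%R ;
  dy_upper : forall a s, (1 <= a)%R -> (0 <= s)%R ->
    (F (a * s) <= L * a ^+ N * F s)%R ;
  dy_lower : forall s t, (0 < s)%R -> (s <= t)%R ->
    (F s <= L * (s / t) `^ p * F t)%R ;
  dy_convex : forall A s, (1 <= A)%R -> (0 <= s)%R -> (F (s / A) <= F s / A)%R }.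

Section real_version.
Variable Phi : R -> \bar R.
Hypothesis hPhi : young_function Phi.
Hypothesis hD : Delta2 Phi.
Hypothesis hN : nabla2 Phi.

Lemma young_convex0 s A : (0 <= s)%R -> (1 <= A)%R ->
  Phi (s / A)%R <= (A^-1)%:E * Phi s.
Proof.
move=> s0 A1.
have A0 : (0 < A)%R by exact: lt_le_trans A1.
have Ai : (0 <= A^-1 <= 1)%R by rewrite invr_ge0 (ltW A0)/= invf_le1.
have := young_convex hPhi s0 (lexx 0%R) Ai.
by rewrite mulr0 addr0 (young0 hPhi) mule0 adde0 mulrC.
Qed.

Lemma young_nondecreasing x y : (0 <= x)%R -> (x <= y)%R -> Phi x <= Phi y.
Proof.
move=> x0 xy; have [x_eq0|xn0] := eqVneq x 0%R.
  rewrite x_eq0 (young0 hPhi); apply: (young_ge0 hPhi).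
  exact: le_trans xy.
have xgt0 : (0 < x)%R by rewrite lt_neqAle eq_sym xn0.
have ygt0 : (0 < y)%R by exact: lt_le_trans xy.
have yx1 : (1 <= y / x)%R by rewrite ler_pdivlMr// mul1r.
have := young_convex0 (ltW ygt0) yx1.
have -> : (y / (y / x) = x)%R by field; rewrite !gt_eqF.
move=> /le_trans; apply.
rewrite -[leRHS]mul1e; apply: lee_wpmul2r; first exact: (young_ge0 hPhi) (ltW _).
by rewrite lee_fin invf_le1// divr_gt0.
Qed.

Lemma Delta2_iter : exists2 k : R, (1 < k)%R & forall n r, (0 < r)%R ->
  Phi (2 ^+ n * r)%R <= (k ^+ n)%:E * Phi r.
Proof.
have [k k1 hk] := hD; exists k => //; elim=> [|n ih] r r0.
  by rewrite !expr0 mul1r mul1e.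
rewrite exprS -mulrA; apply: le_trans (hk _ _) _.
  by rewrite mulr_gt0// exprn_gt0.
rewrite exprS EFinM -muleA; apply: lee_wpmul2l; last exact: ih.
by rewrite lee_fin ltW// (lt_trans _ k1).
Qed.

Lemma pow2_ge (x : R) : exists n, (x <= 2 ^+ n)%R.
Proof.
exists (Num.truncn x).+1; apply: (@le_trans _ _ (Num.truncn x).+1%:R).
  by apply/ltW; rewrite truncnS_gt// num_real.
by rewrite -natrX ler_nat ltnW// ltn_expl.
Qed.

Lemma young_small (e : R) : (0 < e)%R -> exists2 r, (0 < r)%R & Phi r < e%:E.
Proof.
move=> e0.
have h : \forall s \near 0%R^'+, Phi s < e%:E.
  have /fine_cvgP[f0 /cvgrPdist_lt/(_ e e0) h] := young_cvg0 hPhi.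
  near=> s; have /fineK <- : Phi s \is a fin_num by near: s.
  rewrite lte_fin; apply: (@le_lt_trans _ _ `|0 - fine (Phi s)|%R); last by near: s.
  by rewrite sub0r normrN ler_norm.
near (0:R)^'+ => r.
exists r; first by near: r; exact: nbhs_right_gt.
by near: r.
Unshelve. all: by end_near.
Qed.

Lemma young_large (M : R) : exists2 r, (0 < r)%R & M%:E < Phi r.
Proof.
have := young_cvgy hPhi; move/cvgeyPgt => /(_ M) h.
near (+oo%R : set_system R) => r.
exists r; first by near: r; exact: nbhs_pinfty_gt.
by near: r.
Unshelve. all: by end_near.
Qed.

(** Delta_2 propagates finiteness from a small argument, where Phi < 1, to all larger ones. *)
Lemma young_fin r : (0 <= r)%R -> Phi r \is a fin_num.
Proof.
move=> r0; rewrite ge0_fin_numE; last exact: (young_ge0 hPhi).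
have [s s0 hs] := young_small ltr01.
have [k k1 hk] := Delta2_iter.
have [n rn] := pow2_ge (r / s).
apply: (@le_lt_trans _ _ (Phi (2 ^+ n * s)%R)).
  by apply: young_nondecreasing => //; rewrite -ler_pdivrMr.
apply: le_lt_trans (hk n s s0) _.
rewrite lte_mul_pinfty ?lee_fin ?exprn_ge0 ?(ltW (lt_trans ltr01 k1))//.
exact: lt_trans hs (ltry _).
Qed.

(** By Delta_2, a zero at one positive argument would make Phi vanish everywhere, against its limit
    at infinity. *)
Lemma young_gt0 r : (0 < r)%R -> 0 < Phi r.
Proof.
move=> r0; rewrite lt_neqAle (young_ge0 hPhi) ?(ltW r0)// andbT.
apply/eqP => Phir.
have [s s0 hs] := young_large 0%R.
have [k k1 hk] := Delta2_iter.
have [n sn] := pow2_ge (s / r).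
have := hk n r r0; rewrite -Phir mule0 leNgt => /negP; apply.
apply: lt_le_trans hs _; apply: young_nondecreasing; first exact: ltW.
by rewrite -ler_pdivrMr.
Qed.

Lemma young_doubling : exists F N L p, doubling_young Phi F N L p.
Proof.
(* Clipping at 0 makes [F] monotone on the whole line, hence measurable. *)
pose F r := fine (Phi (Num.max r 0%R)).
have FE r : (0 <= r)%R -> Phi r = (F r)%:E.
  by move=> r0; rewrite /F max_l// fineK// young_fin.
have Fh : {homo F : s t / (s <= t)%R}.
  move=> s t st; rewrite -lee_fin /F !fineK ?young_fin ?le_max ?lexx ?orbT//.
  apply: young_nondecreasing; first by rewrite le_max lexx orbT.
  by rewrite ge_max !le_max st lexx orbT.
have F0 r : (0 <= F r)%R.
  by apply: fine_ge0; apply: (young_ge0 hPhi); rewrite le_max lexx orbT.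
have Fgt0 r : (0 < r)%R -> (0 < F r)%R.
  by move=> r0; rewrite -lte_fin -FE ?ltW// young_gt0.
have [k k1 hk] := Delta2_iter.
have [N kN] := pow2_ge k.
have [q q1 hq] := hN.
have q0 : (0 < q)%R by exact: lt_trans q1.
have lq0 : (0 < ln q)%R by exact: ln_gt0.
have hqn n r : (0 <= r)%R -> ((2 * q) ^+ n * F r <= F (q ^+ n * r))%R.
  move=> r0; elim: n => [|n ih]; first by rewrite !expr0 !mul1r.
  have qn0 : (0 <= q ^+ n * r)%R by rewrite mulr_ge0// exprn_ge0// ltW.
  have qq0 : (0 <= q * (q ^+ n * r))%R by rewrite mulr_ge0// ltW.
  have := hq _ qn0; rewrite (FE _ qn0) (FE _ qq0).
  rewrite -EFinM lee_fin [leRHS]mulrC ler_pdivlMr ?mulr_gt0// => h'.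
  rewrite (exprS q) -mulrA; apply: le_trans h'.
  by rewrite exprS -mulrA [leRHS]mulrC ler_pM2l ?mulr_gt0.
(* The solution of q^p = 2q: iterating nabla_2 gains (2q)^n for a dilation by q^n. *)
pose p := (1 + ln 2 / ln q)%R.
have p1 : (1 < p)%R by rewrite ltrDl divr_gt0// ln_gt0// ltr1n.
have qp : (q `^ p = 2 * q)%R.
  rewrite /p powRD; last by rewrite (gt_eqF q0) implybT.
  rewrite powRr1 ?(ltW q0)// mulrC; congr (_ * _)%R.
  by rewrite /powR (gt_eqF q0) divfK ?gt_eqF// lnK// posrE.
(* The first term pays for rounding a dilation up to a power of 2, the second for rounding t/s down
   to a power of q. *)
pose L := (2 ^+ N + 2 * q)%R.
have L2N : (2 ^+ N <= L)%R by rewrite lerDl mulr_ge0// ltW.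
have L2q : (2 * q <= L)%R by rewrite lerDr exprn_ge0.
have L1 : (1 <= L)%R by lra.
exists F, N, L, p; split => //.
- move=> a s a1 s0; have [a_eq|an1] := eqVneq a 1%R.
    by rewrite a_eq mul1r expr1n mulr1 ler_peMl.
  have agt1 : (1 < a)%R by rewrite lt_neqAle eq_sym an1.
  have [s_eq|sn0] := eqVneq s 0%R.
    rewrite s_eq mulr0 ler_peMl//.
    by rewrite mulr_ege1// exprn_ege1.
  have sgt0 : (0 < s)%R by rewrite lt_neqAle eq_sym sn0.
  have two1 : (1 < 2 :> R)%R by rewrite ltr1n.
  have [i /andP[ia ai]] := level_exists two1 agt1.
  apply: (@le_trans _ _ (F (2 ^+ i.+1 * s))%R).
    by apply: Fh; rewrite ler_pM2r.
  have := hk i.+1 s sgt0; rewrite !FE ?mulr_ge0// lee_fin => /le_trans; apply.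
  rewrite ler_wpM2r//.
  apply: (@le_trans _ _ ((2 ^+ N) ^+ i.+1)%R).
    by apply: lerXn2r; rewrite ?nnegrE ?exprn_ge0// ltW// (lt_trans _ k1).
  rewrite exprS; apply: ler_pM; rewrite ?exprn_ge0//.
  rewrite -exprM mulnC exprM; apply: lerXn2r; rewrite ?nnegrE ?exprn_ge0//.
    exact: le_trans a1.
  exact: ltW.
- move=> s t s0 st.
  have t0 : (0 < t)%R by exact: lt_le_trans st.
  have [ts|nts] := eqVneq t s.
    by rewrite ts divff ?gt_eqF// powR1 mulr1 ler_peMl.
  have a1 : (1 < t / s)%R by rewrite ltr_pdivlMr// mul1r lt_neqAle eq_sym nts.
  have [i /andP[ia ai]] := level_exists q1 a1.
  have h1 : ((2 * q) ^+ i * F s <= F t)%R.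
    apply: le_trans (hqn i s (ltW s0)) _; apply: Fh.
    by rewrite -ler_pdivlMr// ltW.
  have h2 : ((2 * q) ^- i.+1 <= (s / t) `^ p)%R.
    have -> : ((2 * q) ^+ i.+1 = (q ^+ i.+1) `^ p)%R.
      by rewrite -qp powR_exprn// ltW.
    have ts0 : (0 <= t / s)%R by rewrite divr_ge0// ltW.
    rewrite -(invf_div t s) powR_invl//.
    rewrite lef_pV2 ?posrE ?powR_gt0 ?exprn_gt0 ?divr_gt0//.
    have p0 := ltW (lt_trans ltr01 p1).
    by apply: ge0_ler_powR; rewrite ?nnegrE ?exprn_ge0 ?(ltW q0).
  have q20 : (0 < 2 * q)%R by rewrite mulr_gt0.
  apply: (@le_trans _ _ (2 * q * (2 * q) ^- i.+1 * F t)%R).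
    rewrite exprS invfM mulrA divff ?gt_eqF// mul1r.
    by rewrite mulrC ler_pdivlMr ?exprn_gt0// mulrC.
  rewrite ler_wpM2r//; apply: ler_pM => //.
    by rewrite ltW.
  by rewrite invr_ge0 exprn_ge0// ltW.
- move=> A s A1 s0.
  have A0 : (0 < A)%R by exact: lt_le_trans A1.
  have := young_convex0 s0 A1; rewrite !FE ?divr_ge0 ?(ltW A0)//.
  by rewrite -EFinM lee_fin [(A^-1 * _)%R]mulrC.
Qed.

End real_version.

(** * The inverse of a Young function up to constants *)

Section inverse.
Context {Phi : R -> \bar R} {F : R -> R} {N : nat} {L p : R}.
Hypothesis hPhi : young_function Phi.
Hypothesis hF : doubling_young Phi F N L p.
Local Notation k := (L * 2 ^+ N)%R.

(** F(u) and s agree only up to the doubling constant [k], which spares the study of exact inverses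
    of [F]. *)
Definition quasi_inverse (s u : R) :=
  [/\ (0 < u)%R, (F u <= k * s)%R & (s <= k * F u)%R].

Lemma dy_k_ge1 : (1 <= k)%R.
Proof. by rewrite mulr_ege1 ?(dy_L hF)// exprn_ege1// ler1n. Qed.

Lemma dy_double r : (0 <= r)%R -> (F (2 * r) <= k * F r)%R.
Proof. by move=> r0; apply: (dy_upper hF) => //; rewrite ler1n. Qed.

(** By definition of the infimum u, F(u/2) <= s <= F(2u); doubling moves both bounds to u. *)
Lemma young_invE (s : R) : (0 < s)%R -> exists2 u, quasi_inverse s u &
  young_inv Phi s%:E = u%:E.
Proof.
move=> s0.
pose T := [set r : R | (0 <= r)%R /\ s%:E < Phi r].
have TE r : (0 <= r)%R -> T r <-> (s < F r)%R.
  move=> r0; rewrite /T/= (dy_E hF)// lte_fin; split=> [[]//|]; by split.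
have [d d0 hd] := young_small hPhi s0.
have [e e0 he] := young_large hPhi s.
have Te : T e by split => //; exact: ltW.
have dT r : T r -> (d <= r)%R.
  move=> [r0 hr]; rewrite leNgt; apply/negP => rd.
  have := young_nondecreasing hPhi r0 (ltW rd).
  by move=> /(lt_le_trans hr)/lt_trans => /(_ _ hd); rewrite ltxx.
have lbT : has_inf T by split; [exists e|exists d].
pose u := inf T.
have du : (d <= u)%R by apply: lb_le_inf; [exists e|].
have u0 : (0 < u)%R by exact: lt_le_trans du.
exists u; last first.
  apply/eqP; rewrite eq_le; apply/andP; split.
    apply/lee_addgt0Pr => eps eps0.
    have [r Tr ru] := inf_adherent eps0 lbT.
    apply: (@le_trans _ _ r%:E); last by rewrite -EFinD lee_fin ltW.
    by apply: ereal_inf_lbound; exists r.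
  apply: le_ereal_inf_tmp => _ [r Tr <-]; rewrite lee_fin.
  by apply: ge_inf => //; exact: lbT.2.
split => //.
- have h : (F (u / 2) <= s)%R.
    rewrite leNgt; apply/negP => hu.
    have : T (u / 2)%R by apply/TE => //; rewrite divr_ge0// ltW.
    move=> /(ge_inf lbT.2); rewrite -/u; lra.
  have := @dy_double (u / 2)%R; have -> : (2 * (u / 2) = u)%R by lra.
  move=> /(_ _)/le_trans; apply.
    by rewrite divr_ge0// ltW.
  by rewrite ler_wpM2l// (le_trans ler01)// dy_k_ge1.
- have [r Tr ru] := inf_adherent u0 lbT.
  have [r0 _] := Tr.
  apply: le_trans (dy_double (ltW u0)).
  have /(TE r r0) hr := Tr.
  apply: le_trans (ltW hr) _; apply: (dy_homo hF).
  by move: ru; rewrite -/u; lra.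
Qed.

(** Since the lower exponent is above 1, [F] grows at least linearly: if u > u', the ratio u/u' is
    at most L F(u)/F(u'), and each quasi-inverse contributes a factor [k]. *)
Lemma quasi_inverse_le (s s' u u' a : R) : (0 < s')%R ->
  quasi_inverse s u -> quasi_inverse s' u' -> (1 <= a)%R ->
  (s <= a * s')%R -> (u <= L * k ^+ 2 * a * u')%R.
Proof.
move=> s'0 [u0 uk _] [u'0 _ ku'] a1 ss'.
have k1 := dy_k_ge1; have k0 : (0 < k)%R by exact: lt_le_trans k1.
have L1 := dy_L hF.
have L0 : (0 < L)%R by exact: lt_le_trans L1.
have a0 : (0 < a)%R by exact: lt_le_trans a1.
have [uu'|/ltW u'u] := leP u u'.
  apply: le_trans uu' _; rewrite ler_peMl ?(ltW u'0)//.
  by rewrite mulr_ege1// mulr_ege1// exprn_ege1.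
have h := dy_lower hF u'0 u'u.
rewrite -ler_pdivrMr//.
have uu1 : (1 <= u / u')%R by rewrite ler_pdivlMr// mul1r.
have h1 : (u / u' <= (u / u') `^ p)%R.
  rewrite -[leLHS]powRr1 ?(le_trans ler01)//; apply: ler_powR => //.
  exact: ltW (dy_p hF).
apply: le_trans h1 _.
have pp0 : (0 < (u / u') `^ p)%R by rewrite powR_gt0// divr_gt0.
have h2 : (s' <= k * (L * ((u / u') `^ p)^-1 * (k * (a * s'))))%R.
  apply: le_trans ku' _; rewrite ler_pM2l//; apply: le_trans h _.
  have -> : ((u' / u) `^ p = ((u / u') `^ p)^-1)%R.
    by rewrite -(invf_div u u') powR_invl// divr_ge0// ltW.
  rewrite ler_wpM2l ?mulr_ge0 ?invr_ge0 ?(ltW L0) ?(ltW pp0)//.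
  by apply: le_trans uk _; rewrite ler_pM2l.
rewrite -(ler_pM2r s'0) -(ler_pM2l (_ : 0 < ((u / u') `^ p)^-1))%R ?invr_gt0//.
rewrite mulrA mulVf ?gt_eqF// mul1r; apply: le_trans h2 _.
by rewrite le_eqVlt; apply/orP; left; apply/eqP; ring.
Qed.

Lemma growth_rescale u : (0 < u)%R ->
  growth (fun s => F (u * s) / F u)%R N L p.
Proof.
move=> u0; have Fu := dy_gt0 hF u0.
have iFu : (0 <= (F u)^-1)%R by rewrite invr_ge0 ltW.
split.
- by move=> s t st; rewrite ler_wpM2r// (dy_homo hF)// ler_pM2l.
- by move=> s; rewrite divr_ge0 ?(dy_ge0 hF).
- by rewrite mulr1 divff// gt_eqF.
- move=> a s a1 s0; rewrite [leRHS]mulrA ler_wpM2r// mulrCA (dy_upper hF)//.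
  by rewrite mulr_ge0// ltW.
- move=> s t s0 st; rewrite [leRHS]mulrA ler_wpM2r//.
  have us0 : (0 < u * s)%R by rewrite mulr_gt0.
  have ust : (u * s <= u * t)%R by rewrite ler_pM2l.
  have := dy_lower hF us0 ust.
  have -> // : (u * s / (u * t) = s / t)%R.
  by rewrite -mulf_div divff ?mul1r// gt_eqF.
Qed.

End inverse.
End young.

(** * Luxemburg norms and modulars *)

Section luxemburg.
Context {R : realType} {disp : measure_display} {X : topMeasurableType disp}.
Context {mu : {measure set X -> \bar R}}.
Context {Phi : R -> \bar R} {F : R -> R} {N : nat} {L p2 : R}.
Hypothesis hPhi : young_function Phi.
Hypothesis hF : doubling_young Phi F N L p2.

Lemma young_ext_ge0 (x : \bar R) : 0 <= x -> 0 <= young_ext Phi x.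
Proof. by case: x => [r| |]//; rewrite lee_fin; exact: (young_ge0 hPhi). Qed.

Lemma modular_restrict (f : X -> R) (A : set X) (l : R) : (0 < l)%R ->
  modular mu Phi l^-1 ((EFin \o f) \_ A) = \int[mu]_(z in A) (F (`|f z| / l))%:E.
Proof.
move=> l0; rewrite /modular [RHS]integral_mkcond; apply: eq_integral => z _.
rewrite !patchE; case: ifPn => _ /=.
  rewrite (dy_E hF); first by rewrite mulrC.
  by rewrite mulr_ge0// invr_ge0 ltW.
by rewrite normr0 mulr0 (young0 hPhi).
Qed.

Lemma luxemburg_ge0 (f : X -> \bar R) : 0 <= luxemburg_norm mu Phi f.
Proof.
by apply: le_ereal_inf_tmp => _ [l [l0 _] <-]; rewrite lee_fin ltW.
Qed.

(** The strict inequality provides an admissible l' < l, so whether the infimum is attained does not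
    matter. *)
Lemma luxemburg_lt (f : X -> R) (A : set X) (l : R) :
  luxemburg_norm mu Phi ((EFin \o f) \_ A) < l%:E ->
  \int[mu]_(z in A) (F (`|f z| / l))%:E <= 1.
Proof.
move=> /ereal_inf_lt[_ [l' [l'0 h] <-]]; rewrite lte_fin => l'l.
rewrite (modular_restrict _ _ l'0) in h; apply: le_trans h.
apply: ge0_le_lower_integral => // z _; last by rewrite lee_fin (dy_ge0 hF).
rewrite !lee_fin (dy_ge0 hF) (dy_homo hF)// ler_wpM2l//.
by rewrite lef_pV2 ?posrE// ?ltW// (lt_trans l'0).
Qed.

Lemma luxemburg_subset (f : X -> R) (A B : set X) : A `<=` B ->
  luxemburg_norm mu Phi ((EFin \o f) \_ A) <=
  luxemburg_norm mu Phi ((EFin \o f) \_ B).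
Proof.
move=> AB; apply: le_ereal_inf => _ [l [l0 h] <-]; exists l => //; split => //.
apply: le_trans h; rewrite !modular_restrict//.
apply: ge0_le_lower_integral => // z _; last by rewrite lee_fin (dy_ge0 hF).
by rewrite lexx lee_fin (dy_ge0 hF).
Qed.

(** For y >= 1, the lower growth between v and vy gives y^p2 <= L k a F(vy). Integrated over a ball
    of measure about [a], the bound turns a modular at most 1 into a bounded p-mean. *)
Lemma power_le_young (p a v y : R) : (0 < p)%R -> (p <= p2)%R -> (0 < a)%R ->
  (0 < v)%R -> (0 <= y)%R -> (a^-1 <= L * 2 ^+ N * F v)%R ->
  (y `^ p <= 1 + L * (L * 2 ^+ N) * a * F (v * y))%R.
Proof.
move=> p0 pp2 a0 v0 y0 av.
have L1 := dy_L hF; have L0 : (0 < L)%R by exact: lt_le_trans L1.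
have k0 : (0 < L * 2 ^+ N)%R by rewrite mulr_gt0// exprn_gt0.
have [y1|/ltW y1] := leP y 1%R.
  apply: (@le_trans _ _ 1%R); last first.
    by rewrite lerDl !mulr_ge0 ?(dy_ge0 hF) ?exprn_ge0 ?(ltW L0) ?(ltW a0).
  apply: (@le_trans _ _ (1 `^ p)%R); last by rewrite powR1.
  by apply: ge0_ler_powR; rewrite ?nnegrE ?(ltW p0).
have ygt0 : (0 < y)%R by exact: lt_le_trans y1.
have vy : (v <= v * y)%R by rewrite ler_peMr ?(ltW v0).
apply: (@le_trans _ _ (y `^ p2)%R); first exact: ler_powR.
have y2 : (0 < y `^ p2)%R by exact: powR_gt0.
have := dy_lower hF v0 vy.
have -> : ((v / (v * y)) `^ p2 = (y `^ p2)^-1)%R.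
  by rewrite invfM mulrA divff ?gt_eqF// mul1r powR_invl.
rewrite -(ler_pM2l k0) => /(le_trans av) h.
rewrite -[leLHS]add0r lerD//.
rewrite -(ler_pM2r y2) -(ler_pM2l a0) in h.
move: h; rewrite mulrA divff ?gt_eqF// mul1r => /le_trans; apply.
rewrite le_eqVlt; apply/orP; left; apply/eqP; field.
by rewrite gt_eqF.
Qed.

End luxemburg.

(** * Functions of bounded mean oscillation *)

Section bmo.
Context {R : realType} {disp : measure_display} {X : topMeasurableType disp}.
Context {d : X -> X -> R} {mu : {measure set X -> \bar R}} {K Q D : R}.
Hypothesis hs : ahlfors_space d mu K Q D.
Hypothesis dense : Cc_dense_L1 mu.
Local Notation B := (qball d).
Local Notation kap := (5 * K ^+ 2)%R.

(* c x r stands for the average of b on the ball; only the oscillation bound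
   matters. *)
Variables (b : X -> R) (c : X -> R -> R) (beta : R).
Hypothesis beta0 : (0 <= beta)%R.
Hypothesis mb : measurable_fun setT b.
Hypothesis osc : forall x r, (0 < r)%R ->
  \int[mu]_(y in B x r) `|b y - c x r|%:E <= (beta * r `^ Q)%:E.

Let K1 : (1 <= K)%R := rs_K hs.
Let K0 : (0 < K)%R := lt_le_trans ltr01 (rs_K hs).
Let D0 : (0 < D)%R := lt_le_trans ltr01 (rs_D hs).
Let Q0 : (0 < Q)%R := rs_Q hs.
Let mB x r : measurable (B x r) := measurable_qball hs x r.

Lemma measurable_dist (a : R) : measurable_fun setT (fun y => `|b y - a|%R).
Proof. by apply: measurableT_comp => //; exact: measurable_funB. Qed.

Lemma center_dist x r a a' s s' : (0 < r)%R ->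
  \int[mu]_(y in B x r) `|b y - a|%:E <= (s * r `^ Q)%:E ->
  \int[mu]_(y in B x r) `|b y - a'|%:E <= (s' * r `^ Q)%:E ->
  (`|a - a'| <= D * (s + s'))%R.
Proof.
move=> r0 ha ha'.
have : (`|a - a'| * (D^-1 * r `^ Q))%:E <= (s * r `^ Q + s' * r `^ Q)%:E.
  apply: (@le_trans _ _ (`|a - a'|%:E * mu (B x r))).
    rewrite EFinM; apply: lee_wpmul2l; first by rewrite lee_fin.
    exact: (mu_qball_ge hs).
  rewrite -integral_cst//.
  apply: (@le_trans _ _
    (\int[mu]_(y in B x r) (`|b y - a|%:E + `|b y - a'|%:E))).
    apply: ge0_le_lower_integral => // y _; last by rewrite adde_ge0 ?lee_fin.
    rewrite -EFinD !lee_fin normr_ge0/= (distrC _ a).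
    by rewrite -[X in (`|X| <= _)%R](subrKA (b y)) ler_normD.
  rewrite ge0_integralDT//; first by rewrite EFinD leeD.
  - by apply/measurable_EFinP; exact: measurable_dist.
  - by apply/measurable_EFinP; exact: measurable_dist.
have rQ : (0 < r `^ Q)%R by exact: powR_gt0.
rewrite lee_fin -mulrDl mulrA ler_pM2r// ler_pdivrMr//.
by rewrite mulrC.
Qed.

Lemma integral_dist_shift x r a : (0 < r)%R ->
  \int[mu]_(y in B x r) `|b y - a|%:E <=
  (beta * r `^ Q + `|c x r - a| * (D * r `^ Q))%:E.
Proof.
move=> r0.
apply: (@le_trans _ _ (\int[mu]_(y in B x r)
    (`|b y - c x r|%:E + `|c x r - a|%:E))).
  apply: ge0_le_lower_integral => // y _; last by rewrite adde_ge0 ?lee_fin.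
  rewrite -EFinD !lee_fin normr_ge0/=.
  by rewrite -[X in (`|X| <= _)%R](subrKA (c x r)) ler_normD.
rewrite ge0_integralDT//; last by apply/measurable_EFinP; exact: measurable_dist.
rewrite integral_cst// EFinD leeD ?osc//.
rewrite EFinM; apply: lee_wpmul2l; first by rewrite lee_fin.
by apply: (mu_qball_le hs); exact: ltW.
Qed.

Lemma integral_dist_lty x r a : \int[mu]_(y in B x r) `|b y - a|%:E < +oo.
Proof.
have [r0|r0] := ltP 0%R r.
  exact: le_lt_trans (integral_dist_shift x a r0) (ltry _).
by rewrite (qball_le0 hs)// integral_set0.
Qed.

Lemma integral_dist_le x r t a : (0 < r)%R -> (r <= t)%R ->
  \int[mu]_(y in B x r) `|b y - a|%:E <= \int[mu]_(y in B x t) `|b y - a|%:E.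
Proof.
move=> r0 rt; apply: ge0_le_lower_integral => [y|y _|y _].
- by move=> /lt_le_trans; apply.
- by rewrite lexx lee_fin normr_ge0.
- by rewrite lee_fin.
Qed.

(** The dilation by 2K contains every ball B y t with y in B x r and t <= r, so [M] bounds the mass
    available to the stopping balls. *)
Lemma dilated_oscillation : exists2 M, (0 <= M)%R & forall x r, (0 < r)%R ->
  \int[mu]_(y in B x (2 * K * r)%R) `|b y - c x r|%:E <= (M * r `^ Q)%:E.
Proof.
pose T := (beta * (2 * K) `^ Q)%R.
have T0 : (0 <= T)%R by rewrite mulr_ge0 ?powR_ge0.
exists (T + D * (beta + T) * (D * (2 * K) `^ Q))%R.
  by rewrite addr_ge0// !mulr_ge0 ?addr_ge0 ?powR_ge0 ?(ltW D0).
move=> x r r0; set t := (2 * K * r)%R.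
have K2 : (0 <= 2 * K)%R by rewrite mulr_ge0// ltW.
have rt : (r <= t)%R by rewrite /t ler_peMl ?(ltW r0)//; have := K1; lra.
have t0 : (0 < t)%R by exact: lt_le_trans rt.
have ot : \int[mu]_(y in B x t) `|b y - c x t|%:E <= (T * r `^ Q)%:E.
  by have := osc x t0; rewrite /t (powRM _ K2) ?(ltW r0)// mulrA.
have cc : (`|c x t - c x r| <= D * (beta + T))%R.
  rewrite [(beta + T)%R]addrC; apply: (center_dist r0 _ (osc x r0)).
  exact: le_trans (integral_dist_le _ _ r0 rt) ot.
apply: le_trans (integral_dist_shift x (c x r) t0) _.
rewrite lee_fin /t (powRM _ K2) ?(ltW r0)// [leRHS]mulrDl lerD//.
  by rewrite mulrA.
rewrite -[leRHS]mulrA -[X in (_ <= _ * X)%R]mulrA ler_wpM2r//.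
by rewrite !mulr_ge0 ?powR_ge0 ?(ltW D0).
Qed.

(* Stopping argument: around y, choose a radius that is maximal up to a factor 2
   among those for which the average of |b - c x r| is large. The dilated ball
   then has a small average, so c changes by a bounded amount from B x r to that
   ball, and a Vitali selection of these balls has total measure at most half of
   the measure of B x r. *)
Lemma john_nirenberg_tail : exists2 A, (0 < A)%R & forall n x r, (0 < r)%R ->
  mu (B x r `&` [set y | (A * n%:R < `|b y - c x r|)%R]) <=
  (2^-1 ^+ n * (D * r `^ Q))%:E.
Proof.
have [M M0 hM] := dilated_oscillation.
have kap1 : (5 <= kap)%R by rewrite ler_peMr// exprn_ege1.
have kap0 : (0 < kap)%R by exact: lt_le_trans kap1.
(* With this stopping height, the covering bounds the total measure of the dilated balls by half of
   D r^Q. *)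
pose A1 := (2 * kap `^ Q * D * M + 1)%R.
have A10 : (0 < A1)%R.
  by rewrite ltr_wpDl// !mulr_ge0// ?powR_ge0// ltW.
have A1M : (2 * kap `^ Q * D * M <= A1)%R by rewrite lerDl.
(* 2 * A1 is the threshold of [lebesgue_gap], and A1 + D * beta bounds the change of [c] from B x r
   to a dilated stopping ball. *)
pose A := (2 * A1 + D * beta)%R.
have A0 : (0 < A)%R by rewrite ltr_pwDl ?mulr_gt0// mulr_ge0// ltW.
have mE x r a : measurable (B x r `&` [set y | (a < `|b y - c x r|)%R]).
  rewrite [X in _ `&` X](_ : _ =
    setT `&` (fun y => `|b y - c x r|)%R @^-1` `]a, +oo[%classic).
    by apply: measurableI => //; apply: measurable_dist.
  by rewrite setTI; apply/seteqP; split => z /=; rewrite in_itv/= andbT.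
exists A => //; elim => [|n ih] x r r0.
  rewrite expr0 mul1r; apply: le_trans (mu_qball_le hs x (ltW r0)).
  by apply: le_measure; rewrite ?inE//; exact: subIsetl.
set c0 := c x r; pose w y := `|b y - c0|%R.
have mw : measurable_fun setT w by exact: measurable_dist.
have w0 y : (0 <= w y)%R by exact: normr_ge0.
have iw z t : \int[mu]_(y in B z t) (w y)%:E < +oo by exact: integral_dist_lty.
(* The exceptional set of [lebesgue_gap] is only of arbitrarily small measure; the slack e absorbs
   it. *)
apply/lee_addgt0Pr => e e0.
have [S [mS muS hS]] := lebesgue_gap hs dense x r mw w0 iw A10 r0 e0.
pose H y t := (A1 / D * t `^ Q)%:E <= \int[mu]_(z in B y t) (w z)%:E.
pose P y t := [/\ B x r y, (0 < t <= r)%R, H y t &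
  forall t', (2 * t <= t' <= r)%R -> ~ H y t'].
have BU y t : B x r y -> (t <= r)%R -> B y t `<=` B x (2 * K * r)%R.
  move=> xy tr; apply: (qball_subset hs xy).
  have : (K * (r + t) <= K * (r + r))%R by rewrite ler_pM2l// lerD2l.
  by lra.
have PU y t : P y t -> (0 < t)%R /\ B y t `<=` B x (2 * K * r)%R.
  by move=> [xy /andP[t0 tr] _ _]; split=> //; exact: BU.
have mwE : measurable_fun setT (EFin \o w) by exact/measurable_EFinP.
have [cc [rho [Pc sumr cov]]] := qball_covering hs x (divr_gt0 A10 D0) (mB _ _)
  (mu_qball_lty hs _ _) PU mwE (fun z => w0 z)
  (fun y t p => let: And4 _ _ q _ := p in q).
have rho0 i : (0 <= rho i)%R by have [->//|[_ /andP[/ltW]]] := Pc i.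
pose E i := B (cc i) (kap * rho i)%R `&`
  [set z | (A * n%:R < `|b z - c (cc i) (kap * rho i)|)%R].
have muE i : mu (E i) <= (2^-1 ^+ n * (D * kap `^ Q) * rho i `^ Q)%:E.
  have := rho0 i; rewrite le_eqVlt => /predU1P[ri0|ri0].
    rewrite /E -ri0 mulr0 (qball_le0 hs)// set0I measure0 lee_fin mulr_ge0//.
    by rewrite !mulr_ge0 ?powR_ge0 ?(ltW D0).
  apply: le_trans (ih _ _ (mulr_gt0 kap0 ri0)) _.
  by rewrite (powRM _ (ltW kap0))// !mulrA.
have mEi i : measurable (E i) by exact: mE.
have mbE : measurable (\bigcup_i E i) by exact: bigcup_measurable.
have muUE : mu (\bigcup_i E i) <= (2^-1 ^+ n.+1 * (D * r `^ Q))%:E.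
  apply: (@le_trans _ _ (\sum_(i <oo) mu (E i))).
    exact: measure_sigma_subadditive.
  apply: (@le_trans _ _ (\sum_(i <oo)
      ((2^-1 ^+ n * (D * kap `^ Q))%:E * (rho i `^ Q)%:E))).
    by apply: lee_nneseries => // i _; rewrite -EFinM.
  rewrite nneseriesZl; last by move=> *; rewrite lee_fin powR_ge0.
  have C0 : (0 <= 2^-1 ^+ n * (D * kap `^ Q))%R.
    by rewrite !mulr_ge0 ?powR_ge0 ?(ltW D0).
  apply: (@le_trans _ _ ((2^-1 ^+ n * (D * kap `^ Q))%:E *
      ((A1 / D)^-1%:E * (M * r `^ Q)%:E))).
    apply: lee_wpmul2l; first by rewrite lee_fin.
    apply: le_trans sumr _; apply: lee_wpmul2l; last exact: hM.
    by rewrite lee_fin invr_ge0 divr_ge0 ?(ltW D0) ?(ltW A10).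
  rewrite -!EFinM lee_fin [in leRHS]exprSr.
  have -> : (2^-1 ^+ n * (D * kap `^ Q) * ((A1 / D)^-1 * (M * r `^ Q)) =
    2^-1 ^+ n * 2^-1 * (D * r `^ Q) * ((2 * kap `^ Q * D * M) / A1))%R.
    by field; rewrite !gt_eqF.
  rewrite ler_piMr//; last by rewrite ler_pdivrMr// mul1r.
  by rewrite !mulr_ge0 ?powR_ge0 ?(ltW D0).
rewrite addeC; apply: le_trans (leeD muS muUE).
apply: le_trans (measureU2 mu mS mbE).
apply: le_measure; rewrite ?inE//; first exact: measurableU.
move=> y [xy /= hy].
have [Sy|nSy] := pselect (S y); first by left.
right.
have An : (A * n%:R + A < w y)%R by move: hy; rewrite -natr1 mulrDr mulr1.
have wy : (2 * A1 < w y)%R.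
  apply: le_lt_trans An; rewrite {2}/A.
  have h1 : (0 <= A * n%:R)%R by rewrite mulr_ge0// ltW.
  have h2 : (0 <= D * beta)%R by rewrite mulr_ge0// ltW.
  by lra.
have [t0 /andP[t00 t0r] Ht0] : exists2 t, (0 < t <= r)%R & H y t.
  apply: contrapT => nt; apply: nSy; apply: hS => // t /andP[t0 tr].
  apply/ltW; rewrite ltNge; apply/negP => h; apply: nt; exists t.
    by rewrite t0.
  apply: le_trans h; rewrite -mulrA EFinM.
  apply: lee_wpmul2l; first by rewrite lee_fin ltW.
  exact: (mu_qball_ge hs).
pose T := [set t | (0 < t <= r)%R /\ H y t].
have supT : has_sup T.
  by split; [exists t0; rewrite /T/= t00|exists r => t [/andP[]]].
have [t1 [/andP[t10 t1r] Ht1] t1S] : exists2 t, T t & (sup T / 2 < t)%R.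
  have t0S : (t0 <= sup T)%R by apply: ub_le_sup; [exact: supT.2|rewrite /T/= t00].
  have S0 : (0 < sup T / 2)%R by rewrite divr_gt0// (lt_le_trans t00).
  by have [t Tt] := sup_adherent S0 supT; exists t => //; lra.
have Pyt : P y t1.
  split=> //; first by rewrite t10.
  move=> t' /andP[t1t' t'r] Ht'.
  have : (t' <= sup T)%R.
    by apply: ub_le_sup; [exact: supT.2|]; split=> //; rewrite t'r andbT; lra.
  by lra.
have [i [ri0 Bi]] := cov _ _ Pyt.
exists i => //; split; first by apply: Bi; exact: (qball_center hs).
rewrite /=; set z := cc i; set s := (kap * rho i)%R.
have [|[xz /andP[_ rir] Hz nH]] := Pc i.
  by move=> ri; rewrite ri ltxx in ri0.
have s0 : (0 < s)%R by rewrite mulr_gt0.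
(* Required to use the maximality clause of [P] at the dilated radius: a large average on B z (rho
   i) forces A1 * rho^Q <= D * M * r^Q, and A1 >= kap^Q * D * M. *)
have sr : (s <= r)%R.
  have hle : (A1 / D * rho i `^ Q)%:E <= (M * r `^ Q)%:E.
    apply: le_trans Hz (le_trans _ (hM x r r0)).
    apply: ge0_le_lower_integral; first exact: BU.
      by move=> u _; rewrite lee_fin w0 lexx.
    by move=> u _; rewrite lee_fin w0.
  have sQ : (s `^ Q <= r `^ Q)%R.
    rewrite /s (powRM _ (ltW kap0))//.
    move: hle; rewrite lee_fin => hle.
    rewrite -(ler_pM2l A10).
    apply: (@le_trans _ _ (kap `^ Q * D * (A1 / D * rho i `^ Q))%R).
      rewrite le_eqVlt; apply/orP; left; apply/eqP; field.
      by rewrite gt_eqF.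
    apply: (@le_trans _ _ (kap `^ Q * D * (M * r `^ Q))%R).
      by rewrite ler_wpM2l// mulr_ge0 ?powR_ge0 ?(ltW D0).
    rewrite mulrA ler_wpM2r ?powR_ge0//; apply: le_trans A1M.
    rewrite -!mulrA ler_peMl//; last by rewrite ler1n.
    by rewrite !mulr_ge0 ?powR_ge0 ?(ltW D0).
  rewrite leNgt; apply/negP => rs; have := gt0_ltr_powR Q0 _ _ rs.
  by rewrite !nnegrE !ltW// ltNge sQ => /(_ isT isT).
have nHs : \int[mu]_(u in B z s) (w u)%:E <= (A1 / D * s `^ Q)%:E.
  apply/ltW; rewrite ltNge; apply/negP; apply: nH; rewrite sr andbT.
  by rewrite /s ler_pM2r//; lra.
(* Moving from [c0] to c z s costs at most D * beta + A1 <= A, so |b y - c z s| still exceeds A * n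
   and y is counted by the induction hypothesis. *)
have := center_dist s0 (osc z s0) nHs.
have -> : (D * (beta + A1 / D) = D * beta + A1)%R by field; rewrite gt_eqF.
have : (w y <= `|b y - c z s| + `|c z s - c0|)%R.
  by rewrite /w -[X in (`|X| <= _)%R](subrKA (c z s)) ler_normD.
by move: An; rewrite {2}/A; have := A10; lra.
Qed.

Lemma john_nirenberg_exp : exists theta C, [/\ (0 < theta)%R, (1 <= C)%R &
  forall x r, (0 < r)%R ->
  \int[mu]_(y in B x r) (expR (theta * `|b y - c x r|))%:E <= (C * r `^ Q)%:E].
Proof.
have [A A0 hA] := john_nirenberg_tail.
(* Any value strictly between 1 and 2 works: the tails decay like 2^(-k), so the terms q^k 2^(-k)
   are summable. *)
have [q qE] : exists q : R, q = (3 / 2)%R by eexists.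
have q1 : (1 < q)%R by rewrite qE; lra.
have q0 : (0 < q)%R by exact: lt_trans q1.
pose theta := (ln q / A)%R.
have theta0 : (0 < theta)%R by rewrite divr_gt0// ln_gt0.
exists theta, (q * D + 9 * D)%R; split => //.
  by have := rs_D hs; rewrite qE; lra.
move=> x r r0.
pose h y := `|b y - c x r|%R.
pose E k := B x r `&` [set y | (A * k%:R < h y)%R].
have mE k : measurable (E k).
  rewrite /E [X in _ `&` X](_ : _ = setT `&` h @^-1` `](A * k%:R)%R, +oo[%classic).
    by apply: measurableI => //; apply: measurable_dist.
  by rewrite setTI; apply/seteqP; split => z /=; rewrite in_itv/= andbT.
pose u k y : \bar R := (q ^+ k.+2)%:E * (\1_(E k) y)%:E.
have u0 k y : 0 <= u k y by rewrite mule_ge0// lee_fin// exprn_ge0// ltW.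
have mu_ k : measurable_fun setT (u k).
  apply: measurable_funeM; apply/measurable_EFinP; exact: measurable_indic.
apply: (@le_trans _ _ (\int[mu]_(y in B x r) (q%:E + \sum_(k <oo) u k y))).
  apply: ge0_le_lower_integral => // [y xy|y _]; last first.
    by rewrite adde_ge0 ?lee_fin ?(ltW q0)// nneseries_ge0.
  rewrite lee_fin expR_ge0/=.
  pose k := Num.truncn (h y / A)%R.
  have /andP[k1 k2] : (k%:R <= h y / A < k.+1%:R)%R.
    by apply: truncn_itv; rewrite divr_ge0// ?normr_ge0 ?ltW.
  have le_k : (expR (theta * h y) <= q ^+ k.+1)%R.
    rewrite -[X in (_ <= X ^+ _)%R](@lnK _ q)// -expRM_natl ler_expR.
    rewrite /theta mulrAC -mulrA mulrC ler_wpM2r ?ln_ge0 ?ltW//.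
  (* E k asks for a strict inequality, so integer part k + 1 is what guarantees membership; hence
     the weight q^(k+2). Integer part 0 is paid for by the constant q. *)
  case: k k1 k2 le_k => [|k] k1 k2 le_k.
    apply: (@le_trans _ _ q%:E); first by rewrite lee_fin (le_trans le_k).
    by rewrite leeDl// nneseries_ge0.
  apply: (@le_trans _ _ (u k y)).
    rewrite /u indicE mem_set ?mule1 ?lee_fin//; split=> //=.
    rewrite -ltr_pdivlMl// mulrC; apply: lt_le_trans k1.
    by rewrite ltr_nat.
  apply: le_trans (nneseries_ge k (u0^~ y)) _.
  by rewrite leeDr// lee_fin ltW.
have msum : measurable_fun setT (fun y => \sum_(k <oo) u k y).
  by apply: ge0_emeasurable_sum.
have sum0 y : 0 <= \sum_(k <oo) u k y by exact: nneseries_ge0.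
rewrite ge0_integralDT//; last by rewrite lee_fin ltW.
rewrite integral_cst//.
have -> : ((q * D + 9 * D) * r `^ Q)%:E =
    (q * (D * r `^ Q))%:E + (9 * D * r `^ Q)%:E.
  by rewrite -EFinD; congr EFin; ring.
apply: leeD.
  rewrite [leRHS]EFinM; apply: lee_wpmul2l; first by rewrite lee_fin ltW.
  by apply: (mu_qball_le hs); exact: ltW.
rewrite integral_nneseries//; last by move=> k; exact: measurable_funTS.
have rQ : (0 <= r `^ Q)%R by exact: powR_ge0.
apply: (@le_trans _ _ (\sum_(k <oo) (q ^+ 2 * D * r `^ Q * (q / 2) ^+ k)%:E)).
  apply: lee_nneseries => k *; first by apply: integral_ge0 => y _; exact: u0.
  have mind : measurable_fun setT (fun y => (\1_(E k) y : R)%:E).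
    by apply/measurable_EFinP; exact: measurable_indic.
  have qk0 : (0 <= q ^+ k.+2)%R by rewrite exprn_ge0// ltW.
  rewrite /u ge0_integralZlT// integral_indic//.
  apply: (@le_trans _ _ ((q ^+ k.+2)%:E * (2^-1 ^+ k * (D * r `^ Q))%:E)).
    apply: lee_wpmul2l; first by rewrite lee_fin exprn_ge0// ltW.
    apply: le_trans (hA k x r r0); apply: le_measure; rewrite ?inE//.
      exact: measurableI.
    exact: mE.
  rewrite -EFinM lee_fin exprMn -[k.+2]addn2 exprD le_eqVlt.
  by apply/orP; left; apply/eqP; ring.
apply: le_trans (nneseries_geometric_le _ _) _.
- by rewrite !mulr_ge0 ?(ltW D0) ?(ltW q0).
- by rewrite qE; lra.
- have -> : (1 - q / 2 = 4^-1)%R by rewrite qE; lra.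
  by rewrite lee_fin invrK qE le_eqVlt; apply/orP; left; apply/eqP; field.
Qed.

Lemma bmo_moments n : exists2 C, (0 <= C)%R & forall x r, (0 < r)%R ->
  \int[mu]_(y in B x r) (`|b y - c x r| ^+ n)%:E <= (C * r `^ Q)%:E.
Proof.
have [th [C [th0 C1 hC]]] := john_nirenberg_exp.
pose M := (n`!%:R / th ^+ n)%R.
have M0 : (0 <= M)%R by rewrite divr_ge0// exprn_ge0// ltW.
exists (M * C)%R; first by rewrite mulr_ge0// (le_trans _ C1).
move=> x r r0.
apply: (@le_trans _ _
  (\int[mu]_(y in B x r) (M%:E * (expR (th * `|b y - c x r|))%:E))).
  apply: ge0_le_lower_integral => // y _; last first.
    by rewrite mule_ge0// lee_fin expR_ge0.
  rewrite -EFinM !lee_fin exprn_ge0//=.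
  set t := `|_|%R; have t0 : (0 <= t)%R by exact: normr_ge0.
  have : (t ^+ n * th ^+ n <= n`!%:R * expR (th * t))%R.
    rewrite -exprMn (mulrC t) (mulrC n`!%:R).
    rewrite -ler_pdivrMr ?ltr0n ?fact_gt0//.
    have tt : (0 <= th * t)%R by rewrite mulr_ge0// ltW.
    case: {M M0}n => [|m].
      by rewrite expr0 fact0 divr1; apply: le_trans (expR_ge1Dx _); rewrite lerDl.
    by apply: le_trans (expR_ge1Dxn m tt); rewrite lerDr.
  by rewrite -ler_pdivlMr ?exprn_gt0// mulrAC.
rewrite ge0_integralZlT//.
- rewrite -mulrA [leRHS]EFinM; apply: lee_wpmul2l; [by rewrite lee_fin|exact: hC].
- apply/measurable_EFinP; apply: measurableT_comp => //.
  apply: measurable_funM => //; exact: measurable_dist.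
Qed.

(* Jensen's inequality for exp turns the exponential integrability on the large
   ball into logarithmic growth of the averages. *)
Lemma center_log : exists2 C, (0 <= C)%R & forall x r t, (0 < r)%R -> (r <= t)%R ->
  (`|c x r - c x t| <= C * (1 + ln (t / r)))%R.
Proof.
have [th [C [th0 C1 hC]]] := john_nirenberg_exp.
have C0 : (0 < C)%R by exact: lt_le_trans C1.
have lC : (0 <= ln C)%R by exact: ln_ge0.
have E0 : (0 <= D * (beta + (ln C * D + 1) / th))%R.
  by rewrite mulr_ge0 ?addr_ge0 ?divr_ge0 ?addr_ge0 ?mulr_ge0// ltW.
exists (D * (beta + (ln C * D + 1) / th) + D * (Q * D / th))%R.
  by rewrite addr_ge0// !mulr_ge0// ?divr_ge0 ?mulr_ge0 ?invr_ge0// ltW.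
move=> x r t r0 rt.
have t0 : (0 < t)%R by exact: lt_le_trans rt.
pose L := ln (t / r)%R.
have L0 : (0 <= L)%R by rewrite ln_ge0// ler_pdivlMr// mul1r.
(* Chosen so that exp(-s) C t^Q = r^Q. In th * a <= s + exp(th * a - s) the exponential then costs
   only r^Q, and the logarithm is confined to [s]. *)
pose s := (ln C + Q * L)%R.
have s0 : (0 <= s)%R by rewrite addr_ge0// mulr_ge0// ltW.
have es : (expR (- s) * (C * t `^ Q) = r `^ Q)%R.
  rewrite /s expRN expRD lnK ?posrE//.
  have -> : (expR (Q * L) = t `^ Q / r `^ Q)%R.
    rewrite /L -ln_powR lnK ?posrE ?powR_gt0 ?divr_gt0//.
    by rewrite powR_div ?ltW.
  by field; rewrite !gt_eqF ?powR_gt0.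
have hr : \int[mu]_(y in B x r) `|b y - c x t|%:E <=
    ((s * D + 1) / th * r `^ Q)%:E.
  apply: (@le_trans _ _ (\int[mu]_(y in B x r)
     ((s / th)%:E + (expR (- s) / th)%:E * (expR (th * `|b y - c x t|))%:E))).
    apply: ge0_le_lower_integral => // y _; last first.
      rewrite adde_ge0// ?mule_ge0// ?lee_fin ?divr_ge0 ?expR_ge0// ?ltW//.
    rewrite -EFinM -EFinD !lee_fin normr_ge0/=.
    rewrite mulrAC -mulrDl ler_pdivlMr// -expRD.
    have := expR_ge1Dx (- s + th * `|b y - c x t|)%R; lra.
  have me : measurable_fun setT (fun y => (expR (th * `|b y - c x t|))%:E).
    apply/measurable_EFinP; apply: measurableT_comp => //.
    by apply: measurable_funM => //; exact: measurable_dist.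
  have e0 y : 0 <= (expR (th * `|b y - c x t|))%:E by rewrite lee_fin expR_ge0.
  have k0 : (0 <= expR (- s) / th)%R by rewrite divr_ge0 ?expR_ge0// ltW.
  rewrite ge0_integralDT//; last 3 first.
  - exact: measurable_funeM.
  - by move=> y; rewrite lee_fin divr_ge0// ltW.
  - by move=> y; rewrite mule_ge0.
  rewrite integral_cst// ge0_integralZlT//.
  have -> : ((s * D + 1) / th * r `^ Q)%:E =
      (s / th * (D * r `^ Q))%:E + (expR (- s) / th * (C * t `^ Q))%:E.
    rewrite -EFinD; congr EFin; rewrite [X in (_ = _ + X)%R]mulrAC es; field.
    by rewrite gt_eqF.
  apply: leeD; rewrite [leRHS]EFinM; apply: lee_wpmul2l.
  - by rewrite lee_fin divr_ge0// ltW.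
  - by apply: (mu_qball_le hs); exact: ltW.
  - by rewrite lee_fin divr_ge0 ?expR_ge0// ltW.
  apply: le_trans (hC x t t0); apply: ge0_le_lower_integral => [y|y _|y _].
  - by move=> /lt_le_trans; apply.
  - by rewrite lexx lee_fin expR_ge0.
  - by rewrite lee_fin expR_ge0.
apply: le_trans (center_dist r0 (osc x r0) hr) _.
rewrite -/L.
have -> : (D * (beta + (s * D + 1) / th) = D * (beta + (ln C * D + 1) / th) +
  D * (Q * D / th) * L)%R by rewrite /s; field; rewrite gt_eqF.
have F0 : (0 <= D * (Q * D / th))%R by rewrite !mulr_ge0 ?invr_ge0// ltW.
move: E0 F0; set E := (D * (beta + _))%R; set F := (D * (_ / th))%R => E0 F0.
have := mulr_ge0 E0 L0; lra.
Qed.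

(** One function of y has to serve all radii t. With H = |b - c x r|^m, |b y - b z|^m <= 2^m (H y +
    H z), and [local_maximal] controls all averages of H around y at the price of a higher moment,
    which John-Nirenberg supplies. *)
Lemma local_oscillation (m n : nat) : exists (C : R)
    (W : X -> R -> X -> \bar R), (0 <= C)%R /\ forall x r, (0 < r)%R -> [/\
    measurable_fun setT (W x r), (forall y, 0 <= W x r y),
    \int[mu]_(y in B x r) W x r y <= (C * r `^ Q)%:E &
    forall y t, (0 < t)%R -> B y t `<=` B x r -> exists w, [/\ (0 <= w)%R,
      \int[mu]_(z in B y t) (`|b y - b z| ^+ m)%:E <= (w * t `^ Q)%:E &
      ((1 + w) ^+ n)%:E <= W x r y]].
Proof.
have [C1 C10 hC1] := local_maximal hs n.
have [C2 C20 hC2] := bmo_moments (m * n).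
have [C3 C30 hC3] := bmo_moments (m * n.+1).
pose H x r z := (`|b z - c x r| ^+ m)%R.
have mH x r : measurable_fun setT (H x r).
  by apply: measurable_funX; exact: measurable_dist.
have H0 x r z : (0 <= H x r z)%R by rewrite exprn_ge0.
pose A1 : R := (2 ^+ n * 2 ^+ n)%R.
pose A2 : R := (A1 * (2 ^+ m * D) ^+ n)%R.
pose A3 : R := (2 ^+ n * (2 ^+ m) ^+ n)%R.
have A10 : (0 <= A1)%R by rewrite mulr_ge0.
have A20 : (0 <= A2)%R by rewrite mulr_ge0// exprn_ge0// mulr_ge0// ltW.
have A30 : (0 <= A3)%R by rewrite mulr_ge0// exprn_ge0.
pose C := (A1 * D + A2 * C2 + A3 * (C1 * (D + C3)))%R.
have C0 : (0 <= C)%R.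
  have D0' := ltW D0.
  apply: addr_ge0; first by rewrite addr_ge0// mulr_ge0.
  by rewrite !mulr_ge0// addr_ge0.
suff /choice[W hW] : forall p : X * R, exists W : X -> \bar R, (0 < p.2)%R -> [/\
    measurable_fun setT W, (forall y, 0 <= W y),
    \int[mu]_(y in B p.1 p.2) W y <= (C * p.2 `^ Q)%:E &
    forall y t, (0 < t)%R -> B y t `<=` B p.1 p.2 -> exists w, [/\ (0 <= w)%R,
      \int[mu]_(z in B y t) (`|b y - b z| ^+ m)%:E <= (w * t `^ Q)%:E &
      ((1 + w) ^+ n)%:E <= W y]].
  by exists C, (fun x r => W (x, r)); split=> // x r r0; exact: (hW (x, r)).
move=> [x r] /=.
have [r0|] := ltP 0%R r; last by exists (cst 0).
have HE k z : ((H x r z) ^+ k = `|b z - c x r| ^+ (m * k))%R by rewrite -exprM.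
have h3 : \int[mu]_(z in B x r) (H x r z ^+ n.+1)%:E <= (C3 * r `^ Q)%:E.
  by under eq_integral do rewrite HE; exact: hC3.
have h2 : \int[mu]_(z in B x r) (H x r z ^+ n)%:E <= (C2 * r `^ Q)%:E.
  by under eq_integral do rewrite HE; exact: hC2.
have [W [mW W0 iW hW]] := hC1 (B x r) (H x r) x (mB _ _) (mu_qball_lty hs _ _)
  (mH _ _) (H0 _ _) (le_lt_trans h3 (ltry _)).
have mHn : measurable_fun setT (fun y => (H x r y ^+ n)%:E).
  by apply/measurable_EFinP; exact: measurable_funX.
have Hn0 y : 0 <= (H x r y ^+ n)%:E by rewrite lee_fin exprn_ge0.
exists (fun y => (A1%:E + A2%:E * (H x r y ^+ n)%:E) + A3%:E * W y) => _.
have m1 : measurable_fun setT (fun y => A2%:E * (H x r y ^+ n)%:E).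
  exact: measurable_funeM.
have m2 : measurable_fun setT (fun y => A1%:E + A2%:E * (H x r y ^+ n)%:E).
  exact: emeasurable_funD.
have m3 : measurable_fun setT (fun y => A3%:E * W y).
  exact: measurable_funeM.
have p1 y : 0 <= A2%:E * (H x r y ^+ n)%:E by rewrite mule_ge0.
have p2 y : 0 <= A1%:E + A2%:E * (H x r y ^+ n)%:E by rewrite adde_ge0.
have p3 y : 0 <= A3%:E * W y by rewrite mule_ge0.
split.
- exact: emeasurable_funD.
- by move=> y; rewrite adde_ge0.
- rewrite ge0_integralDT// ge0_integralDT// integral_cst// !ge0_integralZlT//.
  have muB := mu_qball_le hs x (ltW r0).
  have -> : (C * r `^ Q)%:E = A1%:E * (D * r `^ Q)%:E +
     A2%:E * (C2 * r `^ Q)%:E +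
     A3%:E * (C1%:E * ((D * r `^ Q)%:E + (C3 * r `^ Q)%:E)).
    transitivity (A1 * (D * r `^ Q) + A2 * (C2 * r `^ Q) +
      A3 * (C1 * (D * r `^ Q + C3 * r `^ Q)))%:E; last by [].
    by congr EFin; rewrite /C; ring.
  apply: leeD; first by apply: leeD; apply: lee_wpmul2l.
  apply: lee_wpmul2l => //; apply: le_trans iW _.
  by apply: lee_wpmul2l => //; apply: leeD.
move=> y t t0 Byt.
have [w2 [w20 iw2 w2W]] := hW y t t0 Byt.
have DH0 : (0 <= D * H x r y)%R by rewrite mulr_ge0// ltW.
exists (2 ^+ m * (D * H x r y + w2))%R; split.
- by rewrite mulr_ge0// addr_ge0.
- apply: (@le_trans _ _ (\int[mu]_(z in B y t)
    ((2 ^+ m)%:E * ((H x r y)%:E + (H x r z)%:E)))).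
    apply: ge0_le_lower_integral => // z _; last first.
      by rewrite mule_ge0// adde_ge0// lee_fin.
    rewrite -EFinD -EFinM !lee_fin exprn_ge0//=.
    apply: le_trans (exprD_le _ _ _) => //.
    apply: lerXn2r; rewrite ?nnegrE ?addr_ge0//.
    rewrite (distrC (b z)).
    by rewrite -[X in (`|X| <= _)%R](subrKA (c x r)) ler_normD.
  have mHE : measurable_fun setT (fun z => (H x r z)%:E).
    by apply/measurable_EFinP.
  have mHH : measurable_fun setT (fun z => (H x r y)%:E + (H x r z)%:E).
    exact: emeasurable_funD.
  have HH0 z : 0 <= (H x r y)%:E + (H x r z)%:E by rewrite adde_ge0// lee_fin.
  have HE0 z : 0 <= (H x r z)%:E by rewrite lee_fin.
  rewrite ge0_integralZlT// ge0_integralDT//.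
  rewrite integral_cst// -mulrA [leRHS]EFinM.
  apply: lee_wpmul2l; first by rewrite lee_fin.
  rewrite mulrDl EFinD; apply: leeD => //.
  rewrite mulrAC mulrC EFinM; apply: lee_wpmul2l => //.
  by apply: (mu_qball_le hs); exact: ltW.
apply: (@le_trans _ _ (A1 + A2 * H x r y ^+ n + A3 * w2 ^+ n)%:E); last first.
  rewrite !EFinD !EFinM; apply: leeD => //.
  by apply: lee_wpmul2l.
rewrite lee_fin.
have -> : (1 + 2 ^+ m * (D * H x r y + w2) =
  (1 + 2 ^+ m * (D * H x r y)) + 2 ^+ m * w2)%R by ring.
have q0 : (0 <= 2 ^+ m * (D * H x r y))%R by rewrite mulr_ge0.
have q1 : (0 <= 2 ^+ m * w2)%R by rewrite mulr_ge0.
apply: le_trans (exprD_le _ (addr_ge0 ler01 q0) q1) _.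
have -> : (A1 + A2 * H x r y ^+ n + A3 * w2 ^+ n =
   2 ^+ n * (2 ^+ n * (1 ^+ n + (2 ^+ m * (D * H x r y)) ^+ n) +
   (2 ^+ m * w2) ^+ n))%R.
  rewrite /A2 /A3 /A1 expr1n; move: (H x r y) (2 ^+ m)%R (2 ^+ n)%R => h p s.
  by rewrite !exprMn; move: (p ^+ n)%R (D ^+ n)%R => p' D'; ring.
by rewrite ler_wpM2l// lerD2r exprD_le.
Qed.

(** * The maximal commutator *)

Section commutator.
Variable m : nat.
Let p : R := (m.+2%:R / m.+1%:R)%R.

Let p1 : (1 < p)%R.
Proof. by rewrite /p ltr_pdivlMr// mul1r ltr_nat. Qed.

Let p0 : (0 < p)%R.
Proof. exact: lt_trans p1. Qed.

(** Up to constants, the p-mean of h over B x t is at most 1/(1 + ln(t/r)), which leaves room for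
    the drift of the averages of [b] between the radii r and t. *)
Definition power_mean_decay (h : X -> R) x r := forall t, (r < t)%R ->
  \int[mu]_(z in B x t) (((1 + ln (t / r)) * h z) `^ p)%:E <= (t `^ Q)%:E.

(** With L = 1 + ln(tau/r), write the integrand as L^(-1) |b y - b z| (L h z). Passing from c x r to
    c x tau costs C1 L, which L^(-1) cancels, so no logarithm remains. *)
Lemma far_estimate : exists2 C, (0 <= C)%R & forall x r (h : X -> R),
  (0 < r)%R -> measurable_fun setT h -> (forall z, 0 <= h z)%R ->
  power_mean_decay h x r ->
  forall y t, B x r y -> (r <= t)%R ->
  \int[mu]_(z in B y t) (`|b y - b z| * h z)%:E <=
  (C * (1 + `|b y - c x r|) * t `^ Q)%:E.
Proof.
have [C1 C10 hC1] := center_log.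
have [C2 C20 hC2] := bmo_moments m.+2.
have K2 : (0 < 2 * K)%R by rewrite mulr_gt0.
pose C := ((2 * K) `^ Q * ((1 + C1) * (D + 1) + C2 + 1))%R.
have C0 : (0 <= C)%R.
  rewrite mulr_ge0 ?powR_ge0// !addr_ge0// mulr_ge0 ?addr_ge0//; exact: ltW.
exists C => // x r h r0 mh h0 decay y t xy rt.
have t0 : (0 < t)%R by exact: lt_le_trans rt.
pose tau := (2 * K * t)%R.
have ttau : (2 * t <= tau)%R by rewrite /tau ler_pM2r// ler_peMr.
have rtau : (r < tau)%R by lra.
have tau0 : (0 < tau)%R by exact: lt_trans rtau.
have Bsub : B y t `<=` B x tau.
  apply: (qball_subset hs xy); rewrite /tau.
  have : (K * (r + t) <= K * (t + t))%R by rewrite ler_pM2l// lerD2r.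
  by lra.
pose L := (1 + ln (tau / r))%R.
have L1 : (1 <= L)%R.
  by rewrite lerDl ln_ge0// ler_pdivlMr// mul1r ltW.
have L0 : (0 < L)%R by exact: lt_le_trans L1.
have iL : (0 <= L^-1)%R by rewrite invr_ge0 ltW.
have L_ge0 := ltW L0.
pose u := (`|b y - c x r| + C1 * L)%R.
have u0 : (0 <= u)%R by rewrite addr_ge0// mulr_ge0.
have cc : (`|b y - c x tau| <= u)%R.
  rewrite -[X in (`|X| <= _)%R](subrKA (c x r)).
  apply: le_trans (ler_normD _ _) _; rewrite lerD2l.
  by apply: hC1 => //; exact: ltW.
pose F z := (`|b z - c x tau| ^+ m.+2)%R.
pose G z := ((L * h z) `^ p)%R.
have F0 z : 0 <= (F z)%:E by rewrite lee_fin exprn_ge0.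
have G0 z : 0 <= (G z)%:E by rewrite lee_fin powR_ge0.
have mF : measurable_fun setT (fun z => (F z)%:E).
  by apply/measurable_EFinP; apply: measurable_funX; exact: measurable_dist.
have mG : measurable_fun setT (fun z => (G z)%:E).
  apply/measurable_EFinP.
  apply: (@measurableT_comp _ _ _ _ _ _ (fun x : R => x `^ p)%R) => //.
  exact: measurable_funM.
have pointwise z : (`|b y - b z| * h z <= L^-1 * (u + (u + 1) * G z + F z))%R.
  have Lh0 : (0 <= L * h z)%R by rewrite mulr_ge0.
  rewrite [leRHS]mulrC ler_pdivlMr// -mulrA (mulrC (h z)).
  have e1 : (`|b y - b z| <= u + `|b z - c x tau|)%R.
    rewrite -[X in (`|X| <= _)%R](subrKA (c x tau)).
    by apply: le_trans (ler_normD _ _) _; rewrite (distrC _ (b z)) lerD2r.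
  have e2 : (L * h z <= 1 + G z)%R.
    by have := young_split m ler01 Lh0; rewrite mul1r expr1n.
  have e3 := young_split m (normr_ge0 (b z - c x tau)%R) Lh0.
  apply: le_trans (ler_wpM2r Lh0 e1) _; rewrite mulrDl.
  have := ler_wpM2l u0 e2; rewrite -/(G z) -/(F z) in e3 *; lra.
have uG0 z : 0 <= (u + 1)%:E * (G z)%:E.
  by rewrite mule_ge0// lee_fin addr_ge0.
have muG : measurable_fun setT (fun z => (u + 1)%:E * (G z)%:E).
  exact: measurable_funeM.
have us0 z : 0 <= u%:E + (u + 1)%:E * (G z)%:E by rewrite adde_ge0.
have mus : measurable_fun setT (fun z => u%:E + (u + 1)%:E * (G z)%:E).
  exact: emeasurable_funD.
have ss0 z : 0 <= u%:E + (u + 1)%:E * (G z)%:E + (F z)%:E by rewrite adde_ge0.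
have mss : measurable_fun setT
    (fun z => u%:E + (u + 1)%:E * (G z)%:E + (F z)%:E).
  exact: emeasurable_funD.
apply: (@le_trans _ _ (\int[mu]_(z in B x tau)
    ((L^-1)%:E * (u%:E + (u + 1)%:E * (G z)%:E + (F z)%:E)))).
  apply: ge0_le_lower_integral => // z _; last by rewrite mule_ge0.
  by rewrite lee_fin mulr_ge0//=; have := pointwise z; rewrite -lee_fin; exact.
rewrite ge0_integralZlT// ge0_integralDT// ge0_integralDT// ge0_integralZlT//;
  last by rewrite addr_ge0.
rewrite integral_cst//.
have tQ0 : (0 <= tau `^ Q)%R by exact: powR_ge0.
apply: (@le_trans _ _ ((L^-1)%:E * (u%:E * (D * tau `^ Q)%:E +
    (u + 1)%:E * (tau `^ Q)%:E + (C2 * tau `^ Q)%:E))).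
  apply: lee_wpmul2l => //; apply: leeD; last exact: hC2.
  have u10 : (0 <= u + 1)%R by exact: addr_ge0.
  apply: leeD; apply: lee_wpmul2l; rewrite ?lee_fin//.
    by apply: (mu_qball_le hs); exact: ltW.
  exact: decay.
apply: (@le_trans _ _
    (((`|b y - c x r| + C1) * (D + 1) + C2 + 1) * tau `^ Q)%:E).
  suff h1 : (L^-1 * (u * D + (u + 1) + C2) <=
      (`|b y - c x r| + C1) * (D + 1) + C2 + 1)%R.
    have -> : (L^-1)%:E * (u%:E * (D * tau `^ Q)%:E +
      (u + 1)%:E * (tau `^ Q)%:E + (C2 * tau `^ Q)%:E) =
      (L^-1 * (u * D + (u + 1) + C2) * tau `^ Q)%:E.
      transitivity (L^-1 * (u * (D * tau `^ Q) + (u + 1) * tau `^ Q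
        + C2 * tau `^ Q))%:E; first by [].
      by congr EFin; ring.
    by rewrite lee_fin ler_wpM2r.
  rewrite mulrC ler_pdivrMr// /u.
  have a0 := normr_ge0 (b y - c x r)%R.
  have D1 : (0 <= D + 1)%R by rewrite addr_ge0// ltW.
  have q1 : (`|b y - c x r| * (D + 1) <= `|b y - c x r| * (D + 1) * L)%R.
    by rewrite ler_peMr// mulr_ge0.
  have q2 : (C2 + 1 <= (C2 + 1) * L)%R by rewrite ler_peMr// addr_ge0.
  lra.
rewrite lee_fin /tau (powRM _ (ltW K2) (ltW t0)) mulrA ler_wpM2r ?powR_ge0//.
rewrite mulrC /C -mulrA ler_wpM2l ?powR_ge0//.
have a0 := normr_ge0 (b y - c x r)%R.
have D1 : (0 <= D + 1)%R by rewrite addr_ge0// ltW.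
set a := `|_|%R in a0 *.
have q1 := mulr_ge0 C10 D1.
have q2 := mulr_ge0 a0 q1.
have q3 := mulr_ge0 a0 C20.
lra.
Qed.

(** The coverings give a weak type bound at each level; truncating h at a height proportional to the
    level before covering is what lets these bounds be summed. *)
Lemma near_majorant (N : nat) (L p2 : R) : (1 <= L)%R -> (p < p2)%R ->
  exists2 C, (0 <= C)%R & forall (Psi : R -> R) x r (h : X -> R),
  growth Psi N L p2 ->
  (0 < r)%R -> measurable_fun setT h -> (forall z, 0 <= h z)%R ->
  power_mean_decay h x r ->
  \int[mu]_(z in B x (2 * K * r)%R) (Psi (h z))%:E <= (r `^ Q)%:E ->
  exists G : X -> \bar R, [/\ measurable_fun setT G, (forall z, 0 <= G z),
    \int[mu]_(z in B x r) G z <= (C * r `^ Q)%:E &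
    forall y t, B x r y -> (0 < t <= r)%R -> exists v, [/\ (0 <= v)%R,
      \int[mu]_(z in B y t) (`|b y - b z| * h z)%:E <= (v * t `^ Q)%:E &
      (Psi v)%:E <= G y]].
Proof.
move=> L1 pp2.
have L0 : (0 <= L)%R by exact: le_trans L1.
have [C1 [W [C10 hW]]] := local_oscillation m.+2 N.
have [C2 C20 hC2] := level_sum N (rs_D hs) L1 p0 pp2.
have kap0 : (0 < kap)%R by rewrite mulr_gt0// exprn_gt0.
have K2 : (0 < 2 * K)%R by rewrite mulr_gt0.
pose cst0 := (L * 2 ^+ N * (C1 * kap `^ Q) * 2)%R.
have cst00 : (0 <= cst0)%R by rewrite !mulr_ge0 ?exprn_ge0 ?powR_ge0.
exists (L * C1 * (2 * K) `^ Q + cst0 * C2)%R.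
  by rewrite addr_ge0// !mulr_ge0 ?powR_ge0.
move=> Psi x r h gPsi r0 mh h0 decay hPsi.
have Psi0 := growth_ge0 gPsi.
pose rr := (2 * K * r)%R.
have rrr : (2 * r <= rr)%R by rewrite /rr ler_pM2r// ler_peMr.
have rr0 : (0 < rr)%R by lra.
(* The selection also returns dummy radii 0, about which [hW] says nothing. *)
pose W' a s := if (0 < s)%R then W a s else cst 0.
have mW' a s : measurable_fun setT (W' a s).
  by rewrite /W'; case: ifPn => // s0; case: (hW a s s0).
have W'0 a s z : 0 <= W' a s z.
  by rewrite /W'; case: ifPn => // s0; case: (hW a s s0).
have iW' a s : (0 <= s)%R -> \int[mu]_(z in B a s) W' a s z <= (C1 * s `^ Q)%:E.
  rewrite le_eqVlt => /predU1P[<-|s0].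
    by rewrite (qball_le0 hs)// integral_set0 lee_fin mulr_ge0// powR_ge0.
  by rewrite /W' s0; case: (hW a s s0).
pose q : R := (2 `^ p)%R.
have q1 : (1 < q)%R.
  have := @gt0_ltr_powR R p p0 1%R 2%R.
  by rewrite !nnegrE powR1 ltr1n; apply.
have qi0 i : (0 < q ^+ i)%R by rewrite exprn_gt0// (lt_trans _ q1).
have qiE i : (q ^+ i = (2 ^+ i) `^ p)%R.
  by rewrite /q powR_exprn.
(* Truncation height: on B y t the part of h below [tau i] contributes at most D (tau i)^p t^Q <=
   q^i t^Q / 2, half of what level i requires. *)
pose tau i := (2 ^+ i / (2 * D) : R)%R.
have i20 i : (0 < 2 ^+ i :> R)%R by rewrite exprn_gt0.
have D2 : (0 < 2 * D)%R by rewrite mulr_gt0.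
have tau0 i : (0 < tau i)%R by rewrite divr_gt0.
have mpow f : measurable_fun setT f ->
    measurable_fun setT (fun z : X => (f z `^ p)%R).
  exact: (@measurableT_comp _ _ _ _ _ _ (fun x : R => x `^ p)%R).
have mhp : measurable_fun setT (fun z => (h z `^ p)%:E).
  by apply/measurable_EFinP; exact: mpow.
have hp0 z : 0 <= (h z `^ p)%:E by rewrite lee_fin powR_ge0.
have hpoo : \int[mu]_(z in B x rr) (h z `^ p)%:E < +oo.
  have rrr' : (r < rr)%R by lra.
  apply: le_lt_trans (ltry (rr `^ Q)%R).
  apply: le_trans (decay rr rrr'); apply: ge0_le_lower_integral => // z _.
    rewrite hp0 lee_fin/= ge0_ler_powR ?nnegrE ?(ltW p0)//.
      rewrite mulr_ge0// addr_ge0// ln_ge0// ler_pdivlMr// mul1r; exact: ltW.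
    rewrite ler_peMl// lerDl ln_ge0// ler_pdivlMr// mul1r; exact: ltW.
  by rewrite lee_fin powR_ge0.
pose g i z := ((if tau i < h z then h z `^ p else 0)%R)%:E.
have g0 i z : 0 <= g i z by rewrite /g; case: ifPn.
have gh i z : g i z <= (h z `^ p)%:E by rewrite /g; case: ifPn.
have mg i : measurable_fun setT (g i).
  apply/measurable_EFinP; apply: measurable_fun_ifT => //.
    exact: measurable_fun_ltr.
  exact: mpow.
pose P i y t := [/\ B x r y, (0 < t <= r)%R &
  (q ^+ i / 2 * t `^ Q)%:E <= \int[mu]_(z in B y t) g i z].
have BU y t : B x r y -> (t <= r)%R -> B y t `<=` B x rr.
  move=> xy tr; apply: (qball_subset hs xy); rewrite /rr.
  have : (K * (r + t) <= K * (r + r))%R by rewrite ler_pM2l// lerD2l.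
  by lra.
have /choice[cr hcr] : forall i, exists cr : (nat -> X) * (nat -> R), [/\
    forall j, (0 <= cr.2 j)%R,
    \sum_(j <oo) (cr.2 j `^ Q)%:E <=
      (2 * q ^- i)%:E * \int[mu]_(z in B x rr) g i z &
    forall y t, P i y t -> exists j, (0 < cr.2 j)%R /\
      B y t `<=` B (cr.1 j) (kap * cr.2 j)%R].
  move=> i.
  have PU y t : P i y t -> (0 < t)%R /\ B y t `<=` B x rr.
    by move=> [xy /andP[t0 tr] _]; split=> //; exact: BU.
  have qi2 : (0 < q ^+ i / 2)%R by rewrite divr_gt0.
  have [c' [rho [Pc sumr cov]]] := qball_covering hs x qi2 (mB _ _)
    (mu_qball_lty hs _ _) PU (mg i) (g0 i) (fun y t p => let: And3 _ _ h := p in h).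
  exists (c', rho); split => //.
    by move=> j /=; have [->//|[_ /andP[/ltW]]] := Pc j.
  by rewrite invf_div in sumr.
pose c' i j := (cr i).1 j; pose rho i j := (cr i).2 j.
have r0ij i j : (0 <= rho i j)%R by have [/(_ j)] := hcr i.
have rho0 i j : (0 <= kap * rho i j)%R by rewrite mulr_ge0// ltW.
(* Psi(2^(i+1) (1 + w)) <= L 2^N (1 + w)^N Psi(2^i), and (1 + w)^N is dominated by the oscillation
   function of the dilated ball. *)
pose A i := (L * 2 ^+ N * Psi (2 ^+ i))%R.
have A0 i : (0 <= A i)%R by rewrite !mulr_ge0 ?exprn_ge0.
pose V i j := W' (c' i j) (kap * rho i j)%R \_ (B (c' i j) (kap * rho i j)%R).
have mV i j : measurable_fun setT (V i j).
  by apply/(measurable_restrictT _ _).1 => //; exact: measurable_funTS.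
have V0 i j z : 0 <= V i j z by apply: erestrict_ge0.
pose F i j z := (A i)%:E * V i j z.
have mF i j : measurable_fun setT (F i j) by exact: measurable_funeM.
have F0 i j z : 0 <= F i j z by apply: mule_ge0; [rewrite lee_fin|exact: V0].
pose S i z := \sum_(j <oo) F i j z.
have S0 i z : 0 <= S i z by apply: nneseries_ge0 => j *; exact: F0.
have mS i : measurable_fun setT (S i).
  by apply: ge0_emeasurable_sum => j *; [exact: F0|exact: mF].
have SS0 z : 0 <= \sum_(i <oo) S i z.
  by apply: nneseries_ge0 => i *; exact: S0.
have mSS : measurable_fun setT (fun z => \sum_(i <oo) S i z).
  by apply: ge0_emeasurable_sum => i *; [exact: S0|exact: mS].
have LW0 z : 0 <= L%:E * W' x rr z by rewrite mule_ge0.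
have mLW : measurable_fun setT (fun z => L%:E * W' x rr z).
  exact: measurable_funeM.
exists (fun z => L%:E * W' x rr z + \sum_(i <oo) S i z); split.
- exact: emeasurable_funD.
- by move=> z; rewrite adde_ge0.
- rewrite ge0_integralDT// ge0_integralZlT//.
  have -> : ((L * C1 * (2 * K) `^ Q + cst0 * C2) * r `^ Q)%:E =
      L%:E * (C1 * rr `^ Q)%:E + cst0%:E * (C2%:E * (r `^ Q)%:E).
    transitivity (L * (C1 * rr `^ Q) + cst0 * (C2 * r `^ Q))%:E; last by [].
    by congr EFin; rewrite /rr (powRM _ (ltW K2) (ltW r0)); ring.
  apply: leeD.
    apply: lee_wpmul2l; first by rewrite lee_fin.
    apply: le_trans (iW' x rr (ltW rr0)).
    apply: ge0_le_lower_integral => // [z|z _].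
      by move=> /lt_le_trans; apply; lra.
    by rewrite lexx andbT.
  have iS i : \int[mu]_(z in B x r) S i z <=
      cst0%:E * ((Psi (2 ^+ i) * q ^- i)%:E * \int[mu]_(z in B x rr) g i z).
    rewrite integral_nneseries//; last by move=> j; exact: measurable_funTS.
    have [_ sumr _] := hcr i.
    apply: (@le_trans _ _ (\sum_(j <oo)
      (A i * (C1 * kap `^ Q))%:E * (rho i j `^ Q)%:E)).
      apply: lee_nneseries => j *; first by apply: integral_ge0 => z _; exact: F0.
      rewrite /F ge0_integralZlT// [X in _ <= X * _]EFinM -muleA.
      apply: lee_wpmul2l; first by rewrite lee_fin.
      have := iW' (c' i j) _ (rho0 i j).
      rewrite (powRM _ (ltW kap0) (r0ij i j)).
      rewrite mulrA; apply: le_trans.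
      rewrite [leRHS]integral_mkcond.
      by apply: ge0_le_lower_integral => // z _; rewrite V0 ?lexx.
    rewrite nneseriesZl; last by move=> *; rewrite lee_fin powR_ge0.
    apply: le_trans (lee_wpmul2l _ sumr) _.
      by rewrite lee_fin !mulr_ge0 ?powR_ge0.
    rewrite !muleA -!EFinM; apply: lee_wpmul2r.
      by apply: integral_ge0 => z _; exact: g0.
    rewrite lee_fin /cst0 /A le_eqVlt; apply/orP; left; apply/eqP.
    by field; rewrite gt_eqF.
  rewrite integral_nneseries//; last by move=> i; exact: measurable_funTS.
  apply: le_trans (lee_nneseries _ (fun i _ => iS i)) _.
    by move=> i *; apply: integral_ge0 => z _; exact: S0.
  rewrite nneseriesZl; last first.
    move=> i _; rewrite mule_ge0// ?lee_fin ?mulr_ge0 ?invr_ge0 ?(ltW (qi0 i))//.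
    by apply: integral_ge0 => z _; exact: g0.
  apply: lee_wpmul2l; first by rewrite lee_fin.
  have co0 i : (0 <= Psi (2 ^+ i) * q ^- i)%R.
    by rewrite mulr_ge0 ?invr_ge0 ?(ltW (qi0 i)).
  have cg0 i z : 0 <= (Psi (2 ^+ i) * q ^- i)%:E * g i z.
    by apply: mule_ge0; [rewrite lee_fin; exact: co0|exact: g0].
  (* Once inside the integral, the sum over the levels is the one bounded by [level_sum] at s = h
     z. *)
  rewrite (eq_eseriesr (g := fun i => \int[mu]_(z in B x rr)
    ((Psi (2 ^+ i) * q ^- i)%:E * g i z))); last first.
    by move=> i _; rewrite ge0_integralZlT.
  rewrite -integral_nneseries//; last first.
    by move=> i; apply: measurable_funTS; exact: measurable_funeM.
  have mPsih : measurable_fun setT (fun z => (Psi (h z))%:E).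
    apply/measurable_EFinP; apply: measurableT_comp => //.
    by apply: nondecreasing_measurable => //; exact: (growth_homo gPsi).
  apply: (@le_trans _ _ (\int[mu]_(z in B x rr) (C2%:E * (Psi (h z))%:E))).
    apply: ge0_le_lower_integral => // z _; last by rewrite mule_ge0// lee_fin.
    rewrite nneseries_ge0 /=; last by move=> i *; exact: cg0.
    have := hC2 Psi gPsi (h z) (h0 z); apply: le_trans.
    apply: lee_nneseries => i *; first exact: cg0.
    rewrite /g -EFinM; case: ifPn => // _.
    by rewrite mulr0.
  have Ph0 z : 0 <= (Psi (h z))%:E by rewrite lee_fin.
  rewrite ge0_integralZlT//.
  by apply: lee_wpmul2l => //; rewrite lee_fin.
move=> y t xy /andP[t0 tr].
have By := BU _ _ xy tr.
have tQ : (0 < t `^ Q)%R by exact: powR_gt0.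
have Joo : \int[mu]_(z in B y t) (h z `^ p)%:E < +oo.
  apply: le_lt_trans hpoo; apply: ge0_le_lower_integral => // z _.
  by rewrite lexx andbT.
pose J := (fine (\int[mu]_(z in B y t) (h z `^ p)%:E) / t `^ Q)%R.
have JE : \int[mu]_(z in B y t) (h z `^ p)%:E = (J * t `^ Q)%:E.
  rewrite /J divfK ?gt_eqF// fineK// ge0_fin_numE.
    exact: Joo.
  by apply: integral_ge0 => z _; exact: hp0.
have main n w : (0 <= w)%R -> (J <= q ^+ n)%R ->
    \int[mu]_(z in B y t) (`|b y - b z| ^+ m.+2)%:E <= (w * t `^ Q)%:E ->
    \int[mu]_(z in B y t) (`|b y - b z| * h z)%:E <=
      (2 ^+ n * (1 + w) * t `^ Q)%:E.
  move=> w0 Jq hw.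
  have mby : measurable_fun setT (fun z => (`|b y - b z| ^+ m.+2)%:E).
    apply/measurable_EFinP; apply: measurable_funX; apply: measurableT_comp => //.
    exact: measurable_funB.
  have by0 z : 0 <= (`|b y - b z| ^+ m.+2)%:E by rewrite lee_fin exprn_ge0.
  have qin : (0 <= q ^- n)%R by rewrite invr_ge0 ltW.
  have qh0 z : 0 <= (q ^- n)%:E * (h z `^ p)%:E by rewrite mule_ge0.
  have mqh : measurable_fun setT (fun z => (q ^- n)%:E * (h z `^ p)%:E).
    exact: measurable_funeM.
  have ss0 z : 0 <= (`|b y - b z| ^+ m.+2)%:E + (q ^- n)%:E * (h z `^ p)%:E.
    by rewrite adde_ge0.
  have mss : measurable_fun setT (fun z =>
      (`|b y - b z| ^+ m.+2)%:E + (q ^- n)%:E * (h z `^ p)%:E).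
    exact: emeasurable_funD.
  apply: (@le_trans _ _ (\int[mu]_(z in B y t) ((2 ^+ n)%:E *
      ((`|b y - b z| ^+ m.+2)%:E + (q ^- n)%:E * (h z `^ p)%:E)))).
    apply: ge0_le_lower_integral => // z _; last first.
      by rewrite mule_ge0// lee_fin ltW.
    rewrite lee_fin mulr_ge0//=.
    have hn0 : (0 <= h z / 2 ^+ n)%R by rewrite divr_ge0// ltW.
    have := young_split m (normr_ge0 (b y - b z)%R) hn0.
    rewrite -/p powR_div ?(ltW (i20 n))// -qiE.
    rewrite -(ler_pM2l (i20 n)) => hy.
    have : (`|b y - b z| * h z <=
        2 ^+ n * (`|b y - b z| ^+ m.+2 + q ^- n * h z `^ p))%R.
      rewrite (mulrC (q ^- n)); apply: le_trans hy.
      rewrite le_eqVlt; apply/orP; left; apply/eqP; field.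
      by rewrite gt_eqF.
    by rewrite -lee_fin; exact.
  rewrite ge0_integralZlT// ?(ltW (i20 n))// ge0_integralDT// ge0_integralZlT//.
  rewrite -mulrA [leRHS]EFinM; apply: lee_wpmul2l; first by rewrite lee_fin ltW.
  rewrite mulrDl mul1r EFinD addeC; apply: leeD => //.
  rewrite JE -EFinM lee_fin mulrA ler_piMl ?(ltW tQ)//.
  by rewrite mulrC ler_pdivrMr// mul1r.
(* Small means need no selection: Psi(1) = 1, and the oscillation function of the whole dilated ball
   suffices. *)
have [J1|J1] := leP J 1%R.
  have [_ _ _ /(_ y t t0 By)[w [w0 iw wW]]] := hW x rr rr0.
  exists (2 ^+ 0 * (1 + w))%R; split.
  - by rewrite mulr_ge0// addr_ge0.
  - by apply: main.
  - apply: (@le_trans _ _ (L%:E * W' x rr y)); last by rewrite leeDl.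
    rewrite /W' rr0; apply: le_trans (lee_wpmul2l _ wW); last by rewrite lee_fin.
    rewrite -EFinM lee_fin expr0 mul1r -[(1 + w)%R in leLHS]mulr1.
    apply: le_trans (growth_upper gPsi _ _) _; rewrite ?lerDl//.
    by rewrite (growth1 gPsi) mulr1.
have [i /andP[qJ Jq]] := level_exists q1 J1.
have Pi : P i y t.
  split=> //; first by rewrite t0.
  have e1 : (q ^+ i / 2 * t `^ Q)%:E \is a fin_num by [].
  rewrite -(@leeD2lE _ (q ^+ i / 2 * t `^ Q)%:E)// -EFinD -mulrDl -splitr.
  apply: (@le_trans _ _ (J * t `^ Q)%:E); first by rewrite lee_fin ler_pM2r// ltW.
  rewrite -JE.
  apply: (@le_trans _ _ (\int[mu]_(z in B y t) ((tau i `^ p)%:E + g i z))).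
    apply: ge0_le_lower_integral => // z _; last first.
      by rewrite adde_ge0// lee_fin powR_ge0.
    rewrite hp0 /= /g -EFinD lee_fin; case: ltP => [_|ht].
      by rewrite lerDr powR_ge0.
    by rewrite addr0 ge0_ler_powR ?nnegrE ?(ltW p0)// ltW.
  rewrite ge0_integralDT//; last by rewrite lee_fin powR_ge0.
  apply: leeD => //; rewrite integral_cst//.
  apply: le_trans (lee_wpmul2l _ (mu_qball_le hs y (ltW t0))) _.
    by rewrite lee_fin powR_ge0.
  rewrite -EFinM lee_fin mulrA ler_pM2r// /tau powR_div ?(ltW D2) ?(ltW (i20 i))//.
  rewrite -qiE -mulrA ler_pM2l// mulrC ler_pdivrMr ?powR_gt0//.
  rewrite mulrC -ler_pdivrMr// invrK mulrC -[leLHS]powRr1 ?(ltW D2)//.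
  apply: ler_powR; last exact: ltW.
  by have := rs_D hs; lra.
have [_ _ /(_ y t Pi)[j [rj0 Bj]]] := hcr i.
have kr0 : (0 < kap * rho i j)%R by rewrite mulr_gt0.
have [_ _ _ /(_ y t t0 Bj)[w [w0 iw wW]]] := hW (c' i j) _ kr0.
exists (2 ^+ i.+1 * (1 + w))%R; split.
- by rewrite mulr_ge0// ?addr_ge0// ltW.
- by apply: main.
apply: (@le_trans _ _ (F i j y)).
  rewrite /F /V patchE mem_set; last by apply: Bj; exact: (qball_center hs).
  rewrite /W' kr0; apply: le_trans (lee_wpmul2l _ wW); last by rewrite lee_fin.
  rewrite -EFinM lee_fin.
  have -> : (2 ^+ i.+1 * (1 + w) = (2 * (1 + w)) * 2 ^+ i)%R.
    by rewrite exprS; ring.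
  apply: le_trans (growth_upper gPsi _ (ltW (i20 i))) _; first by lra.
  rewrite exprMn /A le_eqVlt; apply/orP; left; apply/eqP; ring.
apply: le_trans (nneseries_ge j (fun k => F0 i k y)) _.
apply: le_trans (nneseries_ge i (fun k => S0 k y)) _.
by rewrite leeDr.
Qed.

End commutator.

(** * The Luxemburg norm of the commutator on one ball *)

Context {Phi : R -> \bar R} {F : R -> R} {N : nat} {L p2 : R}.
Hypothesis hPhi : young_function Phi.
Hypothesis hF : doubling_young Phi F N L p2.
Variable V : R -> R.
Hypothesis hV : forall t, (0 < t)%R ->
  quasi_inverse (F := F) (N := N) (L := L) (t `^ (- Q)) (V t).
Local Notation k := (L * 2 ^+ N)%R.

Lemma mu_qballE x r : (0 < r)%R -> exists M, [/\ (0 < M)%R,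
  mu (B x r) = M%:E, (M^-1 <= D * r `^ (- Q))%R & (r `^ (- Q) <= D * M^-1)%R].
Proof.
move=> r0; have rQ : (0 < r `^ Q)%R by exact: powR_gt0.
have muf : mu (B x r) \is a fin_num by rewrite ge0_fin_numE// (mu_qball_lty hs).
have := mu_qball_le hs x (ltW r0); have := mu_qball_ge hs x r0.
rewrite -(fineK muf) !lee_fin; set M := fine _ => MD DM.
have M0 : (0 < M)%R.
  by apply: lt_le_trans MD; rewrite mulr_gt0// invr_gt0.
exists M; split => //; rewrite powRN.
  rewrite -[D in leRHS]invrK -invfM lef_pV2 ?posrE// mulr_gt0// invr_gt0//.
by rewrite -[D in leRHS]invrK -invfM lef_pV2 ?posrE ?mulr_gt0 ?invr_gt0// mulrC ler_pdivrMr// mulrC.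
Qed.

Lemma exists_exponent : exists m : nat, (m.+2%:R / m.+1%:R < p2)%R.
Proof.
have p20 : (0 < p2 - 1)%R by rewrite subr_gt0 (dy_p hF).
exists (Num.truncn (p2 - 1)^-1).
set m := Num.truncn _.
have -> : (m.+2%:R / m.+1%:R = m.+1%:R^-1 + 1 :> R)%R.
  by rewrite -[in LHS]natr1; field; rewrite addrC natr1.
rewrite -ltrBrDr -[ltRHS]invrK ltf_pV2 ?posrE ?invr_gt0//.
by rewrite truncnS_gt// num_real.
Qed.

(** The hypothesis on f is the modular form of a norm at most S/((1 + ln(t/r)) V t) on every larger
    ball. Rescaling f by S and Phi by V r reduces it to the normalised estimates. *)
Lemma ball_estimate : exists2 C, (0 < C)%R & forall (f : X -> R) x r (S : R),
  (0 < r)%R -> (0 < S)%R -> measurable_fun setT f ->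
  (forall t, (r < t)%R -> \int[mu]_(z in B x t)
     (F (`|f z| / (S / ((1 + ln (t / r)) * V t))))%:E <= 1) ->
  luxemburg_norm mu Phi (maximal_commutator d mu b f \_ (B x r)) <=
    (C * S / V r)%:E.
Proof.
have L1 := dy_L hF; have L0 : (0 < L)%R by exact: lt_le_trans L1.
have k1 : (1 <= k)%R by exact: (dy_k_ge1 hF).
have k0 : (0 < k)%R by exact: lt_le_trans k1.
have K2 : (0 < 2 * K)%R by rewrite mulr_gt0.
have K21 : (1 <= 2 * K)%R by have := K1; lra.
have [m mp2] := exists_exponent.
pose p : R := (m.+2%:R / m.+1%:R)%R.
have p1 : (1 < p)%R by rewrite /p ltr_pdivlMr// mul1r ltr_nat.
have p0 : (0 < p)%R by exact: lt_trans p1.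
have [Cf Cf0 hfar] := far_estimate m.
have [Cn Cn0 hnear] := near_majorant N L1 mp2.
have [CN CN0 hCN] := bmo_moments N.
have K2Q : (1 <= (2 * K) `^ Q)%R.
  by rewrite -[leLHS](@powRr0 R (2 * K)%R); apply: ler_powR => //; exact: ltW.
pose c2 := (L * k ^+ 2 * (2 * K) `^ Q)%R.
have c21 : (1 <= c2)%R.
  by rewrite mulr_ege1// mulr_ege1// exprn_ege1.
pose C3 := (D + L * k)%R.
have C31 : (1 <= C3)%R.
  by rewrite -[leLHS]addr0 lerD ?(rs_D hs)// mulr_ge0// ltW.
(* One rescaling of f must give [decay] and [hPsi] with constant 1: [C3] collects the two terms
   integrated in [decay], [c2] compares V r with V (2Kr), and [k] is spent through convexity. *)
pose C5 := (c2 * k * C3)%R.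
have C5C3 : (C3 <= C5)%R by rewrite ler_peMl ?(le_trans ler01 C31)// mulr_ege1.
have C51 : (1 <= C5)%R by exact: le_trans C5C3.
have C50 : (0 < C5)%R by exact: lt_le_trans C51.
pose Cf1 := (Cf + 1)%R.
have Cf11 : (1 <= Cf1)%R by rewrite lerDr.
pose C6 := (Cn + L * Cf1 ^+ N * (2 ^+ N * (D + CN)))%R.
have C60 : (0 <= C6)%R.
  rewrite addr_ge0// !mulr_ge0 ?exprn_ge0 ?addr_ge0 ?(ltW L0) ?(ltW D0)//.
(* Makes the final modular at most 1: one [k] is from F(u) r^Q <= k, the other from doubling. *)
pose Y := (k ^+ 2 * C6 + 1)%R.
have Y1 : (1 <= Y)%R by rewrite lerDr mulr_ge0// exprn_ge0// ltW.
have Y0 : (0 < Y)%R by exact: lt_le_trans Y1.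
exists (C5 * D * Y)%R; first exact: mulr_gt0 (mulr_gt0 C50 D0) Y0.
move=> f x r S r0 S0 mf hyp.
pose u := V r.
have [u0 uk ku] := hV r0; rewrite -/u in u0 uk ku.
have Fu0 := dy_gt0 hF u0.
have rQ : (0 < r `^ Q)%R by exact: powR_gt0.
pose h z := (`|f z| / (S * C5))%R.
have SC5 : (0 < S * C5)%R by rewrite mulr_gt0.
have h0 z : (0 <= h z)%R by rewrite divr_ge0// ltW.
have mh : measurable_fun setT h.
  by apply: measurable_funM => //; exact: measurableT_comp.
have mFf (a : R) : measurable_fun setT (fun z => (F (`|f z| / a))%:E).
  apply/measurable_EFinP; apply: measurableT_comp.
    by apply: nondecreasing_measurable => //; exact: (dy_homo hF).
  by apply: measurable_funM => //; exact: measurableT_comp.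
have decay : power_mean_decay m h x r.
  move=> t rt.
  have t0 : (0 < t)%R by exact: lt_trans rt.
  have tQ : (0 < t `^ Q)%R by exact: powR_gt0.
  have [v0 _ kv] := hV t0.
  set lt := (1 + ln (t / r))%R.
  have lt1 : (1 <= lt)%R by rewrite lerDl ln_ge0// ler_pdivlMr// mul1r ltW.
  have lt0 : (0 < lt)%R by exact: lt_le_trans lt1.
  pose a := (S / (lt * V t))%R.
  have hypt : \int[mu]_(z in B x t) (F (`|f z| / a))%:E <= 1 by exact: hyp.
  have w0 : (0 <= L * k * t `^ Q / C5)%R.
    by rewrite !mulr_ge0 ?invr_ge0 ?exprn_ge0 ?(ltW L0) ?(ltW C50) ?(ltW tQ).
  have Fa0 z : 0 <= (F (`|f z| / a))%:E by rewrite lee_fin (dy_ge0 hF).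
  have wF0 z : 0 <= (L * k * t `^ Q / C5)%:E * (F (`|f z| / a))%:E.
    by rewrite mule_ge0.
  apply: (@le_trans _ _ (\int[mu]_(z in B x t)
      ((C5^-1)%:E + (L * k * t `^ Q / C5)%:E * (F (`|f z| / a))%:E))).
    apply: ge0_le_lower_integral => // z _; last first.
      by rewrite adde_ge0// lee_fin invr_ge0 ltW.
    rewrite lee_fin powR_ge0/=.
    pose y := (lt * (`|f z| / S))%R.
    have y0 : (0 <= y)%R by rewrite mulr_ge0 ?divr_ge0// ltW.
    have av : ((t `^ Q)^-1 <= k * F (V t))%R by rewrite -powRN.
    have := power_le_young hF p0 (ltW mp2) tQ v0 y0 av.
    have -> : (V t * y = `|f z| / a)%R.
      by rewrite /y /a; field; rewrite !gt_eqF.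
    move=> hy.
    have : ((lt * h z) `^ p <= C5^-1 * (1 + L * k * t `^ Q * F (`|f z| / a)))%R.
      have -> : (lt * h z = y / C5)%R by rewrite /h /y; field; rewrite !gt_eqF.
      rewrite powR_div ?(ltW C50)// mulrC.
      apply: ler_pM; rewrite ?invr_ge0 ?powR_ge0//.
      rewrite lef_pV2 ?posrE ?powR_gt0// -[leLHS]powRr1 ?(ltW C50)//.
      by apply: ler_powR => //; exact: ltW.
    have -> : (C5^-1 * (1 + L * k * t `^ Q * F (`|f z| / a)) =
       C5^-1 + L * k * t `^ Q / C5 * F (`|f z| / a))%R.
      by field; rewrite gt_eqF.
    by rewrite -lee_fin; exact.
  rewrite ge0_integralDT//; last 2 first.
  - exact: measurable_funeM.
  - by rewrite lee_fin invr_ge0 ltW.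
  rewrite integral_cst// ge0_integralZlT//.
  apply: (@le_trans _ _
    ((C5^-1)%:E * (D * t `^ Q)%:E + (L * k * t `^ Q / C5)%:E * 1)).
    apply: leeD; apply: lee_wpmul2l => //.
      by rewrite lee_fin invr_ge0 ltW.
    by apply: (mu_qball_le hs); exact: ltW.
  rewrite mule1.
  have : (C5^-1 * (D * t `^ Q) + L * k * t `^ Q / C5 <= t `^ Q)%R.
    have -> : (C5^-1 * (D * t `^ Q) + L * k * t `^ Q / C5 =
      C3 / C5 * t `^ Q)%R by rewrite /C3; field; rewrite gt_eqF.
    by rewrite ler_piMl ?(ltW tQ)// ler_pdivrMr// mul1r.
  by rewrite -lee_fin; exact.
pose Psi s := (F (u * s) / F u)%R.
have gPsi : growth Psi N L p2 by exact: (growth_rescale hF u0).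
have Psi0 := growth_ge0 gPsi.
have hPsi : \int[mu]_(z in B x (2 * K * r)%R) (Psi (h z))%:E <= (r `^ Q)%:E.
  set t := (2 * K * r)%R.
  have rt : (r < t)%R.
    by rewrite /t -[ltLHS]mul1r ltr_pM2r//; have := K1; lra.
  have t0 : (0 < t)%R by exact: lt_trans rt.
  have [v0 _ kv] := hV t0.
  set lt := (1 + ln (t / r))%R.
  have lt1 : (1 <= lt)%R by rewrite lerDl ln_ge0// ler_pdivlMr// mul1r ltW.
  have lt0 : (0 < lt)%R by exact: lt_le_trans lt1.
  pose a := (S / (lt * V t))%R.
  have a0 : (0 < a)%R by rewrite divr_gt0// mulr_gt0.
  have hypt : \int[mu]_(z in B x t) (F (`|f z| / a))%:E <= 1 by exact: hyp.
  have uc2 : (u <= c2 * V t)%R.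
    apply: (quasi_inverse_le hF (powR_gt0 _ t0) (hV r0) (hV t0) K2Q).
    rewrite /t (powRM _ (ltW K2) (ltW r0)) mulrA (powRN (2 * K)%R) divff ?mul1r//.
    by rewrite gt_eqF// powR_gt0.
  apply: (@le_trans _ _ (\int[mu]_(z in B x t)
      ((r `^ Q)%:E * (F (`|f z| / a))%:E))).
    apply: ge0_le_lower_integral => // z _; last first.
      by rewrite mule_ge0// lee_fin ?powR_ge0// (dy_ge0 hF).
    rewrite lee_fin Psi0/=.
    have : (Psi (h z) <= r `^ Q * F (`|f z| / a))%R.
      (* Convexity turns a division by [k] inside [F] into a gain 1/k, to be set against r^(-Q) <= k
         F(u). *)
      have e1 : (F (u * h z) <= F (`|f z| / a) / k)%R.
        have fa0 : (0 <= `|f z| / a)%R by rewrite divr_ge0// ltW.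
        apply: le_trans (dy_convex hF k1 fa0); apply: (dy_homo hF).
        have -> : (`|f z| / a / k = `|f z| * (lt * V t / (S * k)))%R.
          by rewrite /a; field; rewrite !gt_eqF.
        rewrite /h mulrCA; apply: ler_wpM2l => //.
        rewrite ler_pdivrMr// mulrAC ler_pdivlMr ?mulr_gt0//.
        apply: (@le_trans _ _ (c2 * V t * (S * k))%R).
          by rewrite ler_wpM2r// mulr_ge0 ?ltW.
        have -> : (lt * V t * (S * C5) = lt * C3 * (c2 * V t * (S * k)))%R.
          by rewrite /C5; ring.
        rewrite ler_peMl ?mulr_ege1//.
        have c20 : (0 <= c2)%R by exact: le_trans c21.
        exact: mulr_ge0 (mulr_ge0 c20 (ltW v0)) (mulr_ge0 (ltW S0) (ltW k0)).
      rewrite /Psi ler_pdivrMr//; apply: le_trans e1 _.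
      have ku' : (1 <= r `^ Q * (k * F u))%R.
        by move: ku; rewrite powRN -[leLHS]mul1r ler_pdivrMr// mulrC.
      rewrite ler_pdivrMr//.
      have -> : (r `^ Q * F (`|f z| / a) * F u * k =
        r `^ Q * (k * F u) * F (`|f z| / a))%R by ring.
      by rewrite ler_peMl ?(dy_ge0 hF).
    by rewrite -lee_fin; exact.
  have Fa0 z : 0 <= (F (`|f z| / a))%:E by rewrite lee_fin (dy_ge0 hF).
  rewrite ge0_integralZlT// ?(ltW rQ)//.
  rewrite -[leRHS]mule1; apply: lee_wpmul2l => //.
  by rewrite lee_fin ltW.
have [G [mG G0 iG hG]] := hnear Psi x r h gPsi r0 mh h0 decay hPsi.
pose e y := (1 + `|b y - c x r|)%R.
have e1 y : (1 <= e y)%R by rewrite lerDl.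
(* The second term dominates Psi of the bound from [far_estimate], as Psi grows at most like the
   N-th power. *)
pose G' y := G y + (L * Cf1 ^+ N)%:E * (e y ^+ N)%:E.
have w0 : (0 <= L * Cf1 ^+ N)%R.
  by rewrite mulr_ge0 ?exprn_ge0 ?(ltW L0) ?(le_trans ler01 Cf11).
have eN0 y : 0 <= (e y ^+ N)%:E by rewrite lee_fin exprn_ge0// (le_trans ler01).
have meN : measurable_fun setT (fun y => (e y ^+ N)%:E).
  apply/measurable_EFinP; apply: measurable_funX; apply: measurable_funD => //.
  exact: measurable_dist.
have weN0 y : 0 <= (L * Cf1 ^+ N)%:E * (e y ^+ N)%:E by rewrite mule_ge0.
have G'0 y : 0 <= G' y by rewrite adde_ge0.
have mweN : measurable_fun setT (fun y => (L * Cf1 ^+ N)%:E * (e y ^+ N)%:E).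
  exact: measurable_funeM.
have mG' : measurable_fun setT G' by exact: emeasurable_funD.
have iG' : \int[mu]_(y in B x r) G' y <= (C6 * r `^ Q)%:E.
  rewrite ge0_integralDT// ge0_integralZlT//.
  have -> : (C6 * r `^ Q)%:E = (Cn * r `^ Q)%:E +
      (L * Cf1 ^+ N)%:E * ((2 ^+ N)%:E * ((D * r `^ Q)%:E + (CN * r `^ Q)%:E)).
    transitivity (Cn * r `^ Q + L * Cf1 ^+ N *
      (2 ^+ N * (D * r `^ Q + CN * r `^ Q)))%:E; last by [].
    by congr EFin; rewrite /C6; ring.
  apply: leeD => //; apply: lee_wpmul2l; first by rewrite lee_fin.
  have mbN : measurable_fun setT (fun y => (`|b y - c x r| ^+ N)%:E).
    by apply/measurable_EFinP; apply: measurable_funX; exact: measurable_dist.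
  have bN0 y : 0 <= (`|b y - c x r| ^+ N)%:E by rewrite lee_fin exprn_ge0.
  have mb1 : measurable_fun setT (fun y => 1 + (`|b y - c x r| ^+ N)%:E).
    exact: emeasurable_funD.
  have b10 y : 0 <= 1 + (`|b y - c x r| ^+ N)%:E by rewrite adde_ge0.
  apply: (@le_trans _ _ (\int[mu]_(y in B x r)
      ((2 ^+ N)%:E * (1 + (`|b y - c x r| ^+ N)%:E)))).
    apply: ge0_le_lower_integral => // y _; last by rewrite mule_ge0// lee_fin.
    rewrite eN0/=.
    have := exprD_le N ler01 (normr_ge0 (b y - c x r)%R).
    by rewrite expr1n -lee_fin; exact.
  rewrite ge0_integralZlT// ge0_integralDT// integral_cst// mul1e.
  apply: lee_wpmul2l; first by rewrite lee_fin.
  apply: leeD; last exact: hCN.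
  by apply: (mu_qball_le hs); exact: ltW.
pose Z := (S * C5 * D)%R.
have Z0 : (0 < Z)%R by exact: mulr_gt0.
have hv y t : B x r y -> (0 < t)%R -> exists v, [/\ (0 <= v)%R,
    (mu (B y t))^-1 * \int[mu]_(z in B y t) (`|b y - b z| * `|f z|)%:E <=
      (Z * v)%:E & (Psi v)%:E <= G' y].
  move=> xy t0.
  have tQ : (0 < t `^ Q)%R by exact: powR_gt0.
  have [v [v0 iv Gv]] : exists v, [/\ (0 <= v)%R,
      \int[mu]_(z in B y t) (`|b y - b z| * h z)%:E <= (v * t `^ Q)%:E &
      (Psi v)%:E <= G' y].
    have [tr|rt] := leP t r.
      have tr' : (0 < t <= r)%R by rewrite t0.
      have [v [v0 iv Gv]] := hG y t xy tr'.
      by exists v; split => //; apply: le_trans Gv _; rewrite leeDl.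
    exists (Cf * e y)%R; split; first by rewrite mulr_ge0// (le_trans ler01).
      exact: hfar h r0 mh h0 decay y t xy (ltW rt).
    apply: (@le_trans _ _ ((L * Cf1 ^+ N)%:E * (e y ^+ N)%:E)); last by rewrite leeDr.
    have ey0 : (0 <= e y)%R by exact: le_trans (e1 y).
    have a1 : (1 <= Cf1 * e y)%R by rewrite mulr_ege1.
    rewrite -EFinM lee_fin.
    apply: (@le_trans _ _ (Psi (Cf1 * e y * 1)%R)).
      by apply: (growth_homo gPsi); rewrite mulr1 ler_wpM2r// lerDl.
    apply: le_trans (growth_upper gPsi a1 ler01) _.
    by rewrite (growth1 gPsi) mulr1 exprMn mulrA.
  exists v; split => //.
  have [M [M0 -> Mt _]] := mu_qballE y t0.
  rewrite inver gt_eqF//.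
  have bh0 z : 0 <= (`|b y - b z| * h z)%:E by rewrite lee_fin mulr_ge0.
  have mbh : measurable_fun setT (fun z => (`|b y - b z| * h z)%:E).
    apply/measurable_EFinP; apply: measurable_funM => //.
    apply: measurableT_comp => //; exact: measurable_funB.
  have -> : \int[mu]_(z in B y t) (`|b y - b z| * `|f z|)%:E =
      (S * C5)%:E * \int[mu]_(z in B y t) (`|b y - b z| * h z)%:E.
    rewrite -ge0_integralZlT// ?(ltW SC5)//; apply: eq_integral => z _.
    rewrite -EFinM; congr EFin; rewrite /h; field.
    by rewrite !gt_eqF.
  apply: (@le_trans _ _ ((M^-1)%:E * ((S * C5)%:E * (v * t `^ Q)%:E))).
    apply: lee_wpmul2l; first by rewrite lee_fin invr_ge0 ltW.
    by apply: lee_wpmul2l => //; rewrite lee_fin ltW.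
  rewrite -!EFinM lee_fin.
  apply: (@le_trans _ _ (D * t `^ (- Q) * (S * C5 * (v * t `^ Q)))%R).
    rewrite ler_wpM2r//; exact: mulr_ge0 (ltW SC5) (mulr_ge0 v0 (ltW tQ)).
  rewrite powRN /Z le_eqVlt; apply/orP; left; apply/eqP; field.
  by rewrite gt_eqF.
pose l := (C5 * D * Y * S / u)%R.
have l0 : (0 < l)%R.
  exact: divr_gt0 (mulr_gt0 (mulr_gt0 (mulr_gt0 C50 D0) Y0) S0) u0.
apply: ereal_inf_lbound; exists l => //; split => //.
pose kk := (F u * k / Y)%R.
have kk0 : (0 < kk)%R by rewrite divr_gt0// mulr_gt0.
have pointwise y : B x r y ->
    young_ext Phi ((l^-1)%:E * `|maximal_commutator d mu b f y|) <= kk%:E * G' y.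
  move=> xy; set M := maximal_commutator d mu b f y.
  have M0 : 0 <= M.
    apply: le_ereal_sup_tmp; exists ((mu (B y 1))^-1 *
        \int[mu]_(z in B y 1) (`|b y - b z| * `|f z|)%:E); first by exists 1%R.
    rewrite mule_ge0//; last by apply: integral_ge0 => z _; rewrite lee_fin mulr_ge0.
    by rewrite inve_ge0.
  (* The supremum need not be attained, but some ball exceeds half of a positive finite value;
     doubling absorbs the factor 2. *)
  have large a : (a%:E < M) -> exists2 v, (a < Z * v)%R & (Psi v)%:E <= G' y.
    move=> /ereal_sup_gt[_ [t t0 ->] at_].
    have [v [v0 hZ hGv]] := hv y t xy t0.
    by exists v => //; rewrite -lte_fin; exact: lt_le_trans hZ.
  rewrite gee0_abs//; move: M0 large; case: M => [a| |//].
  - rewrite lee_fin => a0 large.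
    have [v av Gv] : exists2 v, (a <= Z * (2 * v))%R & (Psi v)%:E <= G' y.
      have [a_eq|an0] := eqVneq a 0%R.
        have [v [v0 _ Gv]] := hv y 1%R xy ltr01.
        exists v => //; rewrite a_eq.
        exact: mulr_ge0 (ltW Z0) (mulr_ge0 (ler0n _ 2) v0).
      have agt0 : (0 < a)%R by rewrite lt_neqAle eq_sym an0.
      have [|v av Gv] := large (a / 2)%R; first by rewrite lte_fin; lra.
      by exists v => //; lra.
    rewrite /= (dy_E hF); last by rewrite mulr_ge0// invr_ge0 ltW.
    apply: (@le_trans _ _ (kk%:E * (Psi v)%:E)); last first.
      by apply: lee_wpmul2l => //; rewrite lee_fin ltW.
    rewrite -EFinM lee_fin.
    have -> : (l^-1 * a = u * (a / Z) / Y)%R.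
      by rewrite /l /Z; field; rewrite !gt_eqF.
    have aZ0 : (0 <= a / Z)%R by rewrite divr_ge0// ltW.
    have v0 : (0 <= v)%R.
      have : (0 <= Z * (2 * v))%R by exact: le_trans av.
      by rewrite pmulr_rge0// pmulr_rge0.
    apply: le_trans (dy_convex hF Y1 _) _; first by rewrite mulr_ge0 ?(ltW u0).
    have -> : (F (u * (a / Z)) = F u * Psi (a / Z))%R.
      by rewrite /Psi [RHS]mulrC divfK// gt_eqF.
    have -> : (kk * Psi v = F u * (k * Psi v) / Y)%R by rewrite /kk; ring.
    rewrite ler_wpM2r ?invr_ge0 ?(ltW Y0)// ler_wpM2l ?(ltW Fu0)//.
    apply: (@le_trans _ _ (Psi (2 * v)%R)).
      by apply: (growth_homo gPsi); rewrite ler_pdivrMr// mulrC.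
    by apply: (growth_upper gPsi) => //; rewrite ler1n.
  (* An infinite supremum forces arbitrarily large v; as Psi grows at least linearly from 1 on, the
     majorant is infinite as well. *)
  - move=> _ large.
    have -> : G' y = +oo.
      apply/eqyP => A A0.
      have [|v Av Gv] := large (Z * (L * A + 1))%R; first exact: ltry.
      rewrite ltr_pM2l// in Av.
      have LA : (0 <= L * A)%R by rewrite mulr_ge0// ltW.
      have v1 : (1 <= v)%R by lra.
      apply: le_trans Gv; rewrite lee_fin.
      have v0 : (0 < v)%R by exact: lt_le_trans v1.
      have := growth_lower gPsi ltr01 v1.
      rewrite (growth1 gPsi) div1r => hPv.
      have vp : ((v^-1) `^ p2 <= v^-1)%R.
        rewrite powR_invl ?(ltW v0)// lef_pV2 ?posrE ?powR_gt0//.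
        rewrite -[leLHS]powRr1 ?(ltW v0)//; apply: ler_powR => //.
        exact: ltW (dy_p hF).
      have : (1 <= L * v^-1 * Psi v)%R.
        apply: le_trans hPv _; rewrite ler_wpM2r//.
        by rewrite ler_pM2l.
      rewrite mulrAC ler_pdivlMr// mul1r => vL.
      by rewrite -(ler_pM2l L0); apply: le_trans vL; lra.
    by rewrite !gt0_muley ?lte_fin ?invr_gt0 ?leey.
have mkG : measurable_fun setT (fun y => kk%:E * G' y) by exact: measurable_funeM.
apply: (@le_trans _ _ (\int[mu]_(y in B x r) (kk%:E * G' y))).
  rewrite [leRHS]integral_mkcond; apply: ge0_le_lower_integral => // y _; last first.
    by apply: erestrict_ge0 => z _; rewrite mule_ge0// lee_fin ltW.
  rewrite !patchE; case: ifPn => [/set_mem xy|_].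
    rewrite pointwise// andbT; apply: (young_ext_ge0 hPhi).
    by rewrite mule_ge0// lee_fin invr_ge0 ltW.
  by rewrite /= normr0 mulr0 (young0 hPhi) lexx.
rewrite ge0_integralZlT// ?(ltW kk0)//.
apply: (@le_trans _ _ (kk%:E * (C6 * r `^ Q)%:E)).
  by apply: lee_wpmul2l => //; rewrite lee_fin ltW.
rewrite -EFinM lee_fin /kk.
have Fr : (F u * r `^ Q <= k)%R by rewrite -ler_pdivlMr// -powRN.
have -> : (F u * k / Y * (C6 * r `^ Q) = (F u * r `^ Q) * (k * C6) / Y)%R by ring.
rewrite ler_pdivrMr// mul1r.
apply: (@le_trans _ _ (k * (k * C6))%R).
  by rewrite ler_wpM2r// mulr_ge0// ltW.
by rewrite mulrA -expr2 lerDl.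
Qed.

End bmo.

(** * Passage to generalized Orlicz-Morrey norms *)

Lemma homogeneous_ahlfors (R : realType) (disp : measure_display)
    (X : topMeasurableType disp) (d : X -> X -> R)
    (mu : {measure set X -> \bar R}) (K1 K2 K3 Q : R) :
  homogeneous_type d mu K1 K2 -> (0 < Q)%R -> (1 <= K3)%R ->
  homogeneous_dim d mu Q K3 -> ahlfors_space d mu K1 Q K3.
Proof.
move=> hX Q0 K31 hdim; split => //.
- exact: (ht_K1 hX).
- exact: (ht_ge0 hX).
- by move=> x; apply/(ht_eq0 hX).
- exact: (ht_sym hX).
- exact: (ht_triangle hX).
- by move=> x A /(ht_nbhs hX).
- exact: (ht_measurable hX).
Qed.

Lemma BMO_oscillation (R : realType) (disp : measure_display)
    (X : topMeasurableType disp) (d : X -> X -> R)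
    (mu : {measure set X -> \bar R}) (K Q D : R) (b : X -> R) :
  ahlfors_space d mu K Q D -> BMO d mu b ->
  exists2 beta, (0 <= beta)%R & forall x r, (0 < r)%R ->
    \int[mu]_(y in qball d x r) `|b y - avg d mu b x r|%:E <=
    (beta * r `^ Q)%:E.
Proof.
move=> hs [_ hb].
have D0 : (0 < D)%R by exact: lt_le_trans (rs_D hs).
exists (Num.max 0 (fine (BMO_norm d mu b)) * D)%R.
  by rewrite mulr_ge0 ?le_max ?lexx ?(ltW D0).
move=> x r r0; set I := \int[mu]_(y in _) _.
have I0 : 0 <= I by exact: integral_ge0.
have [M [M0 ME _ _]] := mu_qballE hs x r0.
have hI : (M^-1)%:E * I <= BMO_norm d mu b.
  apply: ereal_sup_ubound; exists x, r; split => //.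
  by rewrite ME inver gt_eqF.
have n0 : 0 <= BMO_norm d mu b.
  by apply: le_trans hI; rewrite mule_ge0// lee_fin invr_ge0 ltW.
move: n0 hb hI; case: (BMO_norm d mu b) => [n| |]//= n0 _.
rewrite lee_pdivrMl// => /le_trans; apply.
rewrite lee_fin in n0; rewrite -EFinM lee_fin max_r// mulrC -mulrA ler_wpM2l//.
by rewrite -lee_fin -ME; apply: (mu_qball_le hs); exact: ltW.
Qed.

(** Membership only makes the restrictions to balls measurable; countably many balls around [x]
    exhaust the space. *)
Lemma measurable_of_orlicz_loc (R : realType) (disp : measure_display)
    (X : topMeasurableType disp) (d : X -> X -> R)
    (mu : {measure set X -> \bar R}) (K Q D : R) (Phi : R -> \bar R)
    (f : X -> R) (x : X) :
  ahlfors_space d mu K Q D -> orlicz_loc d mu Phi f -> measurable_fun setT f.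
Proof.
move=> hs hf.
have -> : [set: X] = \bigcup_n qball d x n%:R.
  apply/seteqP; split => // y _; exists (Num.truncn (d x y)).+1 => //.
  by rewrite /qball/= truncnS_gt// num_real.
apply/measurable_fun_bigcup => [n|n]; first exact: (measurable_qball hs).
have [->|n0] := eqVneq n 0%N.
  by rewrite (qball_le0 hs)//; exact: measurable_fun_set0.
have n_gt0 : (0 < n%:R :> R)%R by rewrite ltr0n lt0n.
have [[mf _] _] := hf x _ n_gt0.
by apply/(measurable_restrictT _ _).2 => //; exact: (measurable_qball hs).
Qed.

Lemma ess_inf_above_ge (R : realType) (t : R) (g : R -> \bar R) (e : \bar R) :
  (forall s, (t < s)%R -> e <= g s) -> e <= ess_inf_above t g.
Proof.
move=> eg; apply: ereal_sup_ubound.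
exists (~` `]t, +oo[%classic); split.
- exact: measurableC.
- rewrite /mrestr; transitivity (@lebesgue_measure R set0); last exact: measure0.
  by congr (lebesgue_measure _); exact: setICl.
- by move=> s /= hs; rewrite in_itv/= andbT => ts; apply: hs; exact: eg.
Qed.

Theorem theorem4p9 (R : realType) (disp : measure_display)
    (X : topMeasurableType disp) (d : X -> X -> R)
    (mu : {measure set X -> \bar R}) (K1 K2 K3 Q : R)
    (hX : homogeneous_type d mu K1 K2)
    (muX : mu [set: X] = +oo)
    (dense : Cc_dense_L1 mu)
    (hQ : (0 < Q)%R) (hK3 : (1 <= K3)%R)
    (hdim : homogeneous_dim d mu Q K3)
    (Phi : R -> \bar R) (hPhi : young_function Phi)
    (hDelta2 : Delta2 Phi) (hnabla2 : nabla2 Phi)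
    (b : X -> R) (hb : BMO d mu b)
    (phi1 phi2 : R -> R)
    (mphi1 : lebesgue_measurable_fun `]0%R, +oo[ phi1)
    (mphi2 : lebesgue_measurable_fun `]0%R, +oo[ phi2)
    (phi1_gt0 : forall r : R, (0 < r)%R -> (0 < phi1 r)%R)
    (phi2_gt0 : forall r : R, (0 < r)%R -> (0 < phi2 r)%R)
    (C : R) (hC : (0 < C)%R)
    (hphi : forall r : R, (0 < r)%R ->
      ereal_sup [set (1 + ln (t / r))%:E *
          young_inv Phi (t `^ (- Q))%:E *
          ess_inf_above t
            (fun s => (phi1 s)%:E / young_inv Phi (s `^ (- Q))%:E)
        | t in [set t : R | (r < t)%R]]
      <= (C * phi2 r)%:E) :
  bounded_operator (orlicz_morrey d mu Phi phi1)
    (fun f => orlicz_morrey_norm d mu Phi phi1 (EFin \o f))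
    (orlicz_morrey_norm d mu Phi phi2)
    (maximal_commutator d mu b).

have hs := homogeneous_ahlfors hX hQ hK3 hdim.
have mb : measurable_fun setT b by case: hb => [[]].
have [beta beta0 osc] := BMO_oscillation hs hb.
have [F [N [L [p hF]]]] := young_doubling hPhi hDelta2 hnabla2.
have K30 : (0 < K3)%R by exact: lt_le_trans hK3.
have L1 := dy_L hF; have L0 : (0 < L)%R by exact: lt_le_trans L1.
have k1 := dy_k_ge1 hF.
set k := (L * 2 ^+ N)%R in k1.
have k0 : (0 < k)%R by exact: lt_le_trans k1.
pose V t := fine (young_inv Phi (t `^ (- Q))%:E).
have hV0 t : (0 < t)%R -> quasi_inverse (F := F) (N := N) (L := L) (t `^ (- Q)) (V t)
    /\ young_inv Phi (t `^ (- Q))%:E = (V t)%:E.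
  move=> t0; have [u qu uE] := young_invE hPhi hF (powR_gt0 (- Q) t0).
  by rewrite /V uE.
have hV t (t0 : (0 < t)%R) := (hV0 t t0).1.
have VE t (t0 : (0 < t)%R) := (hV0 t t0).2.
have [C0 C00 hball] := ball_estimate hs dense beta0 mb osc hPhi hF hV.
(* The loss when the inverse of Phi at 1/mu(B x r) is exchanged with its value at r^(-Q). *)
pose c1 := (L * k ^+ 2 * K3)%R.
have c10 : (0 < c1)%R by exact: mulr_gt0 (mulr_gt0 L0 (exprn_gt0 2 k0)) K30.
have hU x r : (0 < r)%R -> exists U, [/\ (0 < U)%R,
    young_inv Phi (mu (qball d x r))^-1 = U%:E, (U <= c1 * V r)%R &
    (V r <= c1 * U)%R].
  move=> r0; have [M [M0 -> M1 M2]] := mu_qballE hs x r0.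
  rewrite inver gt_eqF//.
  have Mi : (0 < M^-1)%R by rewrite invr_gt0.
  have rQ : (0 < r `^ (- Q))%R by exact: powR_gt0.
  have [U qU ->] := young_invE hPhi hF Mi.
  exists U; split => //; first by case: qU.
  - exact: (quasi_inverse_le hF rQ qU (hV r r0) hK3 M1).
  - exact: (quasi_inverse_le hF Mi (hV r r0) qU hK3 M2).
pose Cf := (c1 * (C0 * (2 * C * c1)))%R.
have Cf0 : (0 < Cf)%R.
  exact: mulr_gt0 c10 (mulr_gt0 C00 (mulr_gt0 (mulr_gt0 (ltr0n _ 2) hC) c10)).
exists Cf => // f [floc fnorm].
apply: ge_ereal_sup => _ [x [r [r0 ->]]].
have mf := measurable_of_orlicz_loc x hs floc.
set n1 := orlicz_morrey_norm d mu Phi phi1 (EFin \o f) in fnorm *.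
have n1_ge0 : 0 <= n1.
  apply: le_ereal_sup_tmp; eexists; first by exists x, r; split.
  have [U [U0 -> _ _]] := hU x r r0.
  rewrite !mule_ge0 ?luxemburg_ge0// lee_fin ?invr_ge0 ltW//.
  exact: phi1_gt0.
have n1E : n1 = (fine n1)%:E by rewrite fineK// ge0_fin_numE.
have [U [U0 UE UV _]] := hU x r r0.
rewrite UE; have p20 := phi2_gt0 r r0.
(* The norm of f may be 0, so it is replaced by a positive bound A whose excess is arbitrarily
   small. *)
suff main A : (0 < A)%R -> n1 <= A%:E ->
    ((phi2 r)^-1)%:E * U%:E *
      luxemburg_norm mu Phi (maximal_commutator d mu b f \_ (qball d x r)) <=
    (Cf * A)%:E.
  rewrite n1E -EFinM; apply/lee_addgt0Pr => e e0.
  have -> : (Cf * fine n1)%:E + e%:E = (Cf * (fine n1 + e / Cf))%:E.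
    by rewrite -EFinD; congr EFin; field; rewrite gt_eqF.
  apply: main; first by rewrite ltr_wpDl ?fine_ge0// divr_gt0.
  by rewrite n1E lee_fin lerDl divr_ge0// ltW.
move=> A0 n1A.
(* The factor 2 produces the strict inequality that [luxemburg_lt] asks for. *)
pose S := (2 * C * phi2 r * (A * c1))%R.
have Ac0 : (0 < A * c1)%R by exact: mulr_gt0.
have S0 : (0 < S)%R.
  exact: mulr_gt0 (mulr_gt0 (mulr_gt0 (ltr0n _ 2) hC) p20) Ac0.
have lux_s s : (0 < s)%R ->
    luxemburg_norm mu Phi ((EFin \o f) \_ (qball d x s)) <=
    (A * c1 * (phi1 s / V s))%:E.
  move=> s0; have [V0 _ _] := hV s s0.
  have p10 := phi1_gt0 s s0.
  have [W [W0 WE _ VW]] := hU x s s0.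
  have : ((phi1 s)^-1)%:E * W%:E *
      luxemburg_norm mu Phi ((EFin \o f) \_ (qball d x s)) <= A%:E.
    by apply: le_trans n1A; apply: ereal_sup_ubound; exists x, s; rewrite WE.
  rewrite -EFinM -[((phi1 s)^-1 * W)%R]invrK lee_pdivrMl ?invr_gt0 ?mulr_gt0 ?invr_gt0//.
  move=> /le_trans; apply; rewrite -EFinM lee_fin invfM invrK.
  have -> : (phi1 s / W * A = A * phi1 s * W^-1)%R by ring.
  have -> : (A * c1 * (phi1 s / V s) = A * phi1 s * (c1 / V s))%R by ring.
  rewrite ler_wpM2l ?mulr_ge0 ?(ltW A0) ?(ltW p10)//.
  by rewrite ler_pdivlMr// mulrC ler_pdivrMr.
have lux_t t : (r < t)%R ->
    luxemburg_norm mu Phi ((EFin \o f) \_ (qball d x t)) <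
    (S / ((1 + ln (t / r)) * V t))%:E.
  move=> rt; have t0 : (0 < t)%R by exact: lt_trans rt.
  have [V0 _ _] := hV t t0.
  set lt := (1 + ln (t / r))%R.
  have lt0 : (0 < lt)%R.
    by rewrite ltr_pwDl// ln_ge0// ler_pdivlMr// mul1r ltW.
  set Lt := luxemburg_norm _ _ _.
  (* The norm over B x t is at most the norm over each larger ball B x s, hence lies below all the
     values whose essential infimum is taken. *)
  have e1 : ((A * c1)^-1)%:E * Lt <= ess_inf_above t
      (fun s => (phi1 s)%:E / young_inv Phi (s `^ (- Q))%:E).
    apply: ess_inf_above_ge => s ts.
    have s0 : (0 < s)%R by exact: lt_trans ts.
    have [Vs0 _ _] := hV s s0.
    rewrite VE// inver gt_eqF// -EFinM lee_pdivrMl//.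
    apply: le_trans (lux_s s s0); apply: (luxemburg_subset hPhi hF).
    by move=> y /lt_trans; apply.
  have e2 : lt%:E * (V t)%:E * (((A * c1)^-1)%:E * Lt) <= (C * phi2 r)%:E.
    apply: le_trans (hphi r r0); apply: le_ereal_sup_tmp.
    eexists; first by exists t.
    rewrite VE//; apply: lee_wpmul2l => //.
    by rewrite -EFinM lee_fin mulr_ge0 ?(ltW lt0) ?(ltW V0).
  have ltV : (0 < lt * V t)%R by exact: mulr_gt0.
  have e3 : Lt <= (C * phi2 r * (A * c1) / (lt * V t))%:E.
    move: e2; rewrite muleA -!EFinM.
    rewrite -[(lt * V t / (A * c1))%R]invrK lee_pdivrMl ?invr_gt0 ?divr_gt0//.
    move=> /le_trans; apply; rewrite -EFinM lee_fin invf_div le_eqVlt.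
    by apply/orP; left; apply/eqP; ring.
  apply: le_lt_trans e3 _; rewrite lte_fin ltr_pM2r ?invr_gt0//.
  rewrite /S -!mulrA ltr_pMl ?ltr1n//.
  exact: mulr_gt0 hC (mulr_gt0 p20 Ac0).
have hyp t : (r < t)%R -> \int[mu]_(z in qball d x t)
    (F (`|f z| / (S / ((1 + ln (t / r)) * V t))))%:E <= 1.
  by move=> rt; exact: (luxemburg_lt hPhi hF (lux_t t rt)).
have := hball f x r S r0 S0 mf hyp => hl.
have [V0 _ _] := hV r r0.
apply: (@le_trans _ _ (((phi2 r)^-1)%:E * U%:E * (C0 * S / V r)%:E)).
  by apply: lee_wpmul2l => //; rewrite -EFinM lee_fin mulr_ge0 ?invr_ge0 ?(ltW U0) ?(ltW p20).
rewrite -!EFinM lee_fin.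
apply: (@le_trans _ _ ((phi2 r)^-1 * (c1 * V r) * (C0 * S / V r))%R).
  have ge0 : (0 <= C0 * S / V r)%R.
    exact: ltW (divr_gt0 (mulr_gt0 C00 S0) V0).
  by rewrite ler_wpM2r// ler_wpM2l// invr_ge0 ltW.
rewrite le_eqVlt; apply/orP; left; apply/eqP; rewrite /Cf /S; field.
by rewrite !gt_eqF.
Qed.
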